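(* Let $U\subset\mathbb{C}^n$ be open and $x\in\mathbb{C}^n$. Then the following conditions are equivalent: (i) $U$ is non-thin at $x$; (ii) for every $\epsilon>0$ and every neighbourhood $V$ of $x$ there is $f\in\mathcal{O}(\overline{\mathbb{D}},V)$ such that $f(0)=x$ and $$\sigma\bigl(\mathbb{T}\cap f^{-1}(V\cap U)\bigr)>1-\epsilon.$$
   Context: $\mathbb{D}$ is the open unit disc in $\mathbb{C}$, $\mathbb{T}$ the unit circle, and $\sigma$ the arc length measure on $\mathbb{T}$ normalized so that $\sigma(\mathbb{T})=1$. $\mathcal{O}(\overline{\mathbb{D}},V)$ is the set of maps $f$ holomorphic on a neighbourhood of $\overline{\mathbb{D}}$ with $f(\overline{\mathbb{D}})\subset V$. A set $Y\subset\mathbb{C}^n$ is non-thin at $x\in\mathbb{C}^n$ if $x\in\overline{Y\setminus\{x\}}$ and, for every plurisubharmonic function $u$ defined on a neighbourhood of $x$, $$\limsup_{z\to x,\ z\in Y\setminus\{x\}}u(z)=u(x),$$ where $\limsup_{z\to x,\ z\in E}u(z)=\inf_{r>0}\sup\{u(z): z\in\overline{B}(x,r)\cap E\}$. The constant function $-\infty$ is considered plurisubharmonic. *)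

(* Defs.v *)
From HB Require Import structures.
From mathcomp Require Import all_boot all_order all_algebra.
From mathcomp Require Import all_classical all_reals all_analysis.
From mathcomp Require Import complex.
Set Implicit Arguments.
Unset Strict Implicit.
Unset Printing Implicit Defensive.
Import Order.TTheory GRing.Theory Num.Theory.
Import numFieldNormedType.Exports.
Local Open Scope classical_set_scope.
Local Open Scope ring_scope.

(* [R[i]] carries in the library a module structure over [R], so the topology
   and the normed module structure of [C] over itself are not inferred from the
   key [complex]; they are inferred from the packed numClosedFieldType. *)
Definition Cx (R : realType) : numClosedFieldType := R[i].

(* e^(i t) *)
Definition expi (R : realType) (t : R) : Cx R := Complex (cos t) (sin t).

Definition closed_disc (R : realType) (a : Cx R) (r : R) : set (Cx R) :=
  [set z | `|z - a| <= r%:C%C].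

Definition unit_circle (R : realType) : set (Cx R) := [set z | `|z| = 1].

(* Normalized arc length: the image of dt / (2 pi) on [0, 2 pi[ by [expi]. *)
Definition arc_length (R : realType) (A : set (Cx R)) : \bar R :=
  (((2 * pi)^-1 : R)%:E *
   lebesgue_measure (`[0%R, (2 * pi)%R[%classic `&` (@expi R) @^-1` A))%E.

Definition circle_mean (R : realType) (g : Cx R -> \bar R) (a : Cx R) (r : R)
    : \bar R :=
  (((2 * pi)^-1 : R)%:E *
   \int[lebesgue_measure]_(t in `[0%R, (2 * pi)%R])
     g (a + r%:C%C * expi t)%R)%E.

Definition usc_on (R : realType) (T : topologicalType) (W : set T)
    (u : T -> \bar R) : Prop :=
  forall z, W z -> forall c : R,
    (u z < c%:E)%E -> \forall y \near z, (u y < c%:E)%E.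

(* As with all functions on an open set below, [g] is a total function whose
   values outside [D] are irrelevant.  On a circle contained in [D] the upper
   semicontinuous [g] is bounded above, so its integral is well defined in
   [-oo, +oo[. The function -oo is subharmonic. *)
Definition subharmonic (R : realType) (D : set (Cx R)) (g : Cx R -> \bar R)
    : Prop :=
  [/\ forall z, D z -> (g z < +oo)%E,
      usc_on D g &
      forall (a : Cx R) (r : R), 0 < r -> closed_disc a r `<=` D ->
        (g a <= circle_mean g a r)%E].

Definition plurisubharmonic (R : realType) (n : nat) (W : set 'rV[Cx R]_n)
    (u : 'rV[Cx R]_n -> \bar R) : Prop :=
  [/\ forall z, W z -> (u z < +oo)%E,
      usc_on W u &
      forall a b : 'rV[Cx R]_n,
        subharmonic [set l : Cx R | W (a + l *: b)]
                    (fun l => u (a + l *: b))].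

(* The library norm on row vectors is the sup norm, hence the explicit
   Euclidean ball. *)
Definition eball (R : realType) (n : nat) (x : 'rV[Cx R]_n) (r : R)
    : set 'rV[Cx R]_n :=
  [set z | \sum_(i < n) `|z ord0 i - x ord0 i| ^+ 2 <= (r ^+ 2)%:C%C].

(* Only small radii matter: if [u] is meaningful only near [x], its other
   values do not contribute. *)
Definition limsup_in (R : realType) (n : nat) (u : 'rV[Cx R]_n -> \bar R)
    (E : set 'rV[Cx R]_n) (x : 'rV[Cx R]_n) : \bar R :=
  ereal_inf [set ereal_sup (u @` (eball x r `&` E)) | r in [set r : R | 0 < r]].

Definition nonthin (R : realType) (n : nat) (Y : set 'rV[Cx R]_n)
    (x : 'rV[Cx R]_n) : Prop :=
  closure (Y `\ x) x /\
  forall (W : set 'rV[Cx R]_n) (u : 'rV[Cx R]_n -> \bar R),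
    open W -> W x -> plurisubharmonic W u -> limsup_in u (Y `\ x) x = u x.

Definition holomorphic_on (R : realType) (n : nat) (W : set (Cx R))
    (f : Cx R -> 'rV[Cx R]_n) : Prop :=
  forall z, W z -> derivable f z 1.

(* O(closed unit disc, V) *)
Definition holo_closed_disc (R : realType) (n : nat) (V : set 'rV[Cx R]_n)
    (f : Cx R -> 'rV[Cx R]_n) : Prop :=
  (exists2 W : set (Cx R), open W /\ closed_disc 0 1 `<=` W &
     holomorphic_on W f) /\
  f @` closed_disc 0 1 `<=` V.

(* Main.v *)
Require Import Defs.
From mathcomp Require Import all_boot all_order all_algebra.
From mathcomp Require Import all_classical all_reals all_analysis.
From mathcomp Require Import complex.
From mathcomp Require Import measurable_realfun ring lra.
Set Implicit Arguments.
Unset Strict Implicit.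
Unset Printing Implicit Defensive.
Import Order.TTheory GRing.Theory Num.Theory.
Import numFieldNormedType.Exports.
Local Open Scope classical_set_scope.
Local Open Scope ring_scope.

(** Both implications say that the behaviour of plurisubharmonic functions near [x]
is governed by means over the boundaries of small holomorphic discs through [x].

From discs to non-thinness.  Let [u] be plurisubharmonic near [x], with [u <= c]
on the part of [U] near [x], and suppose that [c < u x].  If [f] is a disc centred
at [x] whose boundary lies in [U] except for a set of arc length [eps], then the
sub-mean inequality for [u \o f] bounds [u x] by [c + (M - c) * eps], where [M] is
an upper bound of [u] near [x]; small [eps] is absurd.  Plurisubharmonicity speaks
of complex lines only, so the work is to pass from lines to discs.  The truncation
[w] of [u] from below is replaced by its sup-convolutions
[p |-> sup_y (w y - k * |p - y| ^ 2)], which are continuous and decrease to [w],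
and [supconv_holo_submean] shows that they satisfy the sub-mean inequality on
every holomorphic disc.  If one of them, composed with [f], violated it, then
subtracting the real part of a polynomial that approximates its boundary values
(lemma [trig_approx]) and adding a small multiple of [|z| ^ 2] would give a function with
an interior maximum at some [z0]; freezing a point [y0] that almost realizes the
supremum there, and expanding the square, bounds [w] on the line
[y0 + h *: f' z0] by [w y0 - delta + Re G h] for small [h], with [G]
holomorphic and [G 0 = 0], against the sub-mean inequality on that line.
The complex analysis needed is the mean value property, which [mean_value] gets
from Goursat's bisection applied to [g (exp (s + i t))].

From non-thinness to discs, after Poletsky.  In a ball around [x], let
[disc_value p] be the supremum of the means of [chi \o f] over polynomial discs
[f] centred at [p] with boundary in the ball, and over Lipschitz cutoffs [chi] of
[U].  Its opposite is plurisubharmonic (lemma [disc_value_psh]), and equals -1 on [U] by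
constant discs.  Non-thinness forces the value -1 at [x], so some disc centred
at [x] has a mean close to 1, and spends most of its boundary in [U].
The crux is the super-mean inequality of [disc_value] on a line
[l |-> a + l *: b] (lemma [glue_discs]).  Discs centred at the points of the circle
[a + z *: b], [|z| = 1], may be chosen constant, up to translation, on finitely
many arcs.  They are glued into one polynomial disc centred at [a]: at [exp (i t)]
it takes the value of a weighted mean of the discs centred at
[a + exp (i t) *: b], evaluated at the quickly rotating point
[c * exp (i (N + 1) t)].  The weights are powers of [(1 + cos (t - t_j)) / 2],
normalized; they sum to 1, are trigonometric polynomials of degree [N], and
concentrate on the arc that contains [t].  The average over rotations [c] by roots
of unity turns the values at the rotating point into means over the small discs,
so the average of the resulting functionals is almost the mean of [disc_value] over
the circle, and each of them is at most [disc_value a]. *)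

(** * Norms over the complex field with real values *)

(** The norm of a normed space over [Cx R] has its values in [Cx R]; this is the
same number read in [R], where it can be compared and averaged. *)
Definition rnorm (R : realType) (V : normedZmodType (Cx R)) (v : V) : R :=
  complex.Re `|v|.

Section Rnorm.
Context (R : realType) (V : normedZmodType (Cx R)).
Implicit Types v w : V.

Lemma rnormE v : `|v| = (rnorm v)%:C%C.
Proof. by rewrite /rnorm RRe_real // ger0_real. Qed.

Lemma rnorm_ge0 v : 0 <= rnorm v.
Proof. by rewrite -ler0c -rnormE. Qed.

Lemma rnorm0 : rnorm (0 : V) = 0.
Proof. by rewrite /rnorm normr0. Qed.

Lemma rnormN v : rnorm (- v) = rnorm v.
Proof. by rewrite /rnorm normrN. Qed.

Lemma rdistC v w : rnorm (v - w) = rnorm (w - v).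
Proof. by rewrite /rnorm distrC. Qed.

Lemma ler_rnormD v w : rnorm (v + w) <= rnorm v + rnorm w.
Proof. by rewrite -lecR rmorphD /= -!rnormE ler_normD. Qed.

Lemma rnorm_eq0 v : rnorm v = 0 -> v = 0.
Proof. by move=> h; apply/normr0_eq0; rewrite rnormE h. Qed.

Lemma ler_rdistD u v w : rnorm (v - w) <= rnorm (v - u) + rnorm (u - w).
Proof. by rewrite (_ : v - w = (v - u) + (u - w)) ?ler_rnormD // addrA subrK. Qed.

Lemma ler_rnormB v w : rnorm (v - w) <= rnorm v + rnorm w.
Proof. by rewrite -(rnormN w) ler_rnormD. Qed.

Lemma ler_rnorm_sum (I : Type) (r : seq I) (P : pred I) (F : I -> V) :
  rnorm (\sum_(i <- r | P i) F i) <= \sum_(i <- r | P i) rnorm (F i).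
Proof.
elim/big_rec2 : _ => [|i y x _ h]; first by rewrite rnorm0.
by rewrite (le_trans (ler_rnormD _ _))// lerD2l.
Qed.

Lemma ler_rdist v w : `|rnorm v - rnorm w| <= rnorm (v - w).
Proof.
have h1 := ler_rnormD (v - w) w; have h2 := ler_rnormD (w - v) v.
rewrite !subrK in h1 h2; rewrite rdistC in h2.
by rewrite ler_norml; apply/andP; split; lra.
Qed.

End Rnorm.

Lemma ltcR0 (R : realType) (r : R) : ((0 : Cx R) < r%:C%C) = (0 < r).
Proof. by rewrite -[0]/((0%:C)%C : Cx R) ltcR. Qed.

Section RnormC.
Context (R : realType).
Implicit Types z w : Cx R.

Lemma rnormM z w : rnorm (z * w) = rnorm z * rnorm w.
Proof. by apply: complexI; rewrite -rnormE normrM !rnormE rmorphM. Qed.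

Lemma rnormX z k : rnorm (z ^+ k) = rnorm z ^+ k.
Proof. by apply: complexI; rewrite -rnormE normrX !rnormE rmorphXn. Qed.

Lemma rnorm1 : rnorm (1 : Cx R) = 1.
Proof. by rewrite /rnorm normr1. Qed.

Lemma rnormR (r : R) : rnorm (r%:C%C : Cx R) = `|r|.
Proof. by rewrite /rnorm normc_def /= expr0n addr0 sqrtr_sqr. Qed.

Lemma rnorm_sqr z : rnorm z ^+ 2 = complex.Re z ^+ 2 + complex.Im z ^+ 2.
Proof. by apply: complexI; rewrite rmorphXn /= -rnormE add_Re2_Im2. Qed.

Lemma ReD z w : complex.Re (z + w) = complex.Re z + complex.Re w.
Proof. by case: z; case: w. Qed.

Lemma ReB z w : complex.Re (z - w) = complex.Re z - complex.Re w.
Proof. by case: z; case: w. Qed.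

Lemma ImB z w : complex.Im (z - w) = complex.Im z - complex.Im w.
Proof. by case: z; case: w. Qed.

Lemma ler_Re_rnorm z : `|complex.Re z| <= rnorm z.
Proof.
rewrite -ler_sqr ?nnegrE ?rnorm_ge0 ?normr_ge0//.
by rewrite rnorm_sqr real_normK ?num_real// lerDl sqr_ge0.
Qed.

Lemma ler_Im_rnorm z : `|complex.Im z| <= rnorm z.
Proof.
rewrite -ler_sqr ?nnegrE ?rnorm_ge0 ?normr_ge0//.
by rewrite rnorm_sqr real_normK ?num_real// lerDr sqr_ge0.
Qed.

Lemma rnormZ (n : nat) (z : Cx R) (v : 'rV[Cx R]_n) : rnorm (z *: v) = rnorm z * rnorm v.
Proof. by apply: complexI; rewrite -rnormE normrZ !rnormE rmorphM. Qed.

Lemma rnorm_row_lt (n : nat) (v : 'rV[Cx R]_n) (e : R) : 0 < e ->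
  rnorm v < e <-> forall i, rnorm (v ord0 i) < e.
Proof.
move=> e0.
have -> : (rnorm v < e) = `[< ball (0 : 'rV[Cx R]_n) (e%:C%C : Cx R) v >].
  by apply/idP/asboolP; rewrite mx_norm_ball /ball_ /= sub0r normrN rnormE ltcR.
split=> [/asboolP [_ h] i|h].
  have := h ord0 i; rewrite -ball_normE /ball_ /= mxE sub0r normrN.
  by rewrite -ltcR -rnormE.
apply/asboolP; split; first by rewrite ltcR0.
by move=> i j; rewrite ord1 -ball_normE /ball_ /= mxE sub0r normrN rnormE ltcR.
Qed.

Lemma rnorm_row_le (n : nat) (v : 'rV[Cx R]_n) (e : R) : 0 <= e ->
  rnorm v <= e <-> forall i, rnorm (v ord0 i) <= e.
Proof.
move=> e0; split=> [h i|h].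
  apply/ler_addgt0Pr => d d0; apply/ltW.
  by apply: (rnorm_row_lt v _).1; [lra|lra].
rewrite leNgt; apply/negP => ve.
suff : rnorm v < rnorm v by rewrite ltxx.
by apply/rnorm_row_lt => [|i]; [lra|exact: le_lt_trans (h i) ve].
Qed.

Lemma rnorm_coord (n : nat) (v : 'rV[Cx R]_n) i : rnorm (v ord0 i) <= rnorm v.
Proof. by apply: (rnorm_row_le v (rnorm_ge0 v)).1. Qed.

Lemma nbhs_rnormP (V : normedModType (Cx R)) (x : V) (A : set V) :
  nbhs x A <-> exists2 e : R, 0 < e & forall y, rnorm (y - x) < e -> A y.
Proof.
split=> [/nbhs_ballP[e /= e0 h]|[e e0 h]].
  have er : e = (complex.Re e)%:C%C by rewrite RRe_real// gtr0_real.
  exists (complex.Re e); first by rewrite -ltcR0 -er.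
  move=> y xy; apply: h; rewrite -ball_normE /ball_ /= distrC rnormE er ltcR.
  exact: xy.
apply/nbhs_ballP; exists (e%:C%C : Cx R) => /=; first by rewrite ltcR0.
by move=> y; rewrite -ball_normE /ball_ /= distrC rnormE ltcR => /h.
Qed.

Lemma continuous_rnormP (V W : normedModType (Cx R)) (f : V -> W) (x : V) :
  {for x, continuous f} <->
  forall e : R, 0 < e -> exists2 d : R, 0 < d &
    forall y, rnorm (y - x) < d -> rnorm (f y - f x) < e.
Proof.
split=> [h e e0|h A /nbhs_rnormP[e e0 eA]].
  by have /nbhs_rnormP := h [set w | rnorm (w - f x) < e]
    ((nbhs_rnormP _ _).2 (ex_intro2 _ _ e e0 (fun y hy => hy))).
have [d d0 hd] := h e e0; apply/nbhs_rnormP; exists d => // y /hd; exact: eA.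
Qed.

Lemma continuous_RCP (W : normedModType (Cx R)) (f : R -> W) (x : R) :
  {for x, continuous f} <->
  forall e : R, 0 < e -> exists2 d : R, 0 < d &
    forall y, `|y - x| < d -> rnorm (f y - f x) < e.
Proof.
split=> [h e e0|h A /nbhs_rnormP[e e0 eA]].
  have /nbhs_ballP[d d0 hd] := h [set w | rnorm (w - f x) < e]
    ((nbhs_rnormP _ _).2 (ex_intro2 _ _ e e0 (fun y hy => hy))).
  exists d => // y; rewrite distrC => xy; apply: hd.
  by rewrite -ball_normE /ball_ /=.
have [d d0 hd] := h e e0; apply/nbhs_ballP; exists d => // y.
by rewrite -ball_normE /ball_ /= distrC => /hd; exact: eA.
Qed.

Lemma continuous_CRP (V : normedModType (Cx R)) (f : V -> R) (x : V) :
  {for x, continuous f} <->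
  forall e : R, 0 < e -> exists2 d : R, 0 < d &
    forall y, rnorm (y - x) < d -> `|f y - f x| < e.
Proof.
split=> [h e e0|h A /nbhs_ballP[e e0 eA]].
  have hb : nbhs (f x) (ball (f x) e) by exact: nbhsx_ballx.
  have /nbhs_rnormP[d d0 hd] := h _ hb.
  exists d => // y /hd; rewrite /= -ball_normE /ball_ /=.
  by rewrite distrC.
have [d d0 hd] := h e e0; apply/nbhs_rnormP; exists d => // y /hd hy.
by apply: eA; rewrite -ball_normE /ball_ /= distrC.
Qed.

Lemma continuous_RRP (f : R -> R) (x : R) :
  {for x, continuous f} <->
  forall e : R, 0 < e -> exists2 d : R, 0 < d &
    forall y, `|y - x| < d -> `|f y - f x| < e.
Proof.
split=> [h e e0|h A /nbhs_ballP[e e0 eA]].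
  have hb : nbhs (f x) (ball (f x) e) by exact: nbhsx_ballx.
  have /nbhs_ballP[d d0 hd] := h _ hb.
  exists d => // y; rewrite distrC => xy.
  have : ball (f x) e (f y) by apply: hd; rewrite -ball_normE.
  by rewrite -ball_normE /ball_ /= distrC.
have [d d0 hd] := h e e0; apply/nbhs_ballP; exists d => // y.
rewrite -ball_normE /ball_ /= distrC => /hd hy.
by apply: eA; rewrite -ball_normE /ball_ /= distrC.
Qed.

Lemma continuous_Re : continuous (fun z : Cx R => complex.Re z).
Proof.
move=> z; apply/continuous_CRP => e e0; exists e => // y.
by rewrite -raddfB/=; exact/le_lt_trans/ler_Re_rnorm.
Qed.

Lemma continuous_expi : continuous (@expi R).
Proof.
move=> t; apply/continuous_RCP => e e0.
have e20 : 0 < e / 2 by rewrite divr_gt0.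
have /continuous_RRP/(_ _ e20)[d1 d10 h1] := @continuous_cos R t.
have /continuous_RRP/(_ _ e20)[d2 d20 h2] := @continuous_sin R t.
exists (Num.min d1 d2); first by rewrite lt_min d10.
move=> s; rewrite lt_min => /andP[/h1 c1 /h2 c2].
rewrite -ltr_sqr ?nnegrE ?rnorm_ge0 ?(ltW e0)// rnorm_sqr/=.
have : (cos s - cos t) ^+ 2 < (e / 2) ^+ 2.
  by rewrite -[ltLHS]real_normK ?num_real// ltr_sqr ?nnegrE ?normr_ge0 ?(ltW e20).
have : (sin s - sin t) ^+ 2 < (e / 2) ^+ 2.
  by rewrite -[ltLHS]real_normK ?num_real// ltr_sqr ?nnegrE ?normr_ge0 ?(ltW e20).
nra.
Qed.

Lemma expiD (s t : R) : expi (s + t) = expi s * expi t.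
Proof. by apply/eqP; rewrite eq_complex /= cosD sinD eqxx/= addrC eqxx. Qed.

Lemma expi0 : expi (0 : R) = 1.
Proof. by rewrite /expi cos0 sin0. Qed.

Lemma expi2pi : expi (2 * pi : R) = 1.
Proof. by rewrite /expi mulr_natl cos2pi sin2pi. Qed.

Lemma expiX (t : R) k : expi t ^+ k = expi (t *+ k).
Proof.
elim: k => [|k ih]; first by rewrite expr0 mulr0n expi0.
by rewrite exprS ih mulrS expiD.
Qed.

Lemma rnorm_expi (t : R) : rnorm (expi t) = 1.
Proof.
apply/eqP; rewrite -(@eqrXn2 _ 2) ?rnorm_ge0// rnorm_sqr/= expr1n.
by rewrite cos2Dsin2.
Qed.

Lemma rdist_expi (s t : R) : rnorm (expi s - expi t) ^+ 2 = 2 - 2 * cos (s - t).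
Proof.
rewrite rnorm_sqr/= cosB.
have := cos2Dsin2 s; have := cos2Dsin2 t; nra.
Qed.

Lemma expi_surj (z : Cx R) : rnorm z = 1 ->
  exists2 t : R, 0 <= t < 2 * pi & z = expi t.
Proof.
case: z => x y /(congr1 (fun u => u ^+ 2)); rewrite rnorm_sqr/= expr1n => xy.
have xle : -1 <= x <= 1 by nra.
have [y0|y0] := lerP 0 y.
  exists (acos x); last first.
    rewrite /expi acosK// sin_acos//; congr Complex.
    by rewrite (_ : 1 - x ^+ 2 = y ^+ 2); [rewrite sqrtr_sqr ger0_norm|lra].
  by rewrite acos_ge0//=; have := acos_lepi xle; have := pi_gt0 R; lra.
exists (2 * pi - acos x).
  have := acos_lepi xle; have := pi_gt0 R; have := acos_ge0 xle.
  have : acos x != 0.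
    apply/eqP => h; have := acosK xle; rewrite h cos0 => x1.
    by move: xy; rewrite -x1; nra.
  by rewrite neq_lt => /orP[]; lra.
have e1 : cos (2 * pi - acos x) = x.
  by rewrite cosB mulr_natl cos2pi sin2pi mul1r mul0r addr0 acosK.
have e2 : sin (2 * pi - acos x) = y.
  rewrite sinB mulr_natl cos2pi sin2pi mul1r mul0r sub0r sin_acos//.
  rewrite (_ : 1 - x ^+ 2 = y ^+ 2); last lra.
  by rewrite sqrtr_sqr ltr0_norm// opprK.
by rewrite /expi e1 e2.
Qed.

Lemma closed_disc_polar (z : Cx R) : rnorm z <= 1 ->
  exists r t : R, [/\ 0 <= r <= 1, 0 <= t <= 2 * pi & z = r%:C%C * expi t].
Proof.
move=> z1; have [z0|z0] := eqVneq z 0.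
  exists 0, 0; split=> //; first by rewrite lexx/=.
    by rewrite lexx/= mulr_ge0// pi_ge0.
  by rewrite z0 mul0r.
have nz : rnorm z != 0 by apply: contra_neq z0; exact: rnorm_eq0.
have nz' : ((rnorm z)%:C%C : Cx R) != 0 by rewrite -[0]/((0%:C)%C) (inj_eq (@complexI R)).
have [|t /andP[t0 t1] zt] := @expi_surj (z / (rnorm z)%:C%C).
  apply: (mulIf nz); rewrite -{2}(ger0_norm (rnorm_ge0 z)) -rnormR -rnormM divfK//.
  by rewrite mul1r.
exists (rnorm z), t; split; first by rewrite rnorm_ge0.
  by rewrite t0 ltW.
by rewrite -zt mulrC divfK.
Qed.

End RnormC.

(** * Integrals of real functions over segments *)

Section Rint.
Context (R : realType).
Implicit Types (a b c : R) (f g : R -> R).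

Local Notation mu := (@lebesgue_measure R).

Definition rint a b f : R := \int[mu]_(t in `[a, b]%classic) f t.

Definition rintegrable a b f : Prop := mu.-integrable `[a, b]%classic (EFin \o f).

Lemma rintegrable_within a b f : {within `[a, b], continuous f} -> rintegrable a b f.
Proof. by move=> h; apply: continuous_compact_integrable => //; exact: segment_compact. Qed.

Lemma rintegrable_cont a b f : continuous f -> rintegrable a b f.
Proof. by move=> h; apply: rintegrable_within; exact: continuous_subspaceT. Qed.

Lemma within_RRP a b f :
  (forall x, a <= x <= b -> forall e : R, 0 < e -> exists2 d : R, 0 < d &
    forall y, a <= y <= b -> `|y - x| < d -> `|f y - f x| < e) ->
  {within `[a, b], continuous f}.
Proof.
move=> h; apply/subspace_continuousP => x; rewrite /= in_itv/= => xab.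
move=> A /nbhs_ballP[e /= e0 eA].
have [d d0 hd] := h x xab e e0.
apply/nbhs_ballP; exists d => // y.
rewrite -ball_normE /ball_ /= distrC => xy; rewrite in_itv/= => yab.
by apply: eA; rewrite -ball_normE /ball_ /= distrC; exact: hd.
Qed.

Lemma rintegrable_sub a b c d f : rintegrable a b f -> a <= c -> d <= b -> rintegrable c d f.
Proof.
move=> h ac db; apply: integrableS h => //.
by apply: subset_itv; rewrite bnd_simp.
Qed.

Lemma rintegrableD a b f g : rintegrable a b f -> rintegrable a b g -> rintegrable a b (fun x => f x + g x).
Proof. by move=> hf hg; apply: (integrableD _ hf hg). Qed.

Lemma rintegrableB a b f g : rintegrable a b f -> rintegrable a b g -> rintegrable a b (fun x => f x - g x).
Proof. by move=> hf hg; apply: (integrableB _ hf hg). Qed.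

Lemma rintegrable_cst a b c : rintegrable a b (fun=> c).
Proof. by apply: rintegrable_cont => x; exact: cst_continuous. Qed.

Lemma rintegrableZ a b c f : rintegrable a b f -> rintegrable a b (fun x => c * f x).
Proof. by move=> h; apply: (integrableZl _ c h). Qed.

Lemma rintegrable_sum a b (I : Type) (r : seq I) (F : I -> R -> R) :
  (forall i, rintegrable a b (F i)) -> rintegrable a b (fun x => \sum_(i <- r) F i x).
Proof.
move=> h; elim: r => [|i r ih].
  rewrite (_ : (fun x => _) = fun=> 0); first exact: rintegrable_cst.
  by rewrite funeqE => x; rewrite big_nil.
rewrite (_ : (fun x => _) = fun x => F i x + \sum_(j <- r) F j x); first exact: rintegrableD.
by apply: funext => x; rewrite big_cons.
Qed.

Lemma rintD a b f g : rintegrable a b f -> rintegrable a b g ->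
  rint a b (fun x => f x + g x) = rint a b f + rint a b g.
Proof. by move=> hf hg; rewrite /rint RintegralD. Qed.

Lemma rintB a b f g : rintegrable a b f -> rintegrable a b g ->
  rint a b (fun x => f x - g x) = rint a b f - rint a b g.
Proof. by move=> hf hg; rewrite /rint RintegralB. Qed.

Lemma rintZ a b c f : rintegrable a b f -> rint a b (fun x => c * f x) = c * rint a b f.
Proof. by move=> hf; rewrite /rint RintegralZl. Qed.

Lemma rint_cst a b c : a <= b -> rint a b (fun=> c) = c * (b - a).
Proof.
move=> ab; rewrite /rint (Rintegral_cst (@lebesgue_measure R))//.
have := @lebesgue_measure_itv R `[a, b]; rewrite /= lte_fin => h.
congr (_ * _); rewrite [X in fine X]h.
by move: ab; rewrite le_eqVlt => /predU1P[->|->//]; rewrite ltxx subrr.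
Qed.

Lemma rint_sum a b (I : Type) (r : seq I) (F : I -> R -> R) :
  (forall i, rintegrable a b (F i)) ->
  rint a b (fun x => \sum_(i <- r) F i x) = \sum_(i <- r) rint a b (F i).
Proof.
move=> h; elim: r => [|i r ih].
  rewrite big_nil (_ : (fun x => _) = fun=> 0 * 0); last first.
    by rewrite funeqE => x; rewrite big_nil mulr0.
  by rewrite rintZ ?mul0r//; exact: rintegrable_cst.
rewrite big_cons -ih -rintD//; last exact: rintegrable_sum.
by congr rint; apply: funext => x; rewrite big_cons.
Qed.

Lemma le_rint a b f g : rintegrable a b f -> rintegrable a b g ->
  (forall x, a <= x <= b -> f x <= g x) -> rint a b f <= rint a b g.
Proof.
by move=> hf hg h; apply: le_Rintegral => // x; rewrite /= in_itv/=; exact: h.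
Qed.

Lemma rint_split a b c f : rintegrable a c f -> a <= b <= c ->
  rint a c f = rint a b f + rint b c f.
Proof.
move=> h /andP[ab bc].
have := @Rintegral_itvB R f (BLeft a) (BRight c) b h.
rewrite !bnd_simp => /(_ ab bc) /eqP; rewrite subr_eq => /eqP.
rewrite /rint => ->; rewrite addrC; congr (_ + _).
by apply: Rintegral_itv_obnd_cbnd; apply: integrableS h => //; apply: subset_itv; rewrite bnd_simp.
Qed.

Lemma rint_close a b k M f : a <= b -> rintegrable a b f ->
  (forall x, a <= x <= b -> `|f x - k| <= M) ->
  `|rint a b f - k * (b - a)| <= M * (b - a).
Proof.
move=> ab h hM; rewrite -!rint_cst//.
have h1 : rint a b f <= rint a b (fun=> M + k).
  apply: le_rint => //; first exact: rintegrable_cst.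
  by move=> x /hM; rewrite ler_norml => /andP[]; lra.
have h2 : rint a b (fun=> k - M) <= rint a b f.
  apply: le_rint => //; first exact: rintegrable_cst.
  by move=> x /hM; rewrite ler_norml => /andP[]; lra.
by rewrite !rint_cst// in h1 h2 *; rewrite ler_norml; apply/andP; split; lra.
Qed.

End Rint.

(** * Goursat bisection on rectangles *)

Section Goursat.
Context (R : realType).
Implicit Types (P Q : R -> R -> R) (a b c d e s t p : R).

(** Differentiability of [P] and [Q] on a rectangle, the same number [p] serving as
the derivative of [P] in the first variable and of [Q] in the second: this is the
Cauchy-Riemann equation that makes the form [Q ds + P dt] closed. *)
Definition CR_on a b c d P Q : Prop :=
  forall s t, a <= s <= b -> c <= t <= d ->
  exists p p2 q1 : R, forall e, 0 < e -> exists2 dl : R, 0 < dl &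
  forall s' t', a <= s' <= b -> c <= t' <= d -> `|s' - s| < dl -> `|t' - t| < dl ->
    `|P s' t' - P s t - p * (s' - s) - p2 * (t' - t)| <= e * (`|s' - s| + `|t' - t|) /\
    `|Q s' t' - Q s t - q1 * (s' - s) - p * (t' - t)| <= e * (`|s' - s| + `|t' - t|).

(** The integral of [Q ds + P dt] over the boundary of a rectangle. *)
Definition defect P Q s0 s1 t0 t1 : R :=
  rint t0 t1 (P s1) - rint t0 t1 (P s0) - rint s0 s1 (Q^~ t1) + rint s0 s1 (Q^~ t0).

Lemma CR_within_t a b c d P Q (PQ : CR_on a b c d P Q) s : a <= s <= b -> {within `[c, d], continuous (P s)}.
Proof.
move=> sab; apply: within_RRP => t tcd e e0.
have [p [p2 [q1 h]]] := PQ _ _ sab tcd; have [dl dl0 hd] := h 1 ltr01.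
pose K := `|p2| + 1; have K0 : 0 < K by rewrite ltr_wpDl.
exists (Num.min dl (e / (K + 1))).
  by rewrite lt_min dl0 divr_gt0//; lra.
move=> t' t'cd; rewrite lt_min => /andP[tt1 tt2].
have := hd s t' sab t'cd; rewrite subrr normr0 => /(_ dl0 tt1)[+ _].
rewrite mulr0 subr0 add0r mul1r => h1.
rewrite ltr_pdivlMr in tt2; last lra.
have h2 : `|p2 * (t' - t)| = `|p2| * `|t' - t| by rewrite normrM.
have := ler_normD (P s t' - P s t - p2 * (t' - t)) (p2 * (t' - t)).
rewrite subrK h2 => h3; apply: le_lt_trans h3 _.
have := normr_ge0 (t' - t); rewrite /K in tt2; nra.
Qed.

Lemma CR_within_s a b c d P Q (PQ : CR_on a b c d P Q) t : c <= t <= d -> {within `[a, b], continuous (Q^~ t)}.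
Proof.
move=> tcd; apply: within_RRP => s sab e e0.
have [p [p2 [q1 h]]] := PQ _ _ sab tcd; have [dl dl0 hd] := h 1 ltr01.
exists (Num.min dl (e / (`|q1| + 1 + 1))).
  by rewrite lt_min dl0 divr_gt0//; have := normr_ge0 q1; lra.
move=> s' s'ab; rewrite lt_min => /andP[tt1 tt2].
have := hd s' t s'ab tcd; rewrite subrr normr0 => /(_ tt1 dl0)[_].
rewrite mulr0 subr0 addr0 mul1r => h1.
rewrite ltr_pdivlMr in tt2; last by have := normr_ge0 q1; lra.
have h2 : `|q1 * (s' - s)| = `|q1| * `|s' - s| by rewrite normrM.
have := ler_normD (Q s' t - Q s t - q1 * (s' - s)) (q1 * (s' - s)).
rewrite subrK h2 => h3; apply: le_lt_trans h3 _.
have := normr_ge0 (s' - s); nra.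
Qed.

Lemma CR_rintegrable_t a b c d P Q (PQ : CR_on a b c d P Q) s t0 t1 : a <= s <= b -> c <= t0 -> t1 <= d -> rintegrable t0 t1 (P s).
Proof. by move=> sab ct td; apply: (rintegrable_sub (rintegrable_within (CR_within_t PQ sab))). Qed.

Lemma CR_rintegrable_s a b c d P Q (PQ : CR_on a b c d P Q) t s0 s1 : c <= t <= d -> a <= s0 -> s1 <= b -> rintegrable s0 s1 (Q^~ t).
Proof. by move=> tcd ct td; apply: (rintegrable_sub (rintegrable_within (CR_within_s PQ tcd))). Qed.

Lemma defect_quarter a b c d P Q (PQ : CR_on a b c d P Q) s0 sm s1 t0 tm t1 : a <= s0 -> s0 <= sm <= s1 -> s1 <= b ->
  c <= t0 -> t0 <= tm <= t1 -> t1 <= d ->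
  defect P Q s0 s1 t0 t1 = defect P Q s0 sm t0 tm + defect P Q sm s1 t0 tm + defect P Q s0 sm tm t1 + defect P Q sm s1 tm t1.
Proof.
move=> h1 h2 h3 h4 h5 h6; have := h2; have := h5 => /andP[h7 h8] /andP[h9 h10].
rewrite /defect.
have sb : a <= s0 <= b by apply/andP; split; lra.
have sb' : a <= sm <= b by apply/andP; split; lra.
have sb'' : a <= s1 <= b by apply/andP; split; lra.
have tb : c <= t0 <= d by apply/andP; split; lra.
have tb' : c <= tm <= d by apply/andP; split; lra.
have tb'' : c <= t1 <= d by apply/andP; split; lra.
rewrite (rint_split (CR_rintegrable_t PQ sb'' h4 h6) h5) (rint_split (CR_rintegrable_t PQ sb h4 h6) h5).
rewrite (rint_split (CR_rintegrable_s PQ tb'' h1 h3) h2) (rint_split (CR_rintegrable_s PQ tb h1 h3) h2).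
lra.
Qed.

(** The affine parts of [P] and [Q] at [(s, t)] form a closed form and integrate to
zero, which leaves the differentiability error times the perimeter. *)
Lemma defect_local a b c d P Q (PQ : CR_on a b c d P Q) s t : a <= s <= b -> c <= t <= d -> forall e, 0 < e ->
  exists2 dl : R, 0 < dl & forall s0 s1 t0 t1,
  a <= s0 <= s -> s <= s1 <= b -> c <= t0 <= t -> t <= t1 <= d ->
  s1 - s0 < dl -> t1 - t0 < dl ->
  `|defect P Q s0 s1 t0 t1| <= e * (s1 - s0 + (t1 - t0)) ^+ 2.
Proof.
move=> sab tcd e e0; have [p [p2 [q1 h]]] := PQ _ _ sab tcd.
have e20 : 0 < e / 2 by rewrite divr_gt0.
have [dl dl0 hd] := h _ e20; exists dl => // s0 s1 t0 t1.
move=> /andP[as0 s0s] /andP[ss1 s1b] /andP[ct0 t0t] /andP[tt1 t1d] sd td.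
have sle : s0 <= s1 := le_trans s0s ss1.
have tle : t0 <= t1 := le_trans t0t tt1.
have s0ab : a <= s0 <= b by rewrite as0 (le_trans sle).
have s1ab : a <= s1 <= b by rewrite s1b (le_trans as0).
have t0cd : c <= t0 <= d by rewrite ct0 (le_trans tle).
have t1cd : c <= t1 <= d by rewrite t1d (le_trans ct0).
pose L := s1 - s0 + (t1 - t0).
have loc s' t' : s0 <= s' <= s1 -> t0 <= t' <= t1 ->
    `|P s' t' - P s t - p * (s' - s) - p2 * (t' - t)| <= e / 2 * L /\
    `|Q s' t' - Q s t - q1 * (s' - s) - p * (t' - t)| <= e / 2 * L.
  move=> /andP[u1 u2] /andP[u3 u4].
  have v1 : `|s' - s| <= s1 - s0.
    by clear -u1 u2 s0s ss1; rewrite ler_norml; apply/andP; split; lra.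
  have v2 : `|t' - t| <= t1 - t0.
    by clear -u3 u4 t0t tt1; rewrite ler_norml; apply/andP; split; lra.
  have [| | | |w1 w2] := hd s' t'.
  - by rewrite (le_trans as0) ?(le_trans u2).
  - by rewrite (le_trans ct0) ?(le_trans u4).
  - exact: le_lt_trans sd.
  - exact: le_lt_trans td.
  have le2 : e / 2 * (`|s' - s| + `|t' - t|) <= e / 2 * L.
    by rewrite ler_wpM2l ?(ltW e20)// lerD.
  by split; [exact: le_trans w1 le2|exact: le_trans w2 le2].
have r1 := CR_rintegrable_t PQ s1ab ct0 t1d; have r0 := CR_rintegrable_t PQ s0ab ct0 t1d.
have q1i := CR_rintegrable_s PQ t1cd as0 s1b; have q0i := CR_rintegrable_s PQ t0cd as0 s1b.
have A1 : `|rint t0 t1 (fun x => P s1 x - P s0 x) - p * (s1 - s0) * (t1 - t0)| <= e * L * (t1 - t0).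
  apply: rint_close => //; first exact: rintegrableB.
  move=> x xt; have [|w1 _] := loc s1 x _ xt; first by rewrite sle lexx.
  have [|w2 _] := loc s0 x _ xt; first by rewrite sle lexx.
  by clear -w1 w2; move: w1 w2; rewrite !ler_norml => /andP[? ?] /andP[? ?];
    apply/andP; split; lra.
have A2 : `|rint s0 s1 (fun x => Q x t1 - Q x t0) - p * (t1 - t0) * (s1 - s0)| <= e * L * (s1 - s0).
  apply: rint_close => //; first exact: rintegrableB.
  move=> x xt; have [|_ w1] := loc x t1 xt; first by rewrite tle lexx.
  have [|_ w2] := loc x t0 xt; first by rewrite tle lexx.
  by clear -w1 w2; move: w1 w2; rewrite !ler_norml => /andP[? ?] /andP[? ?];
    apply/andP; split; lra.
rewrite rintB// in A1; rewrite rintB// in A2.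
clear -A1 A2; move: A1 A2; rewrite /defect /L.
move: (rint _ _ _) (rint _ _ _) (rint _ _ _) (rint _ _ _) => i1 i2 i3 i4.
by rewrite !ler_norml => /andP[? ?] /andP[? ?]; apply/andP; split; lra.
Qed.

Definition halfpow n : R := (2 ^+ n)^-1.
Local Notation w := halfpow.

Lemma halfpowS n : w n.+1 = w n / 2.
Proof. by rewrite /halfpow exprS invfM mulrC. Qed.

Lemma halfpow_gt0 n : 0 < w n.
Proof. by rewrite invr_gt0 exprn_gt0. Qed.

Definition subbox a b c d n (st : R * R) :=
  [/\ a <= st.1, st.1 + (b - a) * w n <= b, c <= st.2 & st.2 + (d - c) * w n <= d].

Definition box_defect a b c d P Q n (st : R * R) := defect P Q st.1 (st.1 + (b - a) * w n) st.2 (st.2 + (d - c) * w n).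

(** The defect is additive over the four quarters, so one of them carries at least a
quarter of it. *)
Lemma box_step a b c d P Q (PQ : CR_on a b c d P Q) (ab : a <= b) (cd : c <= d) n st : subbox a b c d n st -> exists st' : R * R,
  [/\ subbox a b c d n.+1 st', st.1 <= st'.1, st'.1 + (b - a) * w n.+1 <= st.1 + (b - a) * w n,
     st.2 <= st'.2 & st'.2 + (d - c) * w n.+1 <= st.2 + (d - c) * w n] /\
     `|box_defect a b c d P Q n st| <= 4 * `|box_defect a b c d P Q n.+1 st'|.
Proof.
case: st => s t [/= h1 h2 h3 h4].
pose A := (b - a) * w n.+1; pose B := (d - c) * w n.+1.
have A0 : 0 <= A by rewrite mulr_ge0 ?subr_ge0// ltW// halfpow_gt0.
have B0 : 0 <= B by rewrite mulr_ge0 ?subr_ge0// ltW// halfpow_gt0.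
have A2 : (b - a) * w n = A + A by rewrite /A halfpowS; lra.
have B2 : (d - c) * w n = B + B by rewrite /B halfpowS; lra.
have quart : box_defect a b c d P Q n (s, t) = box_defect a b c d P Q n.+1 (s, t) + box_defect a b c d P Q n.+1 (s + A, t) +
    box_defect a b c d P Q n.+1 (s, t + B) + box_defect a b c d P Q n.+1 (s + A, t + B).
  rewrite /box_defect /= -/A -/B A2 B2 (addrA s A A) (addrA t B B); rewrite A2 in h2; rewrite B2 in h4.
  have sA : s <= s + A <= s + A + A by rewrite !lerDl A0.
  have tB : t <= t + B <= t + B + B by rewrite !lerDl B0.
  by rewrite addrA in h2; rewrite addrA in h4; rewrite (defect_quarter PQ h1 sA h2 h3 tB h4).
have key : exists2 st' : R * R, st' \in [:: (s, t); (s + A, t); (s, t + B); (s + A, t + B)] &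
    `|box_defect a b c d P Q n (s, t)| <= 4 * `|box_defect a b c d P Q n.+1 st'|.
  apply: contrapT => no.
  have nn st' : st' \in [:: (s, t); (s + A, t); (s, t + B); (s + A, t + B)] ->
      4 * `|box_defect a b c d P Q n.+1 st'| < `|box_defect a b c d P Q n (s, t)|.
    by move=> m; rewrite ltNge; apply/negP => le; apply: no; exists st'.
  have := nn (s, t); have := nn (s + A, t); have := nn (s, t + B); have := nn (s + A, t + B).
  rewrite !inE !eqxx ?orbT => /(_ isT) n1 /(_ isT) n2 /(_ isT) n3 /(_ isT) n4.
  have := ler_normD (box_defect a b c d P Q n.+1 (s, t) + box_defect a b c d P Q n.+1 (s + A, t) + box_defect a b c d P Q n.+1 (s, t + B)) (box_defect a b c d P Q n.+1 (s + A, t + B)).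
  have := ler_normD (box_defect a b c d P Q n.+1 (s, t) + box_defect a b c d P Q n.+1 (s + A, t)) (box_defect a b c d P Q n.+1 (s, t + B)).
  have := ler_normD (box_defect a b c d P Q n.+1 (s, t)) (box_defect a b c d P Q n.+1 (s + A, t)).
  rewrite -quart; clear -n1 n2 n3 n4; lra.
have [st' m le] := key; exists st'; split=> //.
rewrite -/A -/B /subbox /= -/A -/B A2 B2; rewrite A2 in h2; rewrite B2 in h4.
clear -A0 B0 A2 B2 h1 h2 h3 h4 m ab cd; move: m.
by rewrite !inE => /or4P[]/eqP-> /=; (split; [split|..]); lra.
Qed.

(** Bisection gives nested boxes whose defects decrease at most like their areas,
while [defect_local] at their common point makes these defects negligible with
respect to the areas. *)
Lemma goursat a b c d P Q (PQ : CR_on a b c d P Q) (ab : a <= b) (cd : c <= d) :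
  rint c d (P b) - rint c d (P a) = rint a b (Q^~ d) - rint a b (Q^~ c).
Proof.
suff : defect P Q a b c d = 0 by rewrite /defect; lra.
have w00 : w 0 = 1 by rewrite /halfpow expr0 invr1.
have box0 : subbox a b c d 0 (a, c) by split=> /=; rewrite ?w00; lra.
pose nxt n st := if pselect (subbox a b c d n st) is left h then projT1 (cid (box_step PQ ab cd h)) else st.
pose u := fix u n := if n is m.+1 then nxt m (u m) else (a, c).
have ubox n : subbox a b c d n (u n).
  elim: n => [//|n ih] /=; rewrite /nxt; case: pselect => // h.
  by case: cid => st' [[]].
have ustep n : [/\ (u n).1 <= (u n.+1).1, (u n.+1).1 + (b - a) * w n.+1 <= (u n).1 + (b - a) * w n,
     (u n).2 <= (u n.+1).2 & (u n.+1).2 + (d - c) * w n.+1 <= (u n).2 + (d - c) * w n] /\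
     `|box_defect a b c d P Q n (u n)| <= 4 * `|box_defect a b c d P Q n.+1 (u n.+1)|.
  rewrite [u n.+1]/= /nxt; case: pselect (ubox n) => // h _.
  by case: cid => st' [[]].
have Dn n : `|defect P Q a b c d| <= 4 ^+ n * `|box_defect a b c d P Q n (u n)|.
  elim: n => [|n ih]; first by rewrite expr0 mul1r /box_defect /= w00 !mulr1 !subrKC.
  apply: (le_trans ih); rewrite exprSr -mulrA ler_wpM2l ?exprn_ge0//.
  by have [] := ustep n.
(* the lower left corners of the nested boxes converge, in each coordinate *)
have nest (x : nat -> R) (L : R) : 0 <= L -> (forall n, x n <= x n.+1) ->
    (forall n, x n.+1 + L * w n.+1 <= x n + L * w n) ->
    exists l, forall n, x n <= l <= x n + L * w n.
  move=> L0 up dn.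
  have upm m k : x m <= x (m + k)%N.
    by elim: k => [|k ih]; rewrite ?addn0// addnS (le_trans ih).
  have dnm m k : x (m + k)%N + L * w (m + k) <= x m + L * w m.
    by elim: k => [|k ih]; rewrite ?addn0// addnS (le_trans _ ih).
  have bd m k : x m <= x k + L * w k.
    have [mk|km] := leqP m k.
      have := upm m (k - m)%N; rewrite subnKC// => /le_trans; apply.
      by rewrite lerDl mulr_ge0// ltW// halfpow_gt0.
    have := dnm k (m - k)%N; rewrite subnKC 1?ltnW//; apply: le_trans.
    by rewrite lerDl mulr_ge0// ltW// halfpow_gt0.
  have ub k : ubound (range x) (x k + L * w k) by move=> _ [m _ <-].
  exists (sup (range x)) => n; apply/andP; split.
    apply: ub_le_sup; first by exists (x 0%N + L * w 0); exact: ub.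
    by exists n.
  by apply: ge_sup => //; exists (x 0%N), 0%N.
have [| | |sl hs] := nest (fun n => (u n).1) (b - a).
- by rewrite subr_ge0.
- by move=> n; case: (ustep n) => -[].
- by move=> n; case: (ustep n) => -[].
have [| | |tl ht] := nest (fun n => (u n).2) (d - c).
- by rewrite subr_ge0.
- by move=> n; case: (ustep n) => -[].
- by move=> n; case: (ustep n) => -[].
have slab : a <= sl <= b.
  by have := hs 0%N; rewrite /= w00; have := ubox 0%N => -[/=]; lra.
have tlab : c <= tl <= d.
  by have := ht 0%N; rewrite /= w00; have := ubox 0%N => -[/=]; lra.
apply/eqP; rewrite -normr_le0; apply/ler_addgt0Pr => e e0; rewrite add0r.
pose L := b - a + (d - c).
have L0 : 0 <= L by rewrite /L; lra.
have e'0 : 0 < e / (L ^+ 2 + 1) by rewrite divr_gt0// ltr_wpDl// sqr_ge0.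
have [dl dl0 hd] := defect_local PQ slab tlab e'0.
have [n hn] : exists n, (L + 1) * w n < dl.
    have h12 : `|2^-1 : R| < 1 by rewrite ger0_norm; lra.
  have dL : 0 < dl / (L + 1) by rewrite divr_gt0//; clear -L0; lra.
  have /cvgrPdist_lt/(_ _ dL)[n _ hn] := @cvg_geometric R 1 _ h12.
  exists n; have := hn n (leqnn n); rewrite /geometric /= sub0r normrN mul1r.
  rewrite ger0_norm ?exprn_ge0// ltr_pdivlMr; last lra.
  by rewrite /halfpow mulrC -exprVn.
have wn := halfpow_gt0 n.
apply: (le_trans (Dn n)).
have [u1 u2 u3 u4] := ubox n; have /andP[h1 h2] := hs n; have /andP[h3 h4] := ht n.
have := hd (u n).1 ((u n).1 + (b - a) * w n) (u n).2 ((u n).2 + (d - c) * w n).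
have eA (x y : R) : x + y - x = y by rewrite addrAC subrr add0r.
rewrite !eA -mulrDl -/L => hD.
have /ler_wpM2l : `|box_defect a b c d P Q n (u n)| <= e / (L ^+ 2 + 1) * (L * w n) ^+ 2.
  apply: hD => //.
  - by apply/andP; split.
  - by apply/andP; split.
  - by apply/andP; split.
  - by apply/andP; split.
  - by apply: le_lt_trans hn; rewrite /L ler_wpM2r ?ltW//; lra.
  - by apply: le_lt_trans hn; rewrite /L ler_wpM2r ?ltW//; lra.
move=> /(_ (4 ^+ n)) /(_ (exprn_ge0 _ _))/le_trans; apply=> //.
have -> : 4 ^+ n * (e / (L ^+ 2 + 1) * (L * w n) ^+ 2) = e * (L ^+ 2 / (L ^+ 2 + 1)).
  have -> : (4 : R) ^+ n = (2 ^+ n) ^+ 2 by rewrite -exprM mulnC exprM; congr (_ ^+ _); lra.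
  have : (2 : R) ^+ n != 0 by rewrite expf_neq0.
  rewrite /halfpow => h; field; rewrite h andbT.
  by apply/lt0r_neq0; rewrite ltr_wpDl// sqr_ge0.
rewrite ler_piMr ?(ltW e0)// ler_pdivrMr ?mul1r; last by rewrite ltr_wpDl// sqr_ge0.
by rewrite lerDl.
Qed.

End Goursat.

(** * Complex derivatives *)

Section Cderiv.
Context (R : realType).
Implicit Types (g : Cx R -> Cx R) (z a h : Cx R) (e d : R).

Lemma derive_approx (K : numFieldType) (f : K -> K) (x l : K) :
  h^-1 *: (f (h + x) - f x) @[h --> 0^'] --> l -> forall e : K, 0 < e ->
  exists2 d : K, 0 < d & forall h : K, `|h| < d -> `|f (x + h) - f x - l * h| <= e * `|h|.
Proof.
move=> /cvgrPdist_le H e e0; have /nbhs_ballP[d d0 hd] := H e e0.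
exists d => // h hlt; have [->|h0] := eqVneq h 0.
  by rewrite addr0 subrr mulr0 subr0 normr0 mulr0.
have := hd h; rewrite -ball_normE /ball_ /= sub0r normrN => /(_ hlt h0).
rewrite -(ler_pM2r (_ : 0 < `|h|)) ?normr_gt0// -normrM; apply: le_trans.
rewrite distrC mulrBl (addrC x h) [_^-1 *: _]/GRing.scale/= mulrAC mulVf// mul1r.
by rewrite -normrN opprB.
Qed.

Lemma real_derive_approx (f : R -> R) (x l : R) : is_derive x 1 f l ->
  forall e, 0 < e -> exists2 d : R, 0 < d &
    forall h : R, `|h| < d -> `|f (x + h) - f x - l * h| <= e * `|h|.
Proof.
move=> [fd fl]; apply: derive_approx; rewrite -fl /derive.
have -> : (fun h : R => h^-1 *: (f (h + x) - f x)) =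
    (fun h : R => h^-1 *: ((f \o shift x) (h *: 1) - f x)).
  by rewrite funeqE => h; rewrite /= [h *: 1]mulr1.
exact: fd.
Qed.

(** Differentiability at [z] with error bounds in [R], so that the estimates below
can be handled by real arithmetic. *)
Definition cderiv g z a := forall e, 0 < e -> exists2 d : R, 0 < d &
  forall h, rnorm h < d -> rnorm (g (z + h) - g z - a * h) <= e * rnorm h.

Lemma cderivP g z a : (h^-1 *: (g (h + z) - g z) @[h --> 0^'] --> a) <-> cderiv g z a.
Proof.
split=> [/derive_approx H e e0|H].
  have [|d d0 hd] := H (e%:C%C); first by rewrite ltcR0.
  have dr : d = (complex.Re d)%:C%C by rewrite RRe_real// gtr0_real.
  exists (complex.Re d); first by rewrite -ltcR0 -dr.
  move=> h hlt; have := hd h; rewrite rnormE dr ltcR => /(_ hlt).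
  by rewrite rnormE -rmorphM lecR.
apply/cvgrPdist_le => e e0.
have er : e = (complex.Re e)%:C%C by rewrite RRe_real// gtr0_real.
have [|d d0 hd] := H (complex.Re e); first by rewrite -ltcR0 -er.
apply/nbhs_ballP; exists (d%:C%C : Cx R); first by rewrite /= ltcR0.
move=> h; rewrite -ball_normE /ball_ /= sub0r normrN rnormE ltcR => hlt h0.
have hp : 0 < rnorm h by rewrite lt_def rnorm_ge0 andbT; apply: contra_neq h0; exact: rnorm_eq0.
rewrite rnormE er lecR -(ler_pM2r hp); apply: le_trans (hd h hlt).
rewrite -rnormM [_^-1 *: _]/GRing.scale/= mulrBl mulrAC mulVf// mul1r.
by rewrite addrC rdistC (addrC z h) opprB addrC.
Qed.

Lemma cderiv_continuous g z a : cderiv g z a -> {for z, continuous g}.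
Proof.
move=> H; apply/continuous_rnormP => e e0; have [d d0 hd] := H 1 ltr01.
have K0 : 0 < rnorm a + 1 by rewrite ltr_wpDl ?rnorm_ge0.
exists (Num.min d (e / (rnorm a + 1))); first by rewrite lt_min d0 divr_gt0.
move=> y; rewrite lt_min => /andP[y1 y2]; rewrite ltr_pdivlMr// in y2.
have := hd _ y1; rewrite subrKC => y3.
have := ler_rnormD (g y - g z - a * (y - z)) (a * (y - z)).
by rewrite subrK rnormM; nra.
Qed.

Lemma cderiv_cst (c : Cx R) z : cderiv (fun=> c) z 0.
Proof.
move=> e e0; exists 1 => // h _; rewrite subrr mul0r subr0 rnorm0.
by rewrite mulr_ge0 ?rnorm_ge0// ltW.
Qed.

Lemma cderiv_id z : cderiv id z 1.
Proof.
move=> e e0; exists 1 => // h _; rewrite mul1r /= (addrC z) addrK subrr rnorm0.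
by rewrite mulr_ge0 ?rnorm_ge0// ltW.
Qed.

Lemma cderivD f g z a b : cderiv f z a -> cderiv g z b ->
  cderiv (fun u => f u + g u) z (a + b).
Proof.
move=> Hf Hg e e0; have e20 : 0 < e / 2 by rewrite divr_gt0.
have [d1 d10 h1] := Hf _ e20; have [d2 d20 h2] := Hg _ e20.
exists (Num.min d1 d2); first by rewrite lt_min d10.
move=> h; rewrite lt_min => /andP[/h1 u1 /h2 u2].
rewrite (_ : _ - _ - _ = (f (z + h) - f z - a * h) + (g (z + h) - g z - b * h)); last by ring.
by apply: le_trans (ler_rnormD _ _) _; lra.
Qed.

Lemma cderivM f g z a b : cderiv f z a -> cderiv g z b ->
  cderiv (fun u => f u * g u) z (a * g z + f z * b).
Proof.
move=> Hf Hg e e0.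
set K := rnorm (f z) + rnorm (g z) + rnorm b + 2.
have K0 : 0 < K by rewrite /K ltr_wpDl// !addr_ge0 ?rnorm_ge0.
have e1 : 0 < e / K by rewrite divr_gt0.
have e2 : 0 < Num.min 1 (e / K) by rewrite lt_min ltr01.
have [d1 d10 h1] := Hf _ e1; have [d2 d20 h2] := Hg _ e2.
have /continuous_rnormP/(_ _ e2)[d3 d30 h3] := cderiv_continuous Hf.
exists (Num.min d1 (Num.min d2 d3)); first by rewrite !lt_min d10 d20.
move=> h; rewrite !lt_min => /and3P[/h1 u1 /h2 u2 hd3].
have := h3 (z + h); rewrite addrAC subrr add0r => /(_ hd3).
rewrite lt_min => /andP[u3 u4].
have -> : f (z + h) * g (z + h) - f z * g z - (a * g z + f z * b) * h =
  (f (z + h) - f z - a * h) * g z + f z * (g (z + h) - g z - b * h)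
  + (f (z + h) - f z) * (g (z + h) - g z - b * h) + (f (z + h) - f z) * b * h by ring.
set A := f (z + h) - f z - a * h; set B := g (z + h) - g z - b * h.
set C := f (z + h) - f z.
have := ler_rnormD (A * g z + f z * B + C * B) (C * b * h).
have := ler_rnormD (A * g z + f z * B) (C * B).
have := ler_rnormD (A * g z) (f z * B).
rewrite !rnormM => v1 v2 v3.
have u2' : rnorm B <= e / K * rnorm h.
  by apply: le_trans u2 _; rewrite ler_wpM2r ?rnorm_ge0// ge_min lexx orbT.
have hn : 0 <= rnorm h := rnorm_ge0 h.
have Cn := rnorm_ge0 C; have Bn := rnorm_ge0 B; have bn := rnorm_ge0 b.
have fn := rnorm_ge0 (f z); have gn := rnorm_ge0 (g z).
have w1 : rnorm A * rnorm (g z) <= e / K * rnorm h * rnorm (g z) by rewrite ler_wpM2r.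
have w2 : rnorm (f z) * rnorm B <= rnorm (f z) * (e / K * rnorm h) by rewrite ler_wpM2l.
have w3 : rnorm C * rnorm B <= 1 * (e / K * rnorm h) by rewrite ler_pM// ltW.
have w4 : rnorm C * rnorm b * rnorm h <= e / K * rnorm b * rnorm h.
  by rewrite ler_wpM2r// ler_wpM2r// ltW.
have -> : e * rnorm h = e / K * K * rnorm h by rewrite divfK// lt0r_neq0.
have X0 : 0 <= e / K * rnorm h by rewrite mulr_ge0// ltW.
clear -v1 v2 v3 w1 w2 w3 w4 X0; rewrite /K.
move: (e / (_ + _)) X0 w1 w2 w3 w4 => X; lra.
Qed.

Lemma cderivZ (c : Cx R) g z a : cderiv g z a -> cderiv (fun u => c * g u) z (c * a).
Proof. by move=> H; have := cderivM (cderiv_cst c z) H; rewrite mul0r add0r. Qed.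

Lemma cderivB f g z a b : cderiv f z a -> cderiv g z b ->
  cderiv (fun u => f u - g u) z (a - b).
Proof.
move=> Hf Hg; have := cderivD Hf (cderivZ (-1) Hg); rewrite mulN1r.
by under eq_fun do rewrite mulN1r.
Qed.

Lemma cderiv_sum (I : Type) (r : seq I) (f : I -> Cx R -> Cx R) z (a : I -> Cx R) :
  (forall i, cderiv (f i) z (a i)) ->
  cderiv (fun u => \sum_(i <- r) f i u) z (\sum_(i <- r) a i).
Proof.
move=> H; elim: r => [|i r ih].
  rewrite big_nil; have := cderiv_cst 0 z; congr cderiv.
  by rewrite funeqE => u; rewrite big_nil.
rewrite big_cons; have := cderivD (H i) ih; congr cderiv.
by rewrite funeqE => u; rewrite big_cons.
Qed.

Lemma cderiv_shift g z w a : cderiv g (z + w) a -> cderiv (fun u => g (z + u)) w a.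
Proof. by move=> H e e0; have [d d0 hd] := H e e0; exists d => // h /hd; rewrite addrA. Qed.

Lemma cderiv_horner (p : {poly Cx R}) z : cderiv (horner p) z p^`().[z].
Proof.
elim/poly_ind: p => [|p c ih].
  have := cderiv_cst 0 z; rewrite deriv0 horner0; congr cderiv.
  by rewrite funeqE => u; rewrite horner0.
have := cderivD (cderivM ih (cderiv_id z)) (cderiv_cst c z).
rewrite addr0 mulr1 addrC derivMXaddC hornerD hornerMX; congr cderiv.
by rewrite funeqE => u; rewrite !hornerE.
Qed.

End Cderiv.

(** * The mean value property *)

Section MeanValue.
Context (R : realType).
Implicit Types (g : Cx R -> Cx R) (s t e d r : R).

Definition avg (h : R -> R) : R := (2 * pi)^-1 * rint 0 (2 * pi) h.

Definition polar s t : Cx R := (expR s)%:C%C * expi t.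

Lemma polarD s s' t t' : polar (s + s') (t + t') = polar s t * polar s' t'.
Proof. by rewrite /polar expRD expiD rmorphM; ring. Qed.

Lemma rnorm_polar s t : rnorm (polar s t) = expR s.
Proof. by rewrite rnormM rnorm_expi mulr1 rnormR ger0_norm// expR_ge0. Qed.

Lemma rnorm_le_ReIm (z : Cx R) : rnorm z <= `|complex.Re z| + `|complex.Im z|.
Proof.
rewrite -ler_sqr ?nnegrE ?rnorm_ge0 ?addr_ge0// rnorm_sqr.
have -> : complex.Re z ^+ 2 = `|complex.Re z| ^+ 2 by rewrite real_normK ?num_real.
have -> : complex.Im z ^+ 2 = `|complex.Im z| ^+ 2 by rewrite real_normK ?num_real.
have := normr_ge0 (complex.Re z); have := normr_ge0 (complex.Im z); nra.
Qed.

Lemma polar_approx e : 0 < e -> exists2 d : R, 0 < d & forall s t, `|s| < d -> `|t| < d ->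
  rnorm (polar s t - 1 - Complex s t) <= e * (`|s| + `|t|).
Proof.
move=> e0; have e3 : 0 < e / 3 by rewrite divr_gt0.
have [d1 d10 h1] := real_derive_approx (is_derive_expR (0 : R)) e3.
have [d2 d20 h2] := real_derive_approx (is_derive_sin (0 : R)) e3.
have [d3 d30 h3] := real_derive_approx (is_derive_cos (0 : R)) e3.
have /continuous_RCP/(_ _ e3)[d4 d40 h4] := @continuous_expi R 0.
exists (Num.min (Num.min d1 d2) (Num.min d3 d4)); first by rewrite !lt_min d10 d20 d30.
move=> s t; rewrite !lt_min => /andP[/andP[s1 _] _] /andP[/andP[_ t2] /andP[t3 t4]].
have := h1 s s1; rewrite add0r expR0 mul1r => u1.
have := h2 t t2; rewrite add0r cos0 sin0 mul1r subr0 => u2.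
have := h3 t t3; rewrite add0r cos0 sin0 oppr0 mul0r subr0 => u3.
have := h4 t; rewrite subr0 => /(_ t4); rewrite expi0 => u4.
have -> : polar s t - 1 - Complex s t = (expR s - 1 - s)%:C%C * expi t +
    s%:C%C * (expi t - 1) + (expi t - 1 - Complex 0 t).
  rewrite /polar !rmorphB rmorph1.
  have -> : Complex s t = s%:C%C + Complex 0 t :> Cx R.
    by apply/eqP; rewrite eq_complex /= addr0 add0r !eqxx.
  by ring.
apply: le_trans (ler_rnormD _ _) _.
apply: le_trans (lerD (ler_rnormD _ _) (lexx _)) _.
rewrite !rnormM rnorm_expi mulr1 !rnormR.
have u5 : rnorm (expi t - 1 - Complex 0 t) <= e / 3 * `|t| + e / 3 * `|t|.
  apply: le_trans (rnorm_le_ReIm _) _ => /=.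
  by rewrite !oppr0 !addr0; exact: lerD u3 u2.
have u6 : `|s| * rnorm (expi t - 1) <= `|s| * (e / 3) by rewrite ler_wpM2l// ltW.
clear -u1 u5 u6 e0; have := normr_ge0 t; have := normr_ge0 s; nra.
Qed.

Lemma Re_mul (z : Cx R) (x y : R) :
  complex.Re (z * Complex x y) = complex.Re z * x - complex.Im z * y.
Proof. by case: z. Qed.

Lemma Im_mul (z : Cx R) (x y : R) :
  complex.Im (z * Complex x y) = complex.Re z * y + complex.Im z * x.
Proof. by case: z. Qed.

(** In the coordinates [s + i t], the function [g (exp (s + i t))] is holomorphic. *)
Lemma polar_CR g a b c d : (forall z, rnorm z <= expR b -> exists l, cderiv g z l) ->
  CR_on a b c d (fun s t => complex.Re (g (polar s t))) (fun s t => complex.Im (g (polar s t))).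
Proof.
move=> gd s t /andP[as_ sb] tcd.
have [l gl] := gd (polar s t) ltac:(by rewrite rnorm_polar ler_expR).
pose k := polar s t; pose m := l * k.
exists (complex.Re m), (- complex.Im m), (complex.Im m) => e e0.
have k0 : 0 < rnorm k by rewrite rnorm_polar expR_gt0.
pose e1 := e / (4 * rnorm k); have e10 : 0 < e1 by rewrite divr_gt0// mulr_gt0.
pose e2 := Num.min 1 (e / (2 * (rnorm m + 1))).
have m0 : 0 < rnorm m + 1 by rewrite ltr_wpDl ?rnorm_ge0.
have e20 : 0 < e2 by rewrite lt_min ltr01 divr_gt0// mulr_gt0.
have [d1 d10 h1] := gl _ e10; have [d2 d20 h2] := polar_approx e20.
have d30 : 0 < d1 / (4 * rnorm k) by rewrite divr_gt0// mulr_gt0.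
exists (Num.min d2 (d1 / (4 * rnorm k))); first by rewrite lt_min d20.
move=> s' t' _ _; rewrite !lt_min => /andP[s1 s2] /andP[t1 t2].
pose x := s' - s; pose y := t' - t.
have Exy : polar s' t' = k * polar x y.
  by rewrite -polarD /x /y !subrKC.
have P1 := h2 _ _ s1 t1; rewrite -/x -/y in P1.
pose w := polar x y - 1.
have S0 : 0 <= `|x| + `|y| by rewrite addr_ge0.
have P2 : rnorm w <= 2 * (`|x| + `|y|).
  have := ler_rnormD (w - Complex x y) (Complex x y); rewrite subrK => H.
  have := rnorm_le_ReIm (Complex x y : Cx R); rewrite /= => H2.
  have : e2 * (`|x| + `|y|) <= 1 * (`|x| + `|y|) by rewrite ler_wpM2r// ge_min lexx.
  by clear -P1 H H2 => ?; rewrite -/w in P1; lra.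
have kw : rnorm (k * w) < d1.
  rewrite rnormM; have /ltW := k0 => /ler_wpM2l/(_ _ _ P2)/le_lt_trans; apply.
  move: s2 t2; rewrite !ltr_pdivlMr ?mulr_gt0// -/x -/y.
  clear; lra.
have := h1 _ kw.
rewrite (_ : polar s t + k * w = polar s' t'); last by rewrite Exy /w /k; ring.
move=> H1.
have main : rnorm (g (polar s' t') - g (polar s t) - m * Complex x y) <= e * (`|x| + `|y|).
  have -> : g (polar s' t') - g (polar s t) - m * Complex x y =
    (g (polar s' t') - g (polar s t) - l * (k * w)) + m * (w - Complex x y).
    by rewrite /m; ring.
  apply: le_trans (ler_rnormD _ _) _; rewrite rnormM.
  have H3 : e1 * rnorm (k * w) <= e / 2 * (`|x| + `|y|).
    rewrite rnormM mulrA (_ : e1 * rnorm k = e / 4); last first.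
      by rewrite /e1; field; rewrite lt0r_neq0.
    have : e / 4 * rnorm w <= e / 4 * (2 * (`|x| + `|y|)).
      by rewrite ler_wpM2l// ltW// divr_gt0.
    by move/le_trans; apply; rewrite le_eqVlt; apply/orP; left; apply/eqP; field.
  have H4 : rnorm m * rnorm (w - Complex x y) <= e / 2 * (`|x| + `|y|).
    have H5 : rnorm m * rnorm (w - Complex x y) <= rnorm m * (e2 * (`|x| + `|y|)).
      by rewrite ler_wpM2l ?rnorm_ge0.
    apply: (le_trans H5); rewrite mulrA ler_wpM2r//.
    have : rnorm m * e2 <= (rnorm m + 1) * (e / (2 * (rnorm m + 1))).
      rewrite ler_pM ?rnorm_ge0//; [exact: ltW| by rewrite lerDl |].
      by rewrite ge_min lexx orbT.
    move/le_trans; apply; rewrite le_eqVlt; apply/orP; left; apply/eqP.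
    by field; rewrite lt0r_neq0.
  by clear -H1 H3 H4; lra.
split.
  apply: le_trans main; apply: le_trans (ler_Re_rnorm _).
  rewrite le_eqVlt; apply/orP; left; apply/eqP; congr (`|_|).
  by rewrite !ReB (Re_mul m x y) -/x -/y; ring.
apply: le_trans main; apply: le_trans (ler_Im_rnorm _).
rewrite le_eqVlt; apply/orP; left; apply/eqP; congr (`|_|).
by rewrite !ImB (Im_mul m x y) -/x -/y; ring.
Qed.

(** On a rectangle [a, b] x [0, 2 pi] of polar coordinates the sides [t = 0] and
[t = 2 pi] cancel, so the mean over the circle of radius [exp s] does not depend
on [s]; it tends to the value at the centre as [s] decreases. *)
Lemma mean_value g r : 0 < r -> (forall z, rnorm z <= r -> exists l, cderiv g z l) ->
  avg (fun t => complex.Re (g (r%:C%C * expi t))) = complex.Re (g 0).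
Proof.
move=> r0 gd; pose b := ln r; have eb : expR b = r by rewrite lnK.
have tp0 : 0 < 2 * pi :> R by rewrite mulr_gt0// pi_gt0.
have tp := ltW tp0.
pose P s t := complex.Re (g (polar s t)).
have E a : a <= b -> rint 0 (2 * pi) (P b) = rint 0 (2 * pi) (P a).
  move=> ab; have CR := @polar_CR g a b 0 (2 * pi) ltac:(by rewrite eb).
  have := goursat CR ab tp; rewrite /polar expi2pi expi0 subrr => /eqP.
  by rewrite subr_eq0 => /eqP.
rewrite /avg -eb -/(polar b) -/(P b).
suff -> : rint 0 (2 * pi) (P b) = complex.Re (g 0) * (2 * pi - 0).
  by rewrite subr0 mulrC mulfK// lt0r_neq0.
apply/eqP; rewrite -subr_eq0 -normr_le0; apply/ler_addgt0Pr => e e0; rewrite add0r.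
have e'0 : 0 < e / (2 * pi) by rewrite divr_gt0.
have [l gl] := gd 0 ltac:(by rewrite rnorm0 ltW).
have /continuous_rnormP/(_ _ e'0)[d d0 hd] := cderiv_continuous gl.
have d20 : 0 < d / 2 by rewrite divr_gt0.
(* a circle of radius at most d / 2, on which g is close to g 0 *)
pose a := Num.min b (ln (d / 2)).
have ab : a <= b by rewrite ge_min lexx.
rewrite (E a ab).
have -> : e = e / (2 * pi) * (2 * pi - 0) by rewrite subr0 divfK// lt0r_neq0.
apply: rint_close => //.
  have CR := @polar_CR g a b 0 (2 * pi) ltac:(by rewrite eb).
  by apply: (CR_rintegrable_t CR); rewrite ?lexx ?ab.
move=> t _; rewrite /P -raddfB/=; apply: le_trans (ler_Re_rnorm _) _.
apply/ltW/hd; rewrite subr0 rnorm_polar.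
have : expR a <= d / 2 by rewrite -(lnK d20) ler_expR ge_min lexx orbT.
by move/le_lt_trans; apply; rewrite ltr_pdivrMr//; lra.
Qed.

End MeanValue.

(** * Compactness of the circle and of the disc *)

Section Compactness.
Context (R : realType).
Implicit Types (z w : Cx R) (v : Cx R -> R).

Lemma compact_circle : compact [set z : Cx R | rnorm z = 1].
Proof.
have -> : [set z : Cx R | rnorm z = 1] = @expi R @` `[0, 2 * pi].
  apply/seteqP; split=> [z /expi_surj[t /andP[t0 t1] ->]|_ [t _ <-]].
    by exists t => //=; rewrite in_itv/= t0 ltW.
  exact: rnorm_expi.
apply: continuous_compact; last exact: segment_compact.
by apply: continuous_subspaceT; exact: continuous_expi.
Qed.

Lemma compact_disc : compact [set z : Cx R | rnorm z <= 1].
Proof.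
pose f (p : R * R) : Cx R := p.1%:C%C * expi p.2.
have -> : [set z : Cx R | rnorm z <= 1] = f @` (`[0, 1] `*` `[0, 2 * pi]).
  apply/seteqP; split=> [z /closed_disc_polar[r [t [r01 t01 ->]]]|_ [[r t] [/= r01 _] <-]].
    by exists (r, t) => //; split; rewrite /= in_itv.
  rewrite /= in_itv/= in r01; have /andP[r0 r1] := r01.
  by rewrite /f/= rnormM rnorm_expi mulr1 rnormR ger0_norm.
apply: continuous_compact; last by apply: compact_setX; exact: segment_compact.
apply: continuous_subspaceT => -[r t].
have cr : {for (r, t), continuous (fun p : R * R => (p.1%:C%C : Cx R))}.
  have h : {for r, continuous (fun x : R => (x%:C%C : Cx R))}.
    by apply/continuous_RCP => e e0; exists e => // y; rewrite -rmorphB rnormR.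
  by apply: (@continuous_comp _ _ _ fst _ (r, t)); [exact: cvg_fst|exact: h].
have ct : {for (r, t), continuous (fun p : R * R => expi p.2)}.
  by apply: (@continuous_comp _ _ _ snd _ (r, t)); [exact: cvg_snd|exact: continuous_expi].
exact: cvgM cr ct.
Qed.

(** Compactness turns local radii into a uniform one; the local form asks for all
small radii because [P] need not be monotone in the radius. *)
Lemma lebesgue_number (A : set (Cx R)) (P : R -> Cx R -> Prop) : compact A ->
  (forall z, A z -> exists2 d : R, 0 < d &
     forall w r, rnorm (w - z) < d -> 0 < r < d -> P r w) ->
  exists2 r : R, 0 < r & forall z, A z -> P r z.
Proof.
move=> /compact_near_coveringP cA loc.
have /(_ _) H := cA R (0%R^'+) P _.
have : \forall d \near 0^'+, A `<=` P d.
  apply: H => z /loc[d d0 hd].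
  have nz : nbhs z [set y : Cx R | rnorm (y - z) < d].
    by apply: (@nbhs_rnormP R (Cx R : normedModType (Cx R)) z _).2; exists d.
  exists ([set y | rnorm (y - z) < d], [set r | 0 < r < d]).
    split=> //=; near=> r; apply/andP; split; near: r.
      exact: nbhs_right_gt.
    exact: nbhs_right_lt.
  by move=> [y r] [/= yz rd]; exact: hd.
move=> Hn; have [d /andP[d0 /asboolP hd]] : exists d : R, (0 < d) && `[< A `<=` P d >].
  near (0:R)^'+ => d; exists d; apply/andP; split.
    by near: d; exact: nbhs_right_gt.
  by apply/asboolP; near: d.
by exists d.
Unshelve. all: by end_near. Qed.

Lemma uniform_continuity (W : normedModType (Cx R)) (F : Cx R -> W) (A : set (Cx R)) : compact A ->
  (forall z, A z -> {for z, continuous F}) -> forall e : R, 0 < e ->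
  exists2 d : R, 0 < d & forall z w, A z -> rnorm (w - z) < d -> rnorm (F w - F z) < e.
Proof.
move=> cA Fc e e0; have e20 : 0 < e / 2 by rewrite divr_gt0.
have [|d d0 hd] := @lebesgue_number A (fun d z => forall w, rnorm (w - z) < d -> rnorm (F w - F z) < e) cA.
  move=> z /Fc /continuous_rnormP/(_ _ e20)[d d0 hd].
  exists (d / 2); first by rewrite divr_gt0.
  move=> y r yz /andP[_ rd] w wy.
  have h1 := hd y ltac:(by apply: lt_trans yz _; clear -d0; lra).
  have h2 : rnorm (F w - F z) < e / 2.
    apply: hd; apply: le_lt_trans (ler_rdistD y _ _) _; clear -yz rd wy; lra.
  apply: le_lt_trans (ler_rdistD (F z) _ _) _.
  by rewrite (rdistC (F z)); clear -h1 h2; lra.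
by exists d => // z w Az; exact: hd.
Qed.

Lemma uniform_continuity_real v (A : set (Cx R)) : compact A ->
  (forall z, A z -> {for z, continuous v}) -> forall e : R, 0 < e ->
  exists2 d : R, 0 < d & forall z w, A z -> rnorm (w - z) < d -> `|v w - v z| < e.
Proof.
move=> cA vc e e0.
have [|d d0 hd] := @uniform_continuity (Cx R : normedModType (Cx R)) (fun z => (v z)%:C%C) A cA _ e e0.
  move=> z /vc /continuous_CRP h; apply/continuous_rnormP => e' /h[d d0 hd].
  by exists d => // y /hd; rewrite -rmorphB rnormR.
by exists d => // z w Az /(hd _ _ Az); rewrite -rmorphB rnormR.
Qed.

Lemma disc_max v : (forall z, rnorm z <= 1 -> {for z, continuous v}) ->
  exists2 z, rnorm z <= 1 & forall w, rnorm w <= 1 -> v w <= v z.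
Proof.
move=> vc; have [||z] := @compact_EVT_max _ R v [set z : Cx R | rnorm z <= 1] _ compact_disc.
- by exists 0; rewrite /= rnorm0.
- apply/subspace_continuousP => z zA; apply: cvg_within_filter; exact: vc.
by rewrite inE => z1 h; exists z => // w w1; apply: h; rewrite inE.
Qed.

Lemma circle_max v : (forall z, rnorm z = 1 -> {for z, continuous v}) ->
  exists2 z, rnorm z = 1 & forall w, rnorm w = 1 -> v w <= v z.
Proof.
move=> vc; have [||z] := @compact_EVT_max _ R v [set z : Cx R | rnorm z = 1] _ compact_circle.
- by exists 1; rewrite /= rnorm1.
- apply/subspace_continuousP => z zA; apply: cvg_within_filter; exact: vc.
by rewrite inE => z1 h; exists z => // w w1; apply: h; rewrite inE.
Qed.

End Compactness.

(** * Means over the circle *)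

Section Avg.
Context (R : realType).
Implicit Types (f g : R -> R).
Local Notation avg_integrable := (@rintegrable R 0 (2 * pi)).

Lemma twopi_gt0 : 0 < 2 * pi :> R.
Proof. by rewrite mulr_gt0// pi_gt0. Qed.

Lemma avg_cst (c : R) : avg (fun=> c) = c.
Proof.
have h := twopi_gt0.
by rewrite /avg rint_cst ?ltW// subr0 mulrCA mulVf ?mulr1// lt0r_neq0.
Qed.

Lemma avgD f g : avg_integrable f -> avg_integrable g -> avg (fun t => f t + g t) = avg f + avg g.
Proof. by move=> hf hg; rewrite /avg rintD// mulrDr. Qed.

Lemma avgB f g : avg_integrable f -> avg_integrable g -> avg (fun t => f t - g t) = avg f - avg g.
Proof. by move=> hf hg; rewrite /avg rintB// mulrBr. Qed.

Lemma avgZ c f : avg_integrable f -> avg (fun t => c * f t) = c * avg f.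
Proof. by move=> hf; rewrite /avg rintZ// mulrCA. Qed.

Lemma avg_sum (I : Type) (r : seq I) (F : I -> R -> R) :
  (forall i, avg_integrable (F i)) -> avg (fun t => \sum_(i <- r) F i t) = \sum_(i <- r) avg (F i).
Proof. by move=> h; rewrite /avg rint_sum// mulr_sumr. Qed.

Lemma le_avg f g : avg_integrable f -> avg_integrable g -> (forall t, 0 <= t <= 2 * pi -> f t <= g t) -> avg f <= avg g.
Proof.
move=> hf hg h; rewrite /avg ler_wpM2l//; last exact: le_rint.
by rewrite invr_ge0 ltW// twopi_gt0.
Qed.

Local Notation mu := (@lebesgue_measure R).

Lemma lebesgue_twopi : mu `[0, 2 * pi]%classic = (2 * pi)%:E.
Proof.
have := @lebesgue_measure_itv R `[0, 2 * pi]; rewrite /= => ->.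
by rewrite lte_fin twopi_gt0 -EFinB subr0.
Qed.

Lemma indic_circle_fin (A : set R) : measurable A -> (mu (A `&` `[0%R, (2 * pi)%R]%classic) < +oo)%E.
Proof.
move=> mA; apply: (@le_lt_trans _ _ (mu `[0, 2 * pi]%classic)).
  by apply: le_measure; rewrite ?inE//; exact: measurableI.
by rewrite lebesgue_twopi ltry.
Qed.

Lemma rintegrable_indic (A : set R) : measurable A -> avg_integrable (\1_A).
Proof.
move=> mA; apply/integrableP; split; first exact/measurable_EFinP/measurable_indic.
under eq_integral do rewrite gee0_abs ?lee_fin//.
by rewrite integral_indic// indic_circle_fin.
Qed.

Lemma avg_indic (A : set R) : measurable A ->
  avg (\1_A) = (2 * pi)^-1 * fine (mu (A `&` `[0, 2 * pi]%classic)).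
Proof. by move=> mA; rewrite /avg /rint /Rintegral integral_indic. Qed.

End Avg.

(** * The maximum modulus principle for polynomials *)

Section MaxPrinciple.
Context (R : realType).
Implicit Types (z w h : Cx R).

Lemma sqr_rnormD z h : rnorm (z + h) ^+ 2 =
  rnorm z ^+ 2 + 2 * complex.Re (z^*%C * h) + rnorm h ^+ 2.
Proof. by rewrite !rnorm_sqr; case: z; case: h => /= *; ring. Qed.

Lemma continuous_rnorm (V : normedModType (Cx R)) : continuous (@rnorm R V).
Proof.
move=> v; apply/continuous_CRP => e e0; exists e => // y; apply: le_lt_trans.
exact: ler_rdist.
Qed.

Lemma continuous_Cpoly (p : {poly Cx R}) : continuous (horner p).
Proof. by move=> z; exact: cderiv_continuous (cderiv_horner p z). Qed.

Lemma holomorphic_avg_bound (g : Cx R -> Cx R) (r : R) (c : R) : 0 < r ->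
  (forall z, rnorm z <= r -> exists l, cderiv g z l) ->
  (forall t, complex.Re (g (r%:C%C * expi t)) <= c) -> complex.Re (g 0) <= c.
Proof.
move=> r0 gd gc; rewrite -(mean_value r0 gd) -[leRHS]avg_cst.
apply: le_avg => //; last exact: rintegrable_cst.
apply: rintegrable_cont => t; apply: continuous_comp; last exact: continuous_Re.
have [l gl] := gd (r%:C%C * expi t)
  ltac:(by rewrite rnormM rnorm_expi mulr1 rnormR ger0_norm// ltW).
have ce : {for t, continuous (fun s : R => r%:C%C * expi s : Cx R)}.
  by apply: continuousM; [exact: cst_continuous|exact: continuous_expi].
exact: (continuous_comp ce (cderiv_continuous gl)).
Qed.

(** Multiply [p] by a unit [c] that makes [p.[z1]] real and nonnegative: the function
[Re (c * p) + tau * |z| ^ 2] has no interior maximum, because the square expands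
at a point as a constant, the real part of a linear function, and a positive term,
so that a maximum would violate [holomorphic_avg_bound]. *)
Lemma poly_max_modulus (p : {poly Cx R}) (M : R) :
  (forall z, rnorm z = 1 -> rnorm p.[z] < M) ->
  forall z, rnorm z <= 1 -> rnorm p.[z] < M.
Proof.
move=> pM z1 z11.
have cp z : {for z, continuous (fun u => rnorm p.[u])}.
  by apply: continuous_comp; [exact: continuous_Cpoly|exact: continuous_rnorm].
have [zm zm1 hm] := circle_max (fun z _ => cp z).
apply: le_lt_trans (pM _ zm1); apply/ler_addgt0Pr => tau tau0.
have [c c1 cp1] : exists2 c : Cx R, rnorm c = 1 & c * p.[z1] = (rnorm p.[z1])%:C%C.
  have [p0|p0] := eqVneq p.[z1] 0.
    by exists 1; rewrite ?rnorm1// p0 rnorm0 mulr0.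
  exists ((rnorm p.[z1])%:C%C / p.[z1]); last by rewrite divfK.
  have np : rnorm p.[z1] != 0 by apply: contra_neq p0; exact: rnorm_eq0.
  apply: (mulIf np); rewrite mul1r -rnormM divfK// rnormR.
  by rewrite ger0_norm// rnorm_ge0.
pose v z := complex.Re (c * p.[z]) + tau * rnorm z ^+ 2.
have vc z : {for z, continuous v}.
  apply: continuousD.
    apply: continuous_comp; last exact: continuous_Re.
    by apply: continuousM; [exact: cst_continuous|exact: continuous_Cpoly].
  apply: continuousM; first exact: cst_continuous.
  by apply: continuousM; exact: continuous_rnorm.
have [z0 z01 hv] := disc_max (fun z _ => vc z).
have := z01; rewrite le_eqVlt => /predU1P[z0T|z0D].
  have h1 := hv _ z11; rewrite /v cp1/= z0T expr1n mulr1 in h1.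
  have h2 := le_trans (ler_norm _) (ler_Re_rnorm (c * p.[z0])).
  rewrite rnormM c1 mul1r in h2; have h3 := hm _ z0T.
  have := sqr_ge0 (rnorm z1); clear -h1 h2 h3 tau0; nra.
exfalso; pose r := 1 - rnorm z0; have r0 : 0 < r by rewrite subr_gt0.
(* the cross term of the square is moved into a holomorphic function *)
pose G u := c * p.[z0 + u] + (2 * tau)%:C%C * (z0^*%C * u).
have Gd z : exists l, cderiv G z l.
  eexists; apply: cderivD; first exact/cderivZ/cderiv_shift/cderiv_horner.
  exact/cderivZ/cderivZ/cderiv_id.
have := @holomorphic_avg_bound G r (complex.Re (c * p.[z0]) - tau * r ^+ 2) r0 (fun z _ => Gd z).
suff H t : complex.Re (G (r%:C%C * expi t)) <= complex.Re (c * p.[z0]) - tau * r ^+ 2.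
  move=> /(_ H); rewrite /G !mulr0 !addr0 => h.
  have : 0 < tau * r ^+ 2 by rewrite mulr_gt0// exprn_gt0.
  by clear -h; lra.
set u := _ * _; have nu : rnorm u = r.
  by rewrite rnormM rnorm_expi mulr1 rnormR ger0_norm// ltW.
have := hv (z0 + u); rewrite /v sqr_rnormD nu => h.
have {}h : rnorm (z0 + u) <= 1.
  by apply: le_trans (ler_rnormD _ _) _; rewrite nu /r subrKC.
have {}h := hv _ h; rewrite /v sqr_rnormD nu in h.
rewrite /G ReD.
have -> : complex.Re ((2 * tau)%:C%C * (z0^*%C * u)) = 2 * tau * complex.Re (z0^*%C * u).
  by case: (z0^*%C * u) => ? ?; rewrite /= mul0r subr0.
clear -h; lra.
Qed.

End MaxPrinciple.

(** * Roots of unity *)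

Section RootsOfUnity.
Context (R : realType).
Implicit Types (n k j : nat) (t s : R).

Lemma cos_lt1 t : 0 < t < 2 * pi -> cos t < 1.
Proof.
move=> /andP[t0 t1]; have -> : t = t / 2 + t / 2 by rewrite -splitr.
have s0 : 0 < sin (t / 2) by apply: sin_gt0_pi; apply/andP; split; [rewrite divr_gt0|rewrite ltr_pdivrMr// mulrC].
rewrite cosD; have := cos2Dsin2 (t / 2); nra.
Qed.

Lemma expiN t : expi (- t) = (expi t)^*%C.
Proof. by rewrite /expi cosN sinN. Qed.

Lemma expiNV t : expi (- t) = (expi t)^-1.
Proof.
have u : expi (- t) * expi t = 1 by rewrite -expiD addNr expi0.
have n0 : expi t != 0 by apply/eqP => h; move: (rnorm_expi t); rewrite h rnorm0 => /eqP; rewrite eq_sym oner_eq0.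
by apply: (mulIf n0); rewrite u mulVf.
Qed.

Lemma expi_neq0 t : expi t != 0.
Proof. by apply/eqP => h; move: (rnorm_expi t); rewrite h rnorm0 => /eqP; rewrite eq_sym oner_eq0. Qed.

(** The arguments of the roots of unity of order [n + 1]. *)
Definition node n j : R := 2 * pi * j%:R / n.+1%:R.

Lemma node_bound n j : (j < n.+1)%N -> 0 <= node n j < 2 * pi.
Proof.
move=> jn; have h := twopi_gt0 R; rewrite /node; apply/andP; split.
  by rewrite divr_ge0// mulr_ge0// ltW.
by rewrite ltr_pdivrMr// ltr_pM2l// ltr_nat.
Qed.

Lemma expi_node n j : expi (node n j) = expi (node n 1) ^+ j.
Proof. rewrite expiX -mulr_natr; congr expi; rewrite /node -!mulrA mul1r.
by congr (_ * (_ * _)); rewrite mulrC. Qed.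

Lemma expi_node_period n : expi (node n 1) ^+ n.+1 = 1.
Proof. by rewrite -expi_node /node mulfK ?pnatr_eq0// expi2pi. Qed.

Lemma expi_node_neq1 n k : (0 < k < n.+1)%N -> expi (node n k) != 1.
Proof.
move=> /andP[k0 kn]; apply/eqP => /(congr1 (@complex.Re R)) /= h.
suff : cos (node n k) < 1 by rewrite h ltxx.
apply: cos_lt1; rewrite /node; apply/andP; split.
  by rewrite divr_gt0// mulr_gt0 ?twopi_gt0// ltr0n.
by rewrite ltr_pdivrMr// ltr_pM2l ?twopi_gt0// ltr_nat.
Qed.

Lemma sum_root n (q : Cx R) : q ^+ n.+1 = 1 -> q != 1 -> \sum_(j < n.+1) q ^+ j = 0.
Proof.
move=> q1 qn; have := subrXX q 1 n.+1; rewrite expr1n q1 subrr => /esym/eqP.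
rewrite mulf_eq0 subr_eq0 (negbTE qn)/= => /eqP h; rewrite -[RHS]h.
rewrite [RHS](reindex_inj rev_ord_inj)/=; apply: eq_bigr => j _.
by rewrite expr1n mulr1 subKn// -ltnS.
Qed.

(** Orthogonality of the powers on the roots of unity of order [n + 1]: among the
exponents up to [2 * n], only [n] itself is congruent to [n]. *)
Lemma sum_nodes n k : (k <= n + n)%N ->
  \sum_(j < n.+1) expi (node n j) ^+ n * expi (- node n j) ^+ k = (if k == n then n.+1%:R else 0) :> Cx R.
Proof.
move=> kn; pose q := expi (node n 1) ^+ n * expi (- node n 1) ^+ k : Cx R.
have E j : expi (node n j) ^+ n * expi (- node n j) ^+ k = q ^+ j :> Cx R.
  by rewrite (expiNV (node n j)) (expi_node n j) -exprVn /q -expiNV exprMn -!exprM (mulnC n) (mulnC k).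
under eq_bigr do rewrite E.
have [kn0|knn] := eqVneq k n.
  rewrite (eq_bigr (fun=> 1)); first by rewrite sumr_const card_ord.
  move=> j _; rewrite /q kn0 expiNV -exprMn mulfV ?expi_neq0//.
  by rewrite !expr1n.
apply: sum_root.
  rewrite /q exprMn -!exprM mulnC exprM expi_node_period expr1n mul1r.
  by rewrite expiNV mulnC exprM exprVn expi_node_period invr1 expr1n.
have [kn'|kn'] := ltnP k n.
  have -> : q = expi (node n (n - k)).
    rewrite /q -(subnK (ltnW kn')) exprD -mulrA -exprMn expiNV mulfV ?expi_neq0//.
    by rewrite expr1n mulr1 addnK [RHS]expi_node.
  by apply: expi_node_neq1; rewrite subn_gt0 kn' ltnS leq_subr.
have nk : (n < k)%N by rewrite ltn_neqAle eq_sym knn.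
have -> : q = (expi (node n (k - n)))^-1.
  rewrite /q -(subnK kn') exprD mulrCA -exprMn expiNV mulfV ?expi_neq0//.
  by rewrite expr1n mulr1 addnK (expi_node n (k - n)) exprVn.
rewrite invr_eq1; apply: expi_node_neq1.
by rewrite subn_gt0 nk ltnS leq_subLR.
Qed.

End RootsOfUnity.

(** * A partition of unity by trigonometric polynomials *)

Section Kernel.
Context (R : realType).
Implicit Types (n k : nat) (t s : R).

(** The half-angle formula makes this [cos (t / 2) ^ (2 * n)], a peak at 0. *)
Definition bump n t : R := ((1 + cos t) / 2) ^+ n.

Lemma bump_ge0 n t : 0 <= bump n t.
Proof. by rewrite exprn_ge0// divr_ge0//; have := cos_geN1 t; lra. Qed.

Lemma bumpE n t : expi t ^+ n * (bump n t)%:C%C = (4 ^- n) * (1 + expi t) ^+ (n + n) :> Cx R.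
Proof.
rewrite /bump rmorphXn /= -exprMn addnn -mul2n exprM -exprVn -exprMn; congr (_ ^+ _).
rewrite -[4^-1]/((4%:R)^-1); have -> : (4%:R : Cx R)^-1 = (4^-1 : R)%:C%C by rewrite fmorphV rmorph_nat.
have h := cos2Dsin2 t; apply/eqP; rewrite expr2 eq_complex /=; apply/andP; split; apply/eqP.
  by rewrite !add0r -!expr2 (_ : sin t ^+ 2 = 1 - cos t ^+ 2); [field|lra].
by field.
Qed.

Definition mass n : R := \sum_(j < n.+1) bump n (node R n j).

Lemma mass_ge1 n : 1 <= mass n.
Proof.
rewrite /mass big_ord_recl /= {1}/bump /node mulr0 mul0r cos0 (_ : (1 + 1) / 2 = 1) ?expr1n ?lerDl; last by field.
by apply: sumr_ge0 => j _; exact: bump_ge0.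
Qed.

Lemma mass_gt0 n : 0 < mass n.
Proof. exact: lt_le_trans (mass_ge1 n). Qed.

Lemma bump_shiftE n s t : expi t ^+ n * (bump n (t - s))%:C%C =
  4 ^- n * \sum_(k < (n + n).+1) 'C(n + n, k)%:R * expi t ^+ k * (expi s ^+ n * expi (- s) ^+ k) :> Cx R.
Proof.
have -> : expi t = expi s * expi (t - s) :> Cx R by rewrite -expiD subrKC.
rewrite [in LHS]exprMn -mulrA bumpE (exprDn 1 (expi (t - s))) !mulr_sumr; apply: eq_bigr => k _.
rewrite expr1n mul1r exprMn -[expi (t - s) ^+ k *+ _]mulr_natl.
have u : expi s ^+ k * expi (- s) ^+ k = 1 :> Cx R.
  by rewrite -exprMn expiNV mulfV ?expi_neq0// expr1n.
transitivity (4 ^- n * ('C(n + n, k)%:R * (expi (t - s) ^+ k) * (expi s ^+ n * (expi s ^+ k * expi (- s) ^+ k))) : Cx R); last by ring.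
by rewrite u; ring.
Qed.

(** As a trigonometric polynomial in [t], the bump has degree [n], and summing over
the translates by the [n + 1] nodes kills all frequencies except 0. *)
Lemma sum_bump_cst n t : \sum_(j < n.+1) bump n (t - node R n j) = mass n.
Proof.
have key u : \sum_(j < n.+1) (bump n (u - node R n j))%:C%C = 4 ^- n * 'C(n + n, n)%:R * n.+1%:R :> Cx R.
  have un : expi u ^+ n != 0 :> Cx R by rewrite expf_neq0// expi_neq0.
  apply: (mulfI un); rewrite mulr_sumr.
  under eq_bigr do rewrite bump_shiftE.
  rewrite -mulr_sumr exchange_big/=.
  have nn : (n < (n + n).+1)%N by rewrite ltnS leq_addr.
  rewrite (bigD1 (Ordinal nn))//= -mulr_sumr sum_nodes ?leq_addr// eqxx.
  rewrite big1 ?addr0; first by ring.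
  move=> k kn; rewrite -mulr_sumr sum_nodes; last by rewrite -ltnS.
  by rewrite ifN ?mulr0//; apply: contra kn => /eqP h; apply/eqP/val_inj.
apply: complexI; rewrite rmorph_sum /= key -(key 0) /mass rmorph_sum /=.
by apply: eq_bigr => j _; rewrite sub0r /bump cosN.
Qed.

Definition weight n (j : nat) t : R := bump n (t - node R n j) / mass n.

Lemma weight_ge0 n j t : 0 <= weight n j t.
Proof. by rewrite divr_ge0 ?bump_ge0// ltW// mass_gt0. Qed.

Lemma sum_weight n t : \sum_(j < n.+1) weight n j t = 1.
Proof. by rewrite -mulr_suml sum_bump_cst mulfV// lt0r_neq0// mass_gt0. Qed.

(** On the circle a weight has frequencies between [- n] and [n]; multiplying it by
[z ^ n] gives this polynomial. *)
Definition wpoly n (j : nat) : {poly Cx R} :=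
  ((4 ^- n / (mass n)%:C%C) * expi (node R n j) ^+ n) *: (1 + expi (- node R n j) *: 'X) ^+ (n + n).

Lemma wpolyE n j t : (wpoly n j).[expi t] = expi t ^+ n * (weight n j t)%:C%C.
Proof.
rewrite /weight rmorphM fmorphV /= mulrA /wpoly !hornerE.
rewrite -expiD addrC; have -> : expi t = expi (node R n j) * expi (t - node R n j) :> Cx R by rewrite -expiD subrKC.
rewrite exprMn -(mulrA (_ ^+ n)) bumpE addrC (addrC _ t); ring.
Qed.

(** The total mass is at least 1, the bump at the node 0, whereas each of the [n + 1]
terms far from [t] is at most the [n]-th power of a ratio below 1. *)
Lemma weight_concentration (kap eta : R) : -1 <= kap < 1 -> 0 < eta ->
  exists n, forall t, \sum_(j < n.+1 | cos (t - node R n j) <= kap) weight n j t <= eta.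
Proof.
move=> /andP[k1 k2] eta0; pose x := (1 + kap) / 2.
have x01 : 0 <= x < 1 by rewrite /x; apply/andP; split; lra.
(* a far term is at most x ^+ n = (y ^+ n) ^+ 2: one factor pays for the number of
   terms, the other is small *)
have /andP[x0 x1] := x01; pose y := Num.sqrt x.
have y0 : 0 <= y by exact: sqrtr_ge0.
have yx : y ^+ 2 = x by rewrite sqr_sqrtr.
have y1 : y < 1 by rewrite ltNge; apply/negP => h; move: x1; rewrite -yx; nra.
have bd n : n.+1%:R * y ^+ n <= (1 - y)^-1.
  rewrite -[leRHS]mul1r ler_pdivlMr; last by rewrite subr_gt0.
  have := subrXX 1 y n.+1; rewrite expr1n => H.
  apply: (@le_trans _ _ (1 - y ^+ n.+1)); last by rewrite gerBl exprn_ge0.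
  rewrite H mulrC ler_wpM2l//; first by rewrite subr_ge0 ltW.
  rewrite mulr_natl -[n.+1 in leLHS]card_ord -sumr_const; apply: ler_sum => j _.
  rewrite expr1n mul1r ler_wiXn2l//; first exact: ltW.
  by rewrite -ltnS.
have hy : `|y| < 1 by rewrite ger0_norm.
have ey : 0 < eta * (1 - y) by rewrite mulr_gt0// subr_gt0.
have /cvgrPdist_lt/(_ _ ey)[n _ hn] := @cvg_geometric R 1 _ hy.
exists n => t; have := hn n (leqnn n).
rewrite /geometric /= sub0r normrN mul1r ger0_norm ?exprn_ge0// => yn.
apply: (@le_trans _ _ (\sum_(j < n.+1) x ^+ n)).
  rewrite big_mkcond; apply: ler_sum => j _; case: ifP => [h|_]; last exact: exprn_ge0.
  rewrite ler_pdivrMr ?mass_gt0//; apply: (@le_trans _ _ (x ^+ n)).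
    have b0 : 0 <= (1 + cos (t - node R n j)) / 2.
      by rewrite divr_ge0//; have := cos_geN1 (t - node R n j); lra.
    by rewrite /bump lerXn2r ?nnegrE// /x; clear -h; lra.
  by rewrite ler_peMr ?exprn_ge0// mass_ge1.
rewrite sumr_const card_ord -mulr_natl -yx -exprM mulnC exprM expr2 mulrA.
apply: le_trans (_ : (1 - y)^-1 * y ^+ n <= _); first by rewrite ler_wpM2r ?exprn_ge0.
by rewrite mulrC ler_pdivrMr ?subr_gt0// ltW.
Qed.

End Kernel.

(** * Uniform approximation on the circle by real parts of polynomials *)

Section TrigApprox.
Context (R : realType).
Implicit Types (v : Cx R -> R) (t s : R).

(** Conjugation turns negative frequencies into positive ones and preserves the real
part. *)
Lemma real_part_poly (n : nat) (p : {poly Cx R}) : exists q : {poly Cx R},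
  forall t, complex.Re q.[expi t] = complex.Re (expi (- t) ^+ n * p.[expi t]).
Proof.
elim/poly_ind: p n => [|p c ih] n.
  by exists 0 => t; rewrite !horner0 mulr0.
case: n => [|n]; first by exists (p * 'X + c%:P) => t; rewrite expr0 mul1r.
have [q hq] := ih n; exists (q + c^*%C *: 'X^(n.+1)) => t.
rewrite !hornerE ReD hq.
have -> : expi (- t) ^+ n.+1 * (p.[expi t] * expi t + c) =
    expi (- t) ^+ n * p.[expi t] + expi (- t) ^+ n.+1 * c.
  have u : expi (- t) * expi t = 1 :> Cx R by rewrite -expiD addNr expi0.
  rewrite mulrDr; congr (_ + _); rewrite exprSr.
  transitivity (expi (- t) ^+ n * p.[expi t] * (expi (- t) * expi t)); first by ring.
  by rewrite u mulr1.
rewrite ReD; congr (_ + _).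
have -> : expi (- t) ^+ n.+1 = (expi t ^+ n.+1)^*%C by rewrite expiN rmorphXn.
by case: (expi t ^+ n.+1) => a b; case: c => c d /=; ring.
Qed.

(** Average the values of [v] at the nodes with the weights of the partition of
unity: the near nodes contribute by uniform continuity, the far ones have small
total weight. *)
Lemma trig_approx v (e : R) : 0 < e -> (forall z, rnorm z = 1 -> {for z, continuous v}) ->
  exists p : {poly Cx R}, forall z, rnorm z = 1 -> `|complex.Re p.[z] - v z| <= e.
Proof.
move=> e0 vc; have e20 : 0 < e / 2 by rewrite divr_gt0.
have [d d0 hd] := uniform_continuity_real (@compact_circle R) vc e20.
have [zM zM1 hM] := @circle_max R (fun z => `|v z|) (fun z z1 => continuous_comp (vc z z1) (@norm_continuous _ _ _)).
set M := `|v zM| in hM; have M0 : 0 <= M by rewrite normr_ge0.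
(* a cosine above kap means that the two points of the circle are d'-close *)
pose d' := Num.min d 1; have d'0 : 0 < d' by rewrite lt_min d0 ltr01.
pose kap := 1 - d' ^+ 2 / 2.
have kap1 : -1 <= kap < 1.
  have : d' <= 1 by rewrite ge_min lexx orbT.
  by rewrite /kap; clear -d'0 => ?; apply/andP; split; nra.
have eta0 : 0 < e / (4 * (M + 1)) by rewrite divr_gt0// mulr_gt0// ltr_wpDl.
have [n hn] := weight_concentration kap1 eta0.
pose q j := projT1 (cid (real_part_poly n (wpoly R n j))).
have qE (j : nat) t : complex.Re (q j).[expi t] = weight n j t.
  rewrite /q; case: cid => /= r ->; rewrite wpolyE mulrA -exprMn -expiD addNr expi0.
  by rewrite expr1n mul1r.
exists (\sum_(j < n.+1) (v (expi (node R n j)))%:C%C *: q j) => z /expi_surj[t _ ->].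
have -> : complex.Re (\sum_(j < n.+1) (v (expi (node R n j)))%:C%C *: q j).[expi t] =
    \sum_(j < n.+1) v (expi (node R n j)) * weight n j t.
  rewrite horner_sum; elim/big_rec2 : _ => [//|j y x _ <-].
  rewrite ReD hornerZ; congr (_ + _); rewrite -qE.
  by case: (_.[_]) => a b; rewrite /= mul0r subr0.
have -> : v (expi t) = \sum_(j < n.+1) v (expi t) * weight n j t.
  by rewrite -mulr_sumr sum_weight mulr1.
rewrite -sumrB; apply: le_trans (ler_norm_sum _ _ _) _.
have bd (j : 'I_n.+1) : `|v (expi (node R n j)) * weight n j t - v (expi t) * weight n j t| <=
    e / 2 * weight n j t + (if cos (t - node R n j) <= kap then 2 * M * weight n j t else 0).
  rewrite -mulrBl normrM (ger0_norm (weight_ge0 _ _ _)).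
  have w0 := weight_ge0 n j t.
  case: ifP => h.
    have h1 := hM _ (rnorm_expi (node R n j)); have h2 := hM _ (rnorm_expi t).
    have h3 := ler_normB (v (expi (node R n j))) (v (expi t)).
    have : 0 <= e / 2 * weight n j t by rewrite mulr_ge0// ltW.
    have : `|v (expi (node R n j)) - v (expi t)| * weight n j t <= 2 * M * weight n j t.
      by rewrite ler_wpM2r//; clear -h1 h2 h3; lra.
    by clear; lra.
  rewrite addr0; apply: ler_wpM2r => //; apply/ltW/hd; first exact: rnorm_expi.
  have : d' <= d by rewrite ge_min lexx.
  apply: lt_le_trans; rewrite -(@ltr_pXn2r _ 2) ?nnegrE ?rnorm_ge0 ?(ltW d'0)//.
  rewrite rdistC rdist_expi; move/negbT: h; rewrite -ltNge /kap; clear; lra.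
apply: le_trans (ler_sum _ (fun j _ => bd j)) _.
rewrite big_split /= -mulr_sumr sum_weight mulr1 -big_mkcond /= -mulr_sumr.
have H := hn t; have : 2 * M * (e / (4 * (M + 1))) <= e / 2.
  have -> : e / 2 = (2 * (M + 1)) * (e / (4 * (M + 1))).
    by field; rewrite lt0r_neq0// ltr_wpDl.
  by rewrite ler_wpM2r// ?(ltW eta0)//; clear; lra.
have : 2 * M * \sum_(j < n.+1 | cos (t - node R n j) <= kap) weight n j t <= 2 * M * (e / (4 * (M + 1))).
  by rewrite ler_wpM2l// mulr_ge0.
by clear; lra.
Qed.

End TrigApprox.

(** * Circle means of upper semicontinuous functions *)

Section CircleMean.
Context (R : realType).
Local Notation mu := (@lebesgue_measure R).
Local Open Scope ereal_scope.

Lemma usc_measurable (g : R -> \bar R) :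
  (forall (t c : R), g t < c%:E -> \forall s \near t, g s < c%:E) ->
  measurable_fun setT g.
Proof.
move=> gu; have h : measurable_fun setT (fun t => - g t).
  apply: lower_semicontinuous_measurable => t a; rewrite lteNr -EFinN => /gu h.
  by exists [set s | g s < (- a)%:E] => // s; rewrite /= lteNr EFinN.
have := measurableT_comp (@oppe_measurable R setT) h.
by congr measurable_fun; rewrite funeqE => t; rewrite /= oppeK.
Qed.

(** Positive and negative parts are compared separately, because [g] may take the
value -oo and need not be integrable. *)
Lemma circle_mean_le (g : Cx R -> \bar R) (j : R -> R) (a : Cx R) (r : R) :
  measurable_fun setT (fun t => g (a + r%:C%C * expi t)%R) -> continuous j ->
  (forall t, g (a + r%:C%C * expi t)%R <= (j t)%:E) ->
  circle_mean g a r <= (avg j)%:E.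
Proof.
set G := fun t => _; move=> mG cj Gj.
have ij : mu.-integrable `[0%R, (2 * pi)%R]%classic (EFin \o j) := rintegrable_cont 0%R (2 * pi)%R cj.
rewrite /circle_mean /avg EFinM; apply: lee_wpmul2l.
  by rewrite lee_fin invr_ge0 ltW// twopi_gt0.
have -> : (rint 0 (2 * pi) j)%:E = \int[mu]_(t in `[0%R, (2 * pi)%R]) (j t)%:E.
  by rewrite /rint /Rintegral fineK//; apply: integrable_fin_num.
have mj : measurable_fun `[0%R, (2 * pi)%R]%classic (EFin \o j) by case/integrableP: ij.
have mG' : measurable_fun `[0%R, (2 * pi)%R]%classic G by exact: measurable_funTS.
rewrite integralE [leRHS]integralE; apply: leeB.
  apply: ge0_le_integral => //; [exact: measurable_funepos|exact: measurable_funepos|].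
  by move=> t _; rewrite !funeposE ge_max le_max Gj/= le_max lexx orbT.
apply: ge0_le_integral => //; [exact: measurable_funeneg|exact: measurable_funeneg|].
by move=> t _; rewrite !funenegE ge_max le_max leeN2 Gj/= le_max lexx orbT.
Qed.

End CircleMean.

(** * Sup-convolutions *)

Section SupConvolution.
Context (R : realType) (n : nat).
Local Notation V := 'rV[Cx R]_n.
Implicit Types (p y x : V) (S : set V) (w : V -> R) (k c M C : R).

(** The Euclidean norm rather than the sup norm: expanding its square around a point
gives the real part of a complex linear function as cross term. *)
Definition sqr_enorm p : R := \sum_(i < n) rnorm (p ord0 i) ^+ 2.

Lemma sqr_enorm_ge0 p : 0 <= sqr_enorm p.
Proof. by apply: sumr_ge0 => i _; exact: sqr_ge0. Qed.

Lemma rnorm_sqr_enorm p : rnorm p ^+ 2 <= sqr_enorm p.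
Proof.
rewrite -(sqr_sqrtr (sqr_enorm_ge0 p)) ler_sqr ?nnegrE ?rnorm_ge0 ?sqrtr_ge0//.
apply/rnorm_row_le => [|i]; first exact: sqrtr_ge0.
rewrite -ler_sqr ?nnegrE ?rnorm_ge0 ?sqrtr_ge0// (sqr_sqrtr (sqr_enorm_ge0 p)).
by rewrite /sqr_enorm (bigD1 i)//= lerDl; apply: sumr_ge0 => j _; exact: sqr_ge0.
Qed.

Lemma sqr_enorm_lip p y : `|sqr_enorm p - sqr_enorm y| <= n%:R * ((rnorm p + rnorm y) * rnorm (p - y)).
Proof.
rewrite /sqr_enorm -sumrB; apply: le_trans (ler_norm_sum _ _ _) _.
have -> : n%:R * ((rnorm p + rnorm y) * rnorm (p - y)) =
    \sum_(i < n) (rnorm p + rnorm y) * rnorm (p - y).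
  by rewrite sumr_const card_ord mulr_natl.
apply: ler_sum => i _; rewrite subr_sqr normrM mulrC.
apply: ler_pM => //.
  rewrite ger0_norm; last by rewrite addr_ge0 ?rnorm_ge0.
  by rewrite lerD ?rnorm_coord.
apply: le_trans (ler_rdist _ _) _; have := rnorm_coord (p - y) i.
by rewrite !mxE.
Qed.

(** Sup-convolution of [w] over [S] with a quadratic penalty: continuous majorants of
[w] on [S] that decrease, as [k] grows, to [w] wherever it is upper semicontinuous. *)
Definition supconv S w k p : R := sup [set w y - k * sqr_enorm (p - y) | y in S].

Lemma supconv_has S w k M p : S !=set0 -> (forall y, S y -> w y <= M) -> 0 <= k ->
  has_sup [set w y - k * sqr_enorm (p - y) | y in S].
Proof.
move=> [y Sy] wM k0; split; first by exists (w y - k * sqr_enorm (p - y)), y.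
exists M => _ [z /wM zM <-]; have := mulr_ge0 k0 (sqr_enorm_ge0 (p - z)); lra.
Qed.

Lemma supconv_ge S w k M p y : (forall y, S y -> w y <= M) -> 0 <= k -> S y ->
  w y - k * sqr_enorm (p - y) <= supconv S w k p.
Proof.
move=> wM k0 Sy; apply: ub_le_sup; last by exists y.
by have [] := supconv_has p (ex_intro _ y Sy) wM k0.
Qed.

Lemma supconv_self S w k M p : (forall y, S y -> w y <= M) -> 0 <= k -> S p ->
  w p <= supconv S w k p.
Proof.
move=> wM k0 Sp; have := supconv_ge p wM k0 Sp; rewrite subrr.
have -> : sqr_enorm 0 = 0 by rewrite /sqr_enorm big1// => i _; rewrite mxE rnorm0 expr0n.
by rewrite mulr0 subr0.
Qed.

Lemma supconv_le S w k p c : S !=set0 ->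
  (forall y, S y -> w y - k * sqr_enorm (p - y) <= c) -> supconv S w k p <= c.
Proof. by move=> [y Sy] h; apply: ge_sup; [exists (w y - k * sqr_enorm (p - y)), y|move=> _ [z /h zc <-]]. Qed.

Lemma supconv_adherent S w k M p (tau : R) : S !=set0 -> (forall y, S y -> w y <= M) -> 0 <= k ->
  0 < tau -> exists2 y, S y & supconv S w k p - tau < w y - k * sqr_enorm (p - y).
Proof.
move=> S0 wM k0 tau0; have [_ [y Sy <-] h] := sup_adherent tau0 (supconv_has p S0 wM k0).
by exists y.
Qed.

Lemma supconv_anti S w k k' M p : S !=set0 -> (forall y, S y -> w y <= M) -> 0 <= k -> k <= k' ->
  supconv S w k' p <= supconv S w k p.
Proof.
move=> S0 wM k0 kk'; apply: supconv_le => // y Sy.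
apply: le_trans (supconv_ge p wM k0 Sy).
by rewrite lerD2l lerN2 ler_wpM2r// sqr_enorm_ge0.
Qed.

Lemma supconv_lip S w k M x C p p' : S !=set0 -> (forall y, S y -> w y <= M) -> 0 <= k ->
  (forall y, S y -> rnorm (y - x) <= C) ->
  supconv S w k p <= supconv S w k p' +
    k * (n%:R * ((rnorm (p - x) + rnorm (p' - x) + C + C) * rnorm (p - p'))).
Proof.
move=> S0 wM k0 SC; apply: supconv_le => // y Sy.
have h1 := supconv_ge p' wM k0 Sy.
have h2 := sqr_enorm_lip (p - y) (p' - y).
have h3 : p - y - (p' - y) = p - p' by rewrite opprB addrA subrK.
rewrite h3 in h2.
have h4 : rnorm (p - y) + rnorm (p' - y) <= rnorm (p - x) + rnorm (p' - x) + C + C.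
  have := SC _ Sy; have := ler_rdistD x p y; have := ler_rdistD x p' y.
  by rewrite (rdistC x y); clear; lra.
have h5 : sqr_enorm (p' - y) - sqr_enorm (p - y) <=
    n%:R * ((rnorm (p - x) + rnorm (p' - x) + C + C) * rnorm (p - p')).
  apply: (@le_trans _ _ (n%:R * ((rnorm (p - y) + rnorm (p' - y)) * rnorm (p - p')))).
    by apply: le_trans h2; rewrite distrC ler_norm.
  by rewrite ler_wpM2l// ler_wpM2r ?rnorm_ge0.
have := ler_wpM2l k0 h5; rewrite mulrBr; clear -h1; lra.
Qed.

Lemma supconv_continuous S w k M x C : S !=set0 -> (forall y, S y -> w y <= M) -> 0 <= k ->
  (forall y, S y -> rnorm (y - x) <= C) -> continuous (supconv S w k).
Proof.
move=> S0 wM k0 SC p; apply/continuous_CRP => e e0.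
have C0 : 0 <= C by have [y Sy] := S0; exact: le_trans (rnorm_ge0 _) (SC _ Sy).
pose L := k * (n%:R * (rnorm (p - x) + (rnorm (p - x) + 1) + C + C)).
have L0 : 0 <= L by rewrite !mulr_ge0 ?ler0n// !addr_ge0 ?rnorm_ge0.
have L1 : 0 < L + 1 by rewrite ltr_wpDl.
exists (Num.min 1 (e / (L + 1))); first by rewrite lt_min ltr01 divr_gt0.
move=> y; rewrite lt_min ltr_pdivlMr// => /andP[y1 y2].
have yx : rnorm (y - x) <= rnorm (p - x) + 1.
  by have := ler_rdistD p y x; clear -y1; lra.
have B d : 0 <= d -> d = rnorm (y - p) ->
    k * (n%:R * ((rnorm (p - x) + rnorm (y - x) + C + C) * d)) <= L * d.
  move=> d0 _; rewrite !mulrA ler_wpM2r// /L -mulrA ler_wpM2l// ler_wpM2l// .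
  by clear -yx; lra.
have n0 := rnorm_ge0 (y - p).
have h1 := supconv_lip y p S0 wM k0 SC; have h2 := supconv_lip p y S0 wM k0 SC.
rewrite (rdistC p y) in h2; have B' := B _ n0 erefl.
rewrite (addrC (rnorm (y - x))) in h1.
rewrite ltr_norml; apply/andP; clear -h1 h2 B' y2 n0; split; lra.
Qed.

(** With a large [k], the points farther than [r] from [p] are penalized out of the
supremum. *)
Lemma supconv_usc S w M p c (r : R) : S !=set0 -> (forall y, S y -> w y <= M) -> 0 < r ->
  (forall y, S y -> rnorm (y - p) < r -> w y <= c) ->
  exists2 k0 : R, 0 <= k0 & forall k, k0 <= k -> supconv S w k p <= c.
Proof.
move=> S0 wM r0 wc; exists (`|M - c| / r ^+ 2); first by rewrite divr_ge0// sqr_ge0.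
have r20 : 0 < r ^+ 2 by rewrite exprn_gt0.
move=> k; rewrite ler_pdivrMr// => kM; apply: supconv_le => // y Sy.
have k0 : 0 <= k by rewrite -(pmulr_lge0 _ r20); apply: le_trans kM.
have sy := sqr_enorm_ge0 (p - y).
have [yr|yr] := ltP (rnorm (y - p)) r.
  by have := wc _ Sy yr; have := mulr_ge0 k0 sy; clear; lra.
have h : r ^+ 2 <= sqr_enorm (p - y).
  apply: le_trans (rnorm_sqr_enorm _); rewrite rdistC ler_sqr ?nnegrE ?rnorm_ge0//.
  exact: ltW.
have := ler_wpM2l k0 h; have := wM _ Sy; have := ler_norm (M - c); clear -kM; lra.
Qed.

End SupConvolution.

(** * Sub-mean inequality of sup-convolutions on holomorphic discs *)

Section HoloComposition.
Context (R : realType) (n : nat).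
Local Notation V := 'rV[Cx R]_n.
Implicit Types (p y x : V) (S : set V) (w : V -> R) (k c M : R).

Lemma common_radius (P : 'I_n -> R -> Prop) :
  (forall i d d', 0 < d' -> d' <= d -> P i d -> P i d') ->
  (forall i, exists2 d : R, 0 < d & P i d) -> exists2 d : R, 0 < d & forall i, P i d.
Proof.
move=> mono H; pose d i := projT1 (cid2 (H i)).
have d0 i : 0 < d i by rewrite /d; case: cid2.
have dP i : P i (d i) by rewrite /d; case: cid2.
have m0 : 0 < \big[Num.min/1]_(i < n) d i by apply: lt_bigmin.
exists (\big[Num.min/1]_(i < n) d i) => // i; apply: mono (dP i) => //.
exact: bigmin_le_cond.
Qed.

Lemma cderiv_row_continuous (f : Cx R -> V) (z : Cx R) :
  (forall i, exists a, cderiv (fun u => f u ord0 i) z a) -> {for z, continuous f}.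
Proof.
move=> fd; apply/continuous_rnormP => e e0.
have [| |d d0 hd] := @common_radius (fun i d => forall y : Cx R, rnorm (y - z) < d -> rnorm (f y ord0 i - f z ord0 i) < e) _ _.
- by move=> i d d' _ dd' h y yd; apply: h; exact: lt_le_trans dd'.
- by move=> i; have [a /cderiv_continuous/continuous_rnormP/(_ _ e0)] := fd i.
exists d => // y yd; apply/rnorm_row_lt => // i.
by have := hd i y yd; rewrite !mxE.
Qed.

(** The hypothesis on [j] is the sub-mean inequality of [w] on complex lines, tested
against continuous majorants, so that [w] need not be integrable or even
measurable.  The last hypothesis on [k] keeps every near-maximizer of the
supremum at [f z] within [R0 / 2] of [f z], hence inside [S] together with a small
disc on a line through it. *)
Lemma supconv_holo_submean S w c M x (R0 k : R) (f : Cx R -> V) :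
  S = [set y | rnorm (y - x) < R0 + R0] -> 0 < R0 ->
  (forall y, S y -> c <= w y <= M) ->
  (forall y (A : V) r (j : R -> R), 0 < r ->
     (forall l, rnorm l <= r -> S (y + l *: A)) -> continuous j ->
     (forall t, w (y + (r%:C%C * expi t) *: A) <= j t) -> w y <= avg j) ->
  (forall z, rnorm z <= 1 -> forall i, exists a, cderiv (fun u => f u ord0 i) z a) ->
  (forall z, rnorm z <= 1 -> rnorm (f z - x) < R0) ->
  0 <= k -> M - c + 1 < k * (R0 / 2) ^+ 2 ->
  supconv S w k (f 0) <= avg (fun t => supconv S w k (f (expi t))).
Proof.
move=> SE R00 wcM Hw fd fV k0 hk.
have wM y : S y -> w y <= M by move=> /wcM /andP[].
have Sx : S x by rewrite SE /= subrr rnorm0 addr_gt0.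
have S0 : S !=set0 by exists x.
have SC y : S y -> rnorm (y - x) <= R0 + R0 by rewrite SE => /ltW.
have Sf z : rnorm z <= 1 -> S (f z).
  by move=> /fV h; rewrite SE /=; apply: lt_trans h _; rewrite ltrDl.
pose v z := supconv S w k (f z).
have sc := supconv_continuous S0 wM k0 SC.
have vc z : rnorm z <= 1 -> {for z, continuous v}.
  by move=> /fd /cderiv_row_continuous fc; apply: continuous_comp; [exact: fc|exact: sc].
have vTc : continuous (fun t => v (expi t)).
  move=> t; apply: (@continuous_comp _ _ _ (@expi R) v); first exact: continuous_expi.
  by apply: vc; rewrite rnorm_expi.
apply/ler_addgt0Pr => e e0; rewrite leNgt; apply/negP => lt.
pose tau := e / 4; have tau0 : 0 < tau by rewrite divr_gt0.
have [P hP] := trig_approx tau0 (fun z (z1 : rnorm z = 1) => vc z ltac:(by rewrite z1)).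
have P0 : complex.Re P.[0] <= avg (fun t => v (expi t)) + tau.
  have := @mean_value R (horner P) 1 ltr01 (fun z _ => ex_intro _ _ (cderiv_horner P z)).
  move=> <-; rewrite -[X in _ + X]avg_cst -avgD; last 2 first.
  - exact: rintegrable_cont.
  - exact: rintegrable_cst.
  apply: le_avg.
  - apply: rintegrable_cont => t; under eq_fun do rewrite mul1r.
    apply: (@continuous_comp _ _ _ (fun t => P.[expi t]) (@complex.Re R)); last exact: continuous_Re.
    by apply: (@continuous_comp _ _ _ (@expi R) (horner P)); [exact: continuous_expi|exact: continuous_Cpoly].
  - by apply: rintegrableD; [exact: rintegrable_cont|exact: rintegrable_cst].
  - move=> t _; rewrite mul1r; have := hP _ (rnorm_expi t).
    by rewrite ler_norml => /andP[_]; clear; lra.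
(* for tau = e / 4, the value at 0 exceeds the values on the circle *)
pose Phi z := v z - complex.Re P.[z] + tau * rnorm z ^+ 2.
have Phic z : rnorm z <= 1 -> {for z, continuous Phi}.
  move=> z1; apply: continuousD.
    apply: continuousB; first exact: vc.
    by apply: continuous_comp; [exact: continuous_Cpoly|exact: continuous_Re].
  apply: continuousM; first exact: cst_continuous.
  by apply: continuousM; exact: continuous_rnorm.
have [z0 z01 hmax] := disc_max Phic.
have z0D : rnorm z0 < 1.
  move: z01; rewrite le_eqVlt => /predU1P[z0T|//]; exfalso.
  have := hmax 0 ltac:(by rewrite rnorm0); rewrite /Phi rnorm0 expr0n mulr0 addr0 z0T expr1n.
  have := hP _ z0T; rewrite ler_norml => /andP[h1 _].
  have lt' : avg (fun t => v (expi t)) + e < v 0 := lt.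
  have eE : e = tau + tau + tau + tau by rewrite /tau; field.
  by move: lt' P0 h1 tau0; rewrite eE; clear; lra.
(* A is the derivative of f at z0 and rho the remainder of the expansion of f *)
pose a i := projT1 (cid (fd z0 z01 i)).
have aP i : cderiv (fun u => f u ord0 i) z0 (a i) by rewrite /a; case: cid.
pose A : V := \row_i a i.
pose rho i h := f (z0 + h) ord0 i - f z0 ord0 i - a i * h.
(* e1 makes the penalty of the remainders at most half of tau * r ^+ 2 *)
pose e1 := Num.sqrt (tau / (2 * (k * n%:R + 1))).
have kn0 : 0 <= k * n%:R by rewrite mulr_ge0.
have kn1 : 0 < k * n%:R + 1 by rewrite ltr_wpDl.
have e10 : 0 < e1 by rewrite sqrtr_gt0 divr_gt0// mulr_gt0.
have e1E : e1 ^+ 2 = tau / (2 * (k * n%:R + 1)).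
  by rewrite sqr_sqrtr// ltW// divr_gt0// mulr_gt0.
have [| |d d0 hd] := @common_radius (fun i d => forall h : Cx R, rnorm h < d -> rnorm (rho i h) <= e1 * rnorm h).
- by move=> i d d' _ dd' h y yd; apply: h; exact: lt_le_trans dd'.
- by move=> i; exact: aP.
have A0 : 0 < rnorm A + 1 by rewrite ltr_wpDl ?rnorm_ge0.
pose r := Num.min (1 - rnorm z0) (Num.min (d / 2) (R0 / 2 / (rnorm A + 1))).
have r0 : 0 < r by rewrite !lt_min subr_gt0 z0D divr_gt0//= !divr_gt0.
have r1 : r <= 1 - rnorm z0 by rewrite ge_min lexx.
have rd : r < d.
  apply: (@le_lt_trans _ _ (d / 2)); first by rewrite !ge_min lexx orbT.
  by clear -d0; lra.
have rA : r * rnorm A < R0 / 2.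
  have h : r * (rnorm A + 1) <= R0 / 2 by rewrite -ler_pdivlMr// !ge_min lexx !orbT.
  by clear -h r0; lra.
have r20 : 0 < r ^+ 2 by rewrite exprn_gt0.
have nh t : rnorm (r%:C%C * expi t : Cx R) = r.
  by rewrite rnormM rnorm_expi mulr1 rnormR ger0_norm// ltW.
have rho_small t : k * \sum_(i < n) rnorm (rho i (r%:C%C * expi t)) ^+ 2 <= tau * r ^+ 2 / 2.
  have h : \sum_(i < n) rnorm (rho i (r%:C%C * expi t)) ^+ 2 <= n%:R * (e1 ^+ 2 * r ^+ 2).
    rewrite mulr_natl -[n in leRHS]card_ord -sumr_const; apply: ler_sum => i _.
    rewrite -exprMn lerXn2r ?nnegrE ?rnorm_ge0 ?mulr_ge0 ?(ltW e10) ?(ltW r0)//.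
    by have := hd i (r%:C%C * expi t); rewrite nh => /(_ rd).
  apply: le_trans (ler_wpM2l k0 h) _; rewrite e1E.
  have -> : k * (n%:R * (tau / (2 * (k * n%:R + 1)) * r ^+ 2)) =
      (k * n%:R / (k * n%:R + 1)) * (tau * r ^+ 2 / 2) by field; rewrite lt0r_neq0.
  rewrite ler_piMl//; first by rewrite ltW// divr_gt0// mulr_gt0.
  by rewrite ler_pdivrMr// mul1r lerDl.
(* the bound 1 on tau' goes with the slack 1 in the hypothesis on k *)
pose tau' := Num.min 1 (tau * r ^+ 2 / 4).
have tau'0 : 0 < tau' by rewrite lt_min ltr01 divr_gt0// mulr_gt0.
have [y0 Sy0 hy0] := supconv_adherent (f z0) S0 wM k0 tau'0.
set dd := f z0 - y0 in hy0.
have ddR : rnorm dd < R0 / 2.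
  have h1 := supconv_self wM k0 (Sf z0 z01).
  have /andP[h2 _] := wcM _ (Sf z0 z01); have /andP[_ h3] := wcM _ Sy0.
  have h4 : tau' <= 1 by rewrite ge_min lexx.
  have h5 : k * sqr_enorm dd < k * (R0 / 2) ^+ 2.
    by move: h1 h2 h3 h4 hy0 hk; clear; lra.
  have kp : 0 < k.
    rewrite lt_def k0 andbT; apply/eqP => kz; move: h5; rewrite kz !mul0r ltxx.
    by [].
  rewrite ltr_pM2l// in h5.
  rewrite -ltr_sqr ?nnegrE ?rnorm_ge0//; last by rewrite divr_ge0// ltW.
  exact: le_lt_trans (rnorm_sqr_enorm _) h5.
have Sline l : rnorm l <= r -> S (y0 + l *: A).
  move=> lr; rewrite SE /= (_ : y0 + l *: A - x = (f z0 - x) - dd + l *: A); last first.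
    by apply/rowP => i; rewrite /dd !mxE; ring.
  have h1 := ler_rnormD (f z0 - x - dd) (l *: A); have h2 := ler_rnormB (f z0 - x) dd.
  have h3 := fV _ z01; rewrite rnormZ in h1.
  have h4 : rnorm l * rnorm A <= r * rnorm A by rewrite ler_wpM2r ?rnorm_ge0.
  by move: h1 h2 h3 h4 ddR rA; clear; lra.
(* the real part of G collects all the terms that are harmonic in h *)
pose G h := P.[z0 + h] - P.[z0] - (2 * tau)%:C%C * (z0^*%C * h) +
  (2 * k)%:C%C * \sum_(i < n) (dd ord0 i)^*%C * (f (z0 + h) ord0 i - f z0 ord0 i - a i * h).
have Gd h : rnorm h <= r -> exists l, cderiv G h l.
  move=> hr; have z0h : rnorm (z0 + h) <= 1.
    by apply: le_trans (ler_rnormD _ _) _; move: hr r1; clear; lra.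
  pose b i := projT1 (cid (fd _ z0h i)).
  have bP i : cderiv (fun u => f u ord0 i) (z0 + h) (b i) by rewrite /b; case: cid.
  eexists; apply: cderivD.
    apply: cderivB; last exact/cderivZ/cderivZ/cderiv_id.
    by apply: cderivB; [exact/cderiv_shift/cderiv_horner|exact: cderiv_cst].
  apply: cderivZ.
  apply: (@cderiv_sum R _ _ _ h (fun i => (dd ord0 i)^*%C * (b i - 0 - a i * 1))) => i.
  apply: cderivZ; apply: cderivB; last exact/cderivZ/cderiv_id.
  apply: cderivB; last exact: cderiv_cst.
  exact: cderiv_shift (bP i).
have G0 : G 0 = 0.
  rewrite /G !addr0 !mulr0 subrr subr0 add0r big1 ?mulr0// => i _.
  by rewrite mulr0 subrr subr0 mulr0.
have Gc : continuous (fun t => complex.Re (G (r%:C%C * expi t))).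
  move=> t; apply: (@continuous_comp _ _ _ (fun t => G (r%:C%C * expi t)) (@complex.Re R)); last exact: continuous_Re.
  apply: (@continuous_comp _ _ _ (fun t : R => r%:C%C * expi t : Cx R) G).
    by apply: continuousM; [exact: cst_continuous|exact: continuous_expi].
  by have [l /cderiv_continuous] := Gd (r%:C%C * expi t) ltac:(by rewrite nh).
pose j t := w y0 - tau * r ^+ 2 / 4 + complex.Re (G (r%:C%C * expi t)).
have jc : continuous j := fun t => continuousD (@cst_continuous _ _ _ t) (Gc t).
have avgj : avg j = w y0 - tau * r ^+ 2 / 4.
  rewrite /j avgD; last 2 first.
  - exact: rintegrable_cst.
  - exact: rintegrable_cont.
  by rewrite avg_cst (mean_value r0 Gd) G0 addr0.
have wj t : w (y0 + (r%:C%C * expi t) *: A) <= j t.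
  set h := r%:C%C * expi t.
  have nhr : rnorm h = r by exact: nh.
  have z0h : rnorm (z0 + h) <= 1.
    by apply: le_trans (ler_rnormD _ _) _; move: nhr r1; clear; lra.
  have h1 := supconv_ge (f (z0 + h)) wM k0 (Sline h ltac:(by rewrite nhr)).
  have h2 := hmax _ z0h; rewrite /Phi sqr_rnormD nhr in h2.
  pose lin := complex.Re (\sum_(i < n) (dd ord0 i)^*%C * rho i h).
  pose quad := \sum_(i < n) rnorm (rho i h) ^+ 2.
  have h3 : sqr_enorm (f (z0 + h) - (y0 + h *: A)) = sqr_enorm dd +
      2 * lin + quad.
    have -> : lin =
        \sum_(i < n) complex.Re ((dd ord0 i)^*%C * rho i h).
      by rewrite /lin; elim/big_rec2 : _ => // i y1 y2 _ <-; rewrite ReD.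
    rewrite /sqr_enorm /quad mulr_sumr -!big_split; apply: eq_bigr => i _ /=.
    rewrite -sqr_rnormD; congr (rnorm _ ^+ 2).
    by rewrite /dd /rho !mxE; ring.
  have h4 := rho_small t; rewrite -/h -/quad in h4.
  have h5 : tau' <= tau * r ^+ 2 / 4 by rewrite ge_min lexx orbT.
  have h6 : complex.Re (G h) = complex.Re P.[z0 + h] - complex.Re P.[z0] - 2 * tau * complex.Re (z0^*%C * h)
      + 2 * k * lin.
    have ReZ (b : R) (u : Cx R) : complex.Re (b%:C%C * u) = b * complex.Re u.
      by case: u => u1 u2; rewrite /= mul0r subr0.
    by rewrite /G ReD !ReB !ReZ.
  rewrite /j -/h h6; rewrite h3 in h1.
  move: h1 h2 h4 h5 hy0; rewrite -/(v (z0 + h)) -/(v z0).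
  by clear; lra.
have := Hw y0 A r j r0 Sline jc wj; rewrite avgj.
have : 0 < tau * r ^+ 2 by rewrite mulr_gt0.
by clear; lra.
Qed.

End HoloComposition.

(** * Discs with boundary mostly in an open set force non-thinness *)

Section DiscsNonthin.
Context (R : realType) (n : nat).
Local Notation V := 'rV[Cx R]_n.
Local Notation mu := (@lebesgue_measure R).
Implicit Types (x y : V) (U W : set V).

Definition discs_mostly_in U x : Prop :=
  forall eps : R, 0 < eps -> forall B : set V, nbhs x B ->
  exists f : Cx R -> V,
    [/\ holo_closed_disc B f, f 0 = x &
        ((1 - eps)%:E < arc_length (@unit_circle R `&` f @^-1` (B `&` U)))%E].

Lemma ereal_between (a b : \bar R) : (a < b)%E -> exists c : R, (a < c%:E)%E /\ (c%:E < b)%E.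
Proof.
case: a => [a| |]; case: b => [b| |]//.
- by rewrite lte_fin => ab; exists ((a + b) / 2); rewrite !lte_fin; split; lra.
- by move=> _; exists (a + 1); rewrite lte_fin ltry; split=> //; lra.
- by move=> _; exists (b - 1); rewrite lte_fin ltNyr; split=> //; lra.
- by move=> _; exists 0; rewrite ltNyr ltry.
Qed.

Lemma eballP x (r : R) y : eball x r y <-> sqr_enorm (y - x) <= r ^+ 2.
Proof.
rewrite /eball /= (_ : \sum_(i < n) _ = (sqr_enorm (y - x))%:C%C); last first.
  rewrite /sqr_enorm rmorph_sum; apply: eq_bigr => i _.
  by rewrite rmorphXn /= !mxE -rnormE.
by rewrite lecR.
Qed.

Lemma eball_rnorm x (r : R) y : 0 <= r -> eball x r y -> rnorm (y - x) <= r.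
Proof.
move=> r0 /eballP h; rewrite -ler_sqr ?nnegrE ?rnorm_ge0//.
exact: le_trans (rnorm_sqr_enorm _) h.
Qed.

Lemma eball_nbhs x (r : R) : 0 < r -> exists2 d : R, 0 < d &
  forall y, rnorm (y - x) < d -> eball x r y.
Proof.
move=> r0; exists (Num.min 1 (r ^+ 2 / n.+1%:R)).
  by rewrite lt_min ltr01 divr_gt0// exprn_gt0.
move=> y; rewrite lt_min ltr_pdivlMr// => /andP[y1 y2]; apply/eballP.
have h : sqr_enorm (y - x) <= n%:R * rnorm (y - x).
  rewrite (_ : n%:R * _ = \sum_(i < n) rnorm (y - x)); last first.
    by rewrite sumr_const card_ord mulr_natl.
  apply: ler_sum => i _; have h1 := rnorm_coord (y - x) i; have h2 := rnorm_ge0 ((y - x) ord0 i).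
  by move: h1 h2 y1; clear; nra.
have := rnorm_ge0 (y - x); rewrite -natr1 in y2; move: h y2; clear; lra.
Qed.

Lemma avg_usc_line (u : V -> \bar R) W y (A : V) (r : R) (j : R -> R) :
  plurisubharmonic W u -> 0 < r -> (forall l, rnorm l <= r -> W (y + l *: A)) ->
  continuous j -> (forall t, (u (y + (r%:C%C * expi t) *: A)%R <= (j t)%:E)%E) ->
  (u y <= (avg j)%:E)%E.
Proof.
move=> [_ _ psh] r0 Wl cj uj; have [_ usc sm] := psh y A.
pose g l := u (y + l *: A).
have nt t : rnorm (0 + r%:C%C * expi t : Cx R) <= r.
  by rewrite add0r rnormM rnorm_expi mulr1 rnormR ger0_norm// ltW.
have -> : u y = g 0 by rewrite /g scale0r addr0.
apply: le_trans (sm 0 r r0 _) _.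
  by move=> l; rewrite /closed_disc /= subr0 rnormE lecR => /Wl.
apply: circle_mean_le => //; last by move=> t; rewrite add0r.
apply: usc_measurable => t c hc.
have Dt : W (y + (0 + r%:C%C * expi t) *: A) by apply: Wl; exact: nt.
have cc : {for t, continuous (fun s : R => 0 + r%:C%C * expi s : Cx R)}.
  apply: continuousD; first exact: cst_continuous.
  by apply: continuousM; [exact: cst_continuous|exact: continuous_expi].
exact: cc _ (usc _ Dt c hc).
Qed.

(** Truncation from below makes a plurisubharmonic function bounded near a point
without losing the sub-mean inequality. *)
Definition trunc (u : V -> \bar R) (c : R) y : R := fine (maxe (u y) c%:E).

Lemma truncE u c y : (u y < +oo)%E -> (trunc u c y)%:E = maxe (u y) c%:E.
Proof.
move=> uy; rewrite /trunc fineK// fin_numE; apply/andP; split.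
  by rewrite gt_eqF// lt_max ltNyr orbT.
by rewrite lt_eqF// gt_max uy ltry.
Qed.

Lemma trunc_line W u c y (A : V) (r : R) (j : R -> R) :
  plurisubharmonic W u -> 0 < r -> (forall l, rnorm l <= r -> W (y + l *: A)) ->
  continuous j -> (forall t, trunc u c (y + (r%:C%C * expi t) *: A) <= j t) ->
  trunc u c y <= avg j.
Proof.
move=> psh r0 Wl cj wj; have [ufin _ _] := psh.
have Wy : W y by have := Wl 0; rewrite scale0r addr0; apply; rewrite rnorm0 ltW.
have nt t : rnorm (r%:C%C * expi t : Cx R) <= r.
  by rewrite rnormM rnorm_expi mulr1 rnormR ger0_norm// ltW.
have Wt t := ufin _ (Wl _ (nt t)).
rewrite -lee_fin truncE ?ufin// ge_max; apply/andP; split.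
  apply: avg_usc_line psh r0 Wl cj _ => t.
  apply: le_trans (_ : (trunc u c (y + (r%:C%C * expi t) *: A))%:E <= _)%E.
    by rewrite truncE// le_max lexx.
  by rewrite lee_fin.
rewrite lee_fin -(avg_cst c); apply: le_avg; [exact: rintegrable_cst|exact: rintegrable_cont|].
move=> t _; apply: le_trans (wj t).
by rewrite -lee_fin truncE// le_max lexx orbT.
Qed.

Lemma arc_length_set0 : arc_length (set0 : set (Cx R)) = 0%E.
Proof. by rewrite /arc_length preimage_set0 setI0 measure0 mule0. Qed.

Lemma arc_length_nonempty (A : set (Cx R)) (c : R) : 0 <= c -> (c%:E < arc_length A)%E -> exists z, A z.
Proof.
move=> c0 cA; apply: contrapT => no; suff A0 : A = set0.
  by move: cA; rewrite A0 arc_length_set0 lte_fin ltNge c0.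
by apply/seteqP; split=> // z Az; apply: no; exists z.
Qed.

Lemma avg_indic_bound (v : R -> R) (c M : R) (A : set R) : continuous v ->
  measurable A -> A `<=` `[0, 2 * pi] -> c <= M ->
  (forall t, v t <= M) -> (forall t, A t -> v t <= c) ->
  forall eps : R, ((2 * pi * (1 - eps))%:E < mu A)%E -> avg v <= c + (M - c) * eps.
Proof.
move=> vc mA Asub cM vM vc' eps hA.
have h2 := twopi_gt0 R.
have ind := rintegrable_indic mA.
have indE := avg_indic mA; rewrite setIidl// in indE.
have Afin := indic_circle_fin mA; rewrite setIidl// in Afin.
have : avg v <= avg (fun t => M - (M - c) * \1_A t).
  apply: le_avg; first exact: rintegrable_cont.
    by apply: rintegrableB; [exact: rintegrable_cst|exact: rintegrableZ].
  move=> t _; rewrite indicE; case: (boolP (t \in A)) => [|_].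
    by rewrite inE (_ : true%:R = 1)// => /vc'; lra.
  by have := vM t; rewrite (_ : false%:R = 0)//; lra.
rewrite avgB; last 2 first.
- exact: rintegrable_cst.
- exact: rintegrableZ.
rewrite avg_cst avgZ// indE.
have : 1 - eps <= (2 * pi)^-1 * fine (mu A).
  rewrite ler_pdivlMl// -lee_fin fineK; first exact: ltW.
  by rewrite ge0_fin_numE.
have Mc : 0 <= M - c by rewrite subr_ge0.
move=> /(ler_wpM2l Mc); lra.
Qed.

Lemma holo_coord_cderiv (f : Cx R -> V) z i : derivable f z 1 ->
  exists a, cderiv (fun u => f u ord0 i) z a.
Proof.
move=> /cvg_ex[l fl]; exists (l ord0 i); apply/cderivP.
have -> : (fun h : Cx R => h^-1 *: (f (h + z) ord0 i - f z ord0 i)) =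
    (fun M : V => M ord0 i) \o (fun h => h^-1 *: ((f \o shift z) (h *: 1) - f z)).
  by rewrite funeqE => h; rewrite /= !mxE [h *: 1]mulr1.
by apply: cvg_comp fl _; exact: coord_continuous.
Qed.

(** Suppose [c < u x].  The sub-mean inequality on a disc given by the hypothesis
bounds [u x] by the mean of a sup-convolution of the truncation of [u], at level
close to [c] on the part of the boundary in [U] and below [u x + 1] elsewhere. *)
Lemma discs_upper U x :
  discs_mostly_in U x ->
  open U -> ~ U x -> forall W (u : V -> \bar R), open W -> W x -> plurisubharmonic W u ->
  forall (c r0 : R), 0 < r0 -> (forall y, eball x r0 y -> U y -> (u y <= c%:E)%E) ->
  (u x <= c%:E)%E.
Proof.
move=> discs oU nUx W u oW Wx psh c r0 r00 uc; rewrite leNgt; apply/negP => cux.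
have [ufin usc _] := psh.
have uxr : (u x = (fine (u x))%:E).
  rewrite fineK// fin_numE; apply/andP; split; last by rewrite lt_eqF ?ufin.
  by rewrite gt_eqF//; apply: lt_trans cux; rewrite ltNyr.
set ux := fine (u x) in uxr; rewrite uxr lte_fin in cux.
pose M := ux + 1.
have /nbhs_rnormP[d1 d10 hW] : nbhs x W by exact: open_nbhs_nbhs.
have /nbhs_rnormP[d2 d20 hM] : \forall y \near x, (u y < M%:E)%E.
  by apply: usc => //; rewrite uxr lte_fin /M ltrDl.
have [d3 d30 hE] := eball_nbhs x r00.
pose R0 := Num.min d1 (Num.min d2 d3) / 2.
have R00 : 0 < R0 by rewrite divr_gt0// !lt_min d10 d20.
have R02 : R0 + R0 = Num.min d1 (Num.min d2 d3) by rewrite -splitr.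
pose S := [set y : V | rnorm (y - x) < R0 + R0].
have SW y : S y -> W y by rewrite /S /= R02 lt_min => /andP[/hW].
have SM y : S y -> (u y < M%:E)%E by rewrite /S /= R02 !lt_min => /and3P[_ /hM].
have SE y : S y -> eball x r0 y by rewrite /S /= R02 !lt_min => /and3P[_ _ /hE].
pose w := trunc u c.
have wE y : S y -> (w y)%:E = maxe (u y) c%:E by move=> /SW/ufin; exact: truncE.
have cM : c <= M by rewrite /M; move: cux; clear; lra.
have wcM y : S y -> c <= w y <= M.
  move=> Sy; rewrite -!lee_fin wE// le_max lexx orbT/= ge_max lee_fin cM andbT.
  exact/ltW/SM.
have wM y : S y -> w y <= M by move=> /wcM/andP[].
have wU y : S y -> U y -> w y <= c.
  by move=> Sy Uy; rewrite -lee_fin wE// ge_max lexx andbT; apply: uc => //; exact: SE.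
have Sx : S x by rewrite /S /= subrr rnorm0 addr_gt0.
have S0 : S !=set0 by exists x.
have SC y : S y -> rnorm (y - x) <= R0 + R0 by move=> /ltW.
pose B := [set y : V | rnorm (y - x) < R0].
have BS y : B y -> S y by move=> h; apply: lt_trans h _; rewrite ltrDl.
have nB : nbhs x B by apply/nbhs_rnormP; exists R0.
have oB : open B.
  rewrite openE => y By; apply/nbhs_rnormP; exists (R0 - rnorm (y - x)).
    by rewrite subr_gt0.
  move=> z zy; apply: le_lt_trans (ler_rdistD y _ _) _; rewrite -ltrBrDr//.
pose beta := ux - c; have beta0 : 0 < beta by rewrite subr_gt0.
(* chosen so that (M - c) * eps is a quarter of the gap u x - c *)
pose eps := beta / (4 * (beta + 1)).
have eps0 : 0 < eps by rewrite divr_gt0// mulr_gt0// addr_gt0.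
pose eta := beta / 4; have eta0 : 0 < eta by rewrite divr_gt0.
have [f [[[D [oD Dsub] fhol] fB] fx fU]] := discs eps eps0 B nB.
have fD z : rnorm z <= 1 -> derivable f z 1.
  by move=> z1; apply/fhol/Dsub; rewrite /closed_disc /= subr0 rnormE lecR.
have fd z : rnorm z <= 1 -> forall i, exists a, cderiv (fun u => f u ord0 i) z a.
  by move=> /fD fz i; exact: holo_coord_cderiv.
have fV z : rnorm z <= 1 -> rnorm (f z - x) < R0.
  by move=> z1; apply: fB; exists z => //; rewrite /closed_disc /= subr0 rnormE lecR.
(* from k0 on, the penalty is strong enough for supconv_holo_submean *)
pose k0 := `|M - c + 1| / (R0 / 2) ^+ 2 + 1.
have Rp : 0 < (R0 / 2) ^+ 2 by rewrite exprn_gt0// divr_gt0.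
have k00 : 0 <= k0 by rewrite addr_ge0// divr_ge0// ltW.
pose kk m : R := k0 + m%:R.
have kk0 m : 0 <= kk m by rewrite addr_ge0.
have hk m : M - c + 1 < kk m * (R0 / 2) ^+ 2.
  have h1 : `|M - c + 1| < k0 * (R0 / 2) ^+ 2.
    by rewrite /k0 mulrDl divfK ?lt0r_neq0// mul1r ltrDl.
  have h2 : 0 <= m%:R * (R0 / 2) ^+ 2 by rewrite mulr_ge0// ltW.
  by rewrite /kk mulrDl; have := ler_norm (M - c + 1); move: h1 h2; clear; lra.
pose v m t := supconv S w (kk m) (f (expi t)).
have feC : continuous (fun t => f (expi t)).
  move=> t; apply: (@continuous_comp _ _ _ (@expi R) f); first exact: continuous_expi.
  by apply: cderiv_row_continuous; apply: fd; rewrite rnorm_expi.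
have vC m : continuous (v m).
  move=> t; apply: (@continuous_comp _ _ _ (fun t => f (expi t)) (supconv S w (kk m))).
    exact: feC.
  exact: supconv_continuous S0 wM (kk0 m) SC _.
have main m : ux <= avg (v m).
  have := @supconv_holo_submean R n S w c M x R0 (kk m) f erefl R00 wcM _ fd fV (kk0 m) (hk m).
  move=> H; apply: le_trans (H _); last first.
    move=> y A r j r_gt0 Sl cj wj; apply: trunc_line psh r_gt0 _ cj wj => l lr.
    exact/SW/Sl.
  rewrite fx; apply: le_trans (supconv_self wM (kk0 m) Sx).
  by rewrite -lee_fin wE// le_max -uxr lexx.
pose T0 := `[0%R, 2 * pi[%classic `&` (fun t : R => f (expi t)) @^-1` (B `&` U).
pose A m := `[0%R, 2 * pi[%classic `&` v m @^-1` [set s | s < c + eta].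
have mA m : measurable (A m).
  apply: measurableI => //; apply: measurable_realfun.open_measurable.
  by apply: open_comp => [t _|]; [exact: vC|exact: open_lt].
have mT0 : measurable T0.
  apply: measurableI => //; apply: measurable_realfun.open_measurable.
  by apply: open_comp => [t _|]; [exact: feC|exact: openI].
have muT0 : ((2 * pi * (1 - eps))%:E < mu T0)%E.
  move: fU; rewrite /arc_length.
  have -> : `[0%R, 2 * pi[%classic `&` (@expi R) @^-1` (@unit_circle R `&` f @^-1` (B `&` U)) = T0.
    rewrite /T0; congr (_ `&` _); apply/seteqP; split=> t /=; first by case.
    by move=> h; split=> //; rewrite /unit_circle /= rnormE rnorm_expi.
  by rewrite EFinM lte_pdivlMl ?twopi_gt0.
have Aincr m m' : (m <= m')%N -> A m `<=` A m'.
  move=> mm' t [t02 /= vt]; split=> //=; apply: le_lt_trans vt.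
  by apply: supconv_anti S0 wM (kk0 m) _; rewrite lerD2l ler_nat.
have T0A : T0 `<=` \bigcup_m A m.
  move=> t [t02 [Bt Ut]].
  have oBU : open (B `&` U) by exact: openI.
  have /nbhs_rnormP[r r_gt0 hr] : nbhs (f (expi t)) (B `&` U).
    by apply: open_nbhs_nbhs; split.
  have [k1 k10 hk1] := @supconv_usc R n S w M (f (expi t)) c r S0 wM r_gt0
    (fun y Sy yr => wU y Sy (hr y yr).2).
  have [m hm] : exists m : nat, k1 <= m%:R.
    by exists (Num.bound k1); exact/ltW/archi_boundP.
  exists m => //; split=> //=; apply: (@le_lt_trans _ _ c).
    by apply: hk1; apply: le_trans hm _; rewrite lerDr.
  by rewrite ltrDl.
have mUA : measurable (\bigcup_m A m) by exact: bigcupT_measurable.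
(* the sup-convolutions are below c + eta on sets that increase to the good part *)
have muUA : ((2 * pi * (1 - eps))%:E < mu (\bigcup_m A m))%E.
  by apply: (lt_le_trans muT0); apply: le_measure; rewrite ?inE.
have [m hm] : exists m, ((2 * pi * (1 - eps))%:E < mu (A m))%E.
  apply: contrapT => no; move: muUA; apply/negP; rewrite -leNgt.
  have cv := @nondecreasing_cvg_mu _ _ _ mu A mA mUA _.
  have <- := cvg_lim _ (cv _) => //; last by move=> a b ab; exact/subsetPset/Aincr.
  apply: lime_le; first by apply/cvg_ex; eexists; apply: cv => a b ab; exact/subsetPset/Aincr.
  apply: nearW => a; rewrite leNgt; apply/negP => h; apply: no; by exists a.
have vM t : v m t <= M.
  apply: supconv_le => // y Sy; have := wM _ Sy.
  by have := mulr_ge0 (kk0 m) (sqr_enorm_ge0 (f (expi t) - y)); clear; lra.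
have := @avg_indic_bound (v m) (c + eta) M (A m) (vC m) (mA m) _ _ vM _ eps hm.
have eM : M - c = beta + 1 by rewrite /M /beta; ring.
have heps : (beta + 1) * eps = eta.
  by rewrite /eps /eta; field; rewrite lt0r_neq0// addr_gt0.
have := main m.
have h1 : A m `<=` `[0%R, 2 * pi].
  by move=> t [] /=; rewrite !in_itv/= => /andP[-> /ltW->].
have h2 : c + eta <= M by rewrite /M /eta; move: eM; rewrite /M; move: beta0; clear; lra.
have h3 t : A m t -> v m t <= c + eta by move=> [_ /ltW].
move=> h4 /(_ h1 h2 h3).
have h5 : (M - (c + eta)) * eps = eta - eta * eps by rewrite -heps -eM; ring.
rewrite h5; have : 0 < eta * eps by rewrite mulr_gt0.
have h6 : beta = 4 * eta by rewrite /eta; field.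
have h7 : ux = c + beta by rewrite /beta; ring.
by rewrite h7 h6 in h4; move: h4 eta0; clear; lra.
Qed.

(** If [x] lies outside [U] the values of [u] on [U] off [x] are all the values on
[U], and [discs_upper] applies.  If [x] lies in [U], a single small circle around
[x] on a line stays in [U] and off [x].  The other inequality for the upper limit is
upper semicontinuity. *)
Lemma discs_nonthin U x : (0 < n)%N -> open U ->
  discs_mostly_in U x ->
  nonthin U x.
Proof.
move=> n0 oU discs.
pose e : V := const_mx 1.
have ne : rnorm e = 1.
  apply/eqP; rewrite eq_le; apply/andP; split.
    by apply/rnorm_row_le => // i; rewrite mxE rnorm1.
  by have := rnorm_coord e (Ordinal n0); rewrite mxE rnorm1.
split.
  move=> B nB; have [f [_ _ fU]] := discs (1 / 2) ltac:(by lra) B nB.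
  have [|z [_ [Bz Uz]]] := arc_length_nonempty _ fU; first by lra.
  have [fzx|fzx] := eqVneq (f z) x; last by exists (f z); split=> //; split=> //; exact/eqP.
  have /nbhs_rnormP[d d0 hd] : nbhs x (B `&` U).
    by apply: filterI => //; apply: open_nbhs_nbhs; rewrite -{1}fzx; split=> //; rewrite -fzx.
  pose y := x + (d / 2)%:C%C *: e.
  have yx : rnorm (y - x) = d / 2.
    by rewrite addrAC subrr add0r rnormZ ne mulr1 rnormR ger0_norm// divr_ge0// ltW.
  have [|By Uy] := hd y; first by rewrite yx; move: d0; clear; lra.
  exists y; split=> //; split=> //= yxE; move: yx; rewrite yxE subrr rnorm0.
  by move: d0; clear; lra.
move=> W u oW Wx psh; have [ufin usc _] := psh.
apply/eqP; rewrite eq_le; apply/andP; split; rewrite leNgt; apply/negP => /ereal_between[c [h1 h2]].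
  have /nbhs_rnormP[d d0 hd] := usc _ Wx c h1.
  have d20 : 0 < d / 2 by rewrite divr_gt0.
  move: h2; apply/negP; rewrite -leNgt; apply: ereal_inf_le.
  exists (ereal_sup (u @` (eball x (d / 2) `&` (U `\ x)))); first by exists (d / 2).
  apply: ge_ereal_sup => _ [y [Ey _] <-]; apply/ltW/hd.
  by apply: le_lt_trans (eball_rnorm (ltW d20) Ey) _; move: d0; clear; lra.
have [_ [r0 r00 <-] h3] := ereal_inf_lt h1.
have uc y : eball x r0 y -> U y -> y <> x -> (u y <= c%:E)%E.
  move=> Ey Uy yx; apply: le_trans (ltW h3); apply: ereal_sup_ubound.
  by exists y.
move: h2; apply/negP; rewrite -leNgt.
have [Ux|nUx] := pselect (U x); last first.
  apply: (discs_upper discs oU nUx oW Wx psh r00) => y Ey Uy; apply: uc => // yx.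
  by apply: nUx; rewrite -yx.
have /nbhs_rnormP[d1 d10 hW] : nbhs x (W `&` U).
  by apply: filterI; apply: open_nbhs_nbhs.
have [d2 d20 hE] := eball_nbhs x r00.
pose r := Num.min d1 d2 / 2; have rm : 0 < Num.min d1 d2 by rewrite lt_min d10.
have r_gt0 : 0 < r by rewrite divr_gt0.
have rl (l : Cx R) : rnorm l <= r -> rnorm (x + l *: e - x) < Num.min d1 d2.
  move=> lr; rewrite addrAC subrr add0r rnormZ ne mulr1; apply: le_lt_trans lr _.
  by rewrite /r; move: rm; clear; lra.
have nt t : rnorm (r%:C%C * expi t : Cx R) = r.
  by rewrite rnormM rnorm_expi mulr1 rnormR ger0_norm// ltW.
rewrite -[c]avg_cst; apply: (avg_usc_line (A := e) psh r_gt0).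
- by move=> l /rl; rewrite lt_min => /andP[/hW[]].
- by move=> t; exact: cst_continuous.
- move=> t; have := rl (r%:C%C * expi t); rewrite nt lexx => /(_ isT).
  rewrite lt_min => /andP[/hW[_ Uy] /hE Ey]; apply: uc => // h.
  have := ne; have : rnorm ((r%:C%C * expi t) *: e) = 0.
    by have := congr1 (fun z => z - x) h; rewrite addrAC subrr add0r => ->; rewrite rnorm0.
  by rewrite rnormZ nt ne mulr1 => r0'; move: r_gt0; rewrite r0' ltxx.
Qed.

End DiscsNonthin.

(** * Riemann sums of periodic functions *)

Section RiemannSum.
Context (R : realType).
Implicit Types (h : R -> R) (s t : R).

Lemma rint_pieces h (D : R) k : continuous h -> 0 <= D ->
  rint 0 (k%:R * D) h = \sum_(l < k) rint (l%:R * D) (l.+1%:R * D) h.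
Proof.
move=> hc D0; elim: k => [|k ih].
  rewrite big_ord0 mul0r /rint set_itv1; exact: Rintegral_set1.
rewrite big_ord_recr /= -ih; apply: rint_split; first exact: rintegrable_cont.
by rewrite mulr_ge0//= ler_wpM2r// ler_nat.
Qed.

(** Translating the sampling points by one step permutes them modulo the period, so
[s] may be taken in the first cell, where each sample is close to the values of
[h] on its cell. *)
Lemma riemann_sum h (q : nat) (e : R) : continuous h ->
  (forall s, h (s + 2 * pi) = h s) ->
  (forall s t, `|s - t| <= 2 * pi / q.+1%:R -> `|h s - h t| <= e) ->
  forall s, 0 <= s -> avg h - e <= q.+1%:R^-1 * \sum_(l < q.+1) h (s + node R q l).
Proof.
move=> hc per mod; have tp := twopi_gt0 R.
pose D : R := 2 * pi / q.+1%:R; have D0 : 0 < D by rewrite divr_gt0.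
have nodeE l : node R q l = l%:R * D by rewrite /node /D mulrAC mulrC.
have DQ : q.+1%:R * D = 2 * pi by rewrite /D mulrC divfK// pnatr_eq0.
have nextD (l : nat) : D + l%:R * D = l.+1%:R * D by rewrite -natr1 mulrDl mul1r addrC.
pose A s := \sum_(l < q.+1) h (s + node R q l).
have Aper s : A (s + D) = A s.
  rewrite /A big_ord_recr big_ord_recl /= addrC; congr (_ + _).
    by rewrite !nodeE mul0r addr0 -addrA nextD DQ per.
  by apply: eq_bigr => l _; rewrite !nodeE -addrA nextD.
have Aper' k s : A (s + k%:R * D) = A s.
  elim: k => [|k ih]; first by rewrite mul0r addr0.
  by rewrite -natr1 mulrDl mul1r addrA Aper.
have small s : 0 <= s <= D -> avg h - e <= q.+1%:R^-1 * A s.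
  move=> /andP[s0 sD].
  have cell (l : 'I_q.+1) : rint (l%:R * D) (l.+1%:R * D) h <= (h (s + node R q l) + e) * D.
    have lD : l%:R * D <= l.+1%:R * D by rewrite ler_wpM2r ?ler_nat// ltW.
    have := @rint_close R _ _ (h (s + node R q l)) e h lD (rintegrable_cont _ _ hc) _.
    have -> : l.+1%:R * D - l%:R * D = D by rewrite -natr1; ring.
    move=> H; have {}H : `|rint (l%:R * D) (l.+1%:R * D) h - h (s + node R q l) * D| <= e * D.
      apply: H => x /andP[x0 x1]; apply: mod; rewrite -/D nodeE.
      by rewrite -natr1 mulrDl mul1r in x1; rewrite ler_norml; apply/andP; split; move: x0 x1 s0 sD; clear; lra.
    by move: H; rewrite ler_norml => /andP[_]; clear; lra.
  have : rint 0 (2 * pi) h <= \sum_(l < q.+1) (h (s + node R q l) + e) * D.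
    by rewrite -DQ (rint_pieces _ hc (ltW D0)); exact: ler_sum.
  rewrite -mulr_suml big_split /= sumr_const card_ord -/(A s) -[e *+ _]mulr_natl => H.
  rewrite /avg lerBlDr ler_pdivrMl//; apply: le_trans H _.
  rewrite le_eqVlt; apply/orP; left; apply/eqP; rewrite /D; field.
  by rewrite addrC natr1 pnatr_eq0.
move=> s s0; have sD0 : 0 <= s / D by rewrite divr_ge0// ltW.
pose k := Num.truncn (s / D).
have /andP[k1 k2] : k%:R <= s / D < k.+1%:R by exact: truncn_itv.
rewrite -/(A s) (_ : s = (s - k%:R * D) + k%:R * D); last by rewrite subrK.
rewrite Aper'; apply: small; rewrite subr_ge0 -ler_pdivlMr// k1/=.
have /ltW := k2; rewrite ler_pdivrMr// -natr1 mulrDl mul1r; clear; lra.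
Qed.

End RiemannSum.

(** * The disc functional *)

Section DiscFunctional.
Context (R : realType) (n : nat).
Local Notation V := 'rV[Cx R]_n.
Implicit Types (p q x : V) (U : set V) (chi : V -> R) (phi : 'I_n -> {poly Cx R}).

Definition poly_row phi (z : Cx R) : V := \row_i (phi i).[z].

(** The polynomial disc centred at [p] with coordinates [p_i + z * phi_i z]; keeping
[phi] and moving [p] translates the disc. *)
Definition poly_disc p phi (z : Cx R) : V := p + z *: poly_row phi z.

Lemma scale_poly_row_continuous phi : continuous (fun z : Cx R => z *: poly_row phi z).
Proof.
move=> z; apply: cderiv_row_continuous => i; exists ((phi i * 'X)^`()).[z].
have := cderiv_horner (phi i * 'X) z; congr cderiv.
by rewrite funeqE => u; rewrite !mxE hornerMX mulrC.
Qed.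

Lemma poly_disc_continuous p phi : continuous (poly_disc p phi).
Proof.
move=> z; apply: cderiv_row_continuous => i; exists ((phi i * 'X + (p ord0 i)%:P)^`()).[z].
have := cderiv_horner (phi i * 'X + (p ord0 i)%:P) z; congr cderiv.
by rewrite funeqE => u; rewrite !mxE !hornerE mulrC addrC.
Qed.

(** Continuous minorants of the indicator function of [U].  The Lipschitz condition
makes the mean of a cutoff stable under uniformly small changes of a disc. *)
Definition cutoff U chi : Prop :=
  [/\ forall p, 0 <= chi p <= 1, forall p, ~ U p -> chi p = 0 &
      exists2 L : R, 0 <= L & forall p q, `|chi p - chi q| <= L * rnorm (p - q)].

Lemma cutoff_continuous U chi : cutoff U chi -> continuous chi.
Proof.
move=> [_ _ [L L0 hL]] p; apply/continuous_CRP => e e0.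
have L1 : 0 < L + 1 by rewrite ltr_wpDl.
exists (e / (L + 1)); first by rewrite divr_gt0.
move=> q; rewrite ltr_pdivlMr// => qp; apply: le_lt_trans (hL q p) _.
by have := rnorm_ge0 (q - p); move: qp; clear; lra.
Qed.

Lemma cutoff0 U : cutoff U (fun=> 0).
Proof.
split=> //; first by move=> _; rewrite lexx ler01.
by exists 0 => // p q; rewrite subrr normr0 mul0r.
Qed.

Lemma maxr_lip (a b c d e : R) : `|a - c| <= e -> `|b - d| <= e ->
  `|Num.max a b - Num.max c d| <= e.
Proof.
rewrite !ler_norml => /andP[h1 h2] /andP[h3 h4].
by rewrite /Num.max; case: ltP => h5; case: ltP => h6; apply/andP; split; lra.
Qed.

Lemma cutoff_max U chi chi' : cutoff U chi -> cutoff U chi' ->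
  cutoff U (fun p => Num.max (chi p) (chi' p)).
Proof.
move=> [a1 a2 [L L0 a3]] [b1 b2 [L' L'0 b3]]; split.
- by move=> p; have /andP[h1 h2] := a1 p; have /andP[h3 h4] := b1 p; rewrite le_max h1/= ge_max h2.
- by move=> p nU; rewrite a2// b2// maxxx.
- exists (L + L') => [|p q]; first exact: addr_ge0.
  have r0 := rnorm_ge0 (p - q).
  apply: maxr_lip.
    by apply: le_trans (a3 p q) _; rewrite ler_wpM2r// lerDl.
  by apply: le_trans (b3 p q) _; rewrite ler_wpM2r// lerDr.
Qed.

Lemma cutoff_maxs U (chi : nat -> V -> R) (m : nat) : (forall k, cutoff U (chi k)) ->
  exists2 X, cutoff U X & forall k p, (k < m)%N -> chi k p <= X p.
Proof.
move=> H; elim: m => [|m [X cX hX]]; first by exists (fun=> 0) => //; exact: cutoff0.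
exists (fun p => Num.max (X p) (chi m p)); first exact: cutoff_max.
move=> k p; rewrite ltnS leq_eqVlt => /predU1P[->|km]; first by rewrite le_max lexx orbT.
by rewrite le_max hX.
Qed.

Lemma cutoff_tent U p : open U -> U p -> exists2 chi, cutoff U chi & chi p = 1.
Proof.
move=> oU Up; have /nbhs_rnormP[r r0 hr] : nbhs p U by exact: open_nbhs_nbhs.
exists (fun q => Num.max 0 (1 - rnorm (q - p) / r)); last first.
  by rewrite subrr rnorm0 mul0r subr0 max_r// ler01.
split.
- move=> q; rewrite le_max lexx/= ge_max ler01/= gerBl divr_ge0 ?rnorm_ge0//.
  exact: ltW.
- move=> q nUq; apply: max_l; rewrite subr_le0 ler_pdivlMr// mul1r leNgt.
  by apply/negP => /hr.
- exists r^-1 => [|q q']; first by rewrite invr_ge0 ltW.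
  apply: maxr_lip; first by rewrite subrr normr0 mulr_ge0 ?rnorm_ge0// invr_ge0 ltW.
  have -> : 1 - rnorm (q - p) / r - (1 - rnorm (q' - p) / r) = r^-1 * (rnorm (q' - p) - rnorm (q - p)) by ring.
  rewrite normrM ger0_norm ?invr_ge0 ?(ltW r0)// ler_wpM2l ?invr_ge0 ?(ltW r0)//.
  apply: le_trans (ler_rdist _ _) _.
  by rewrite opprB addrA subrK rdistC.
Qed.

(** Only the boundary of the disc is constrained; the maximum modulus principle
takes care of its interior. *)
Definition circle_in_ball x (rho : R) p phi := forall z, rnorm z = 1 -> rnorm (poly_disc p phi z - x) < rho.

(** Poletsky's disc functional for the indicator function of [U] in the ball of
centre [x] and radius [rho]. *)
Definition disc_value U x rho p : R :=
  sup [set c | exists phi chi, [/\ cutoff U chi, circle_in_ball x rho p phi &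
                 c = avg (fun t => chi (poly_disc p phi (expi t)))]].

Lemma cutoff_poly_disc_continuous U chi p phi : cutoff U chi ->
  continuous (fun t => chi (poly_disc p phi (expi t))).
Proof.
move=> cchi t; apply: (@continuous_comp _ _ _ (@expi R) (fun z => chi (poly_disc p phi z))).
  exact: continuous_expi.
by apply: continuous_comp; [exact: poly_disc_continuous|exact: cutoff_continuous cchi _].
Qed.

Lemma avg_cutoff01 U chi p phi : cutoff U chi ->
  0 <= avg (fun t => chi (poly_disc p phi (expi t))) <= 1.
Proof.
move=> cchi; have cc := cutoff_poly_disc_continuous (p := p) (phi := phi) cchi; have [c01 _ _] := cchi.
rewrite -{1}(avg_cst (0 : R)) -[X in _ <= _ <= X](avg_cst (1 : R)); apply/andP; split.
  by apply: le_avg; [exact: rintegrable_cst|exact: rintegrable_cont|move=> t _; have /andP[] := c01 (poly_disc p phi (expi t))].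
by apply: le_avg; [exact: rintegrable_cont|exact: rintegrable_cst|move=> t _; have /andP[] := c01 (poly_disc p phi (expi t))].
Qed.

Lemma disc_value_ge U x rho p phi chi : cutoff U chi -> circle_in_ball x rho p phi ->
  avg (fun t => chi (poly_disc p phi (expi t))) <= disc_value U x rho p.
Proof.
move=> cchi inb; apply: ub_le_sup; last by exists phi, chi.
by exists 1 => _ [psi [chi' [cchi' _ ->]]]; have /andP[] := avg_cutoff01 p psi cchi'.
Qed.

Lemma poly_disc0 p z : poly_disc p (fun=> 0) z = p.
Proof.
rewrite /poly_disc (_ : poly_row _ z = 0) ?scaler0 ?addr0//.
by apply/rowP => i; rewrite !mxE horner0.
Qed.

Lemma disc_value_nonempty U x rho p : rnorm (p - x) < rho ->
  [set c | exists phi chi, [/\ cutoff U chi, circle_in_ball x rho p phi &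
                 c = avg (fun t => chi (poly_disc p phi (expi t)))]] !=set0.
Proof.
move=> px; eexists; exists (fun=> 0), (fun=> 0); split; last reflexivity.
  exact: cutoff0.
by move=> z _; rewrite poly_disc0.
Qed.

Lemma disc_value_adherent U x rho p c : rnorm (p - x) < rho -> c < disc_value U x rho p ->
  exists phi chi, [/\ cutoff U chi, circle_in_ball x rho p phi &
    c < avg (fun t => chi (poly_disc p phi (expi t)))].
Proof.
move=> px cE; have e0 : 0 < disc_value U x rho p - c by rewrite subr_gt0.
have hs : has_sup [set c | exists phi chi, [/\ cutoff U chi, circle_in_ball x rho p phi &
                 c = avg (fun t => chi (poly_disc p phi (expi t)))]].
  split; first exact: disc_value_nonempty px.
  by exists 1 => _ [psi [chi' [cchi' _ ->]]]; have /andP[] := avg_cutoff01 p psi cchi'.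
have [_ [phi [chi [cchi inb ->]]] h] := sup_adherent e0 hs.
by exists phi, chi; split=> //; rewrite subKr in h.
Qed.

Lemma disc_value01 U x rho p : rnorm (p - x) < rho -> 0 <= disc_value U x rho p <= 1.
Proof.
move=> px; apply/andP; split.
  have := @disc_value_ge U x rho p (fun=> 0) (fun=> 0) (cutoff0 U).
  by rewrite avg_cst; apply => z _; rewrite poly_disc0.
apply: ge_sup; first exact: disc_value_nonempty px.
by move=> _ [psi [chi' [cchi' _ ->]]]; have /andP[] := avg_cutoff01 p psi cchi'.
Qed.

Lemma disc_value_in U x rho p : open U -> U p -> rnorm (p - x) < rho -> disc_value U x rho p = 1.
Proof.
move=> oU Up px; apply/eqP; rewrite eq_le; have /andP[_ ->]/= := disc_value01 U px.
have [chi cchi chip] := cutoff_tent oU Up.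
have := @disc_value_ge U x rho p (fun=> 0) chi cchi.
rewrite (_ : (fun t => _) = fun=> 1) ?avg_cst; last by rewrite funeqE => t; rewrite poly_disc0.
by apply => z _; rewrite poly_disc0.
Qed.

Lemma circle_in_ball_margin x rho p phi : circle_in_ball x rho p phi ->
  exists2 m : R, m < rho & forall z, rnorm z = 1 -> rnorm (poly_disc p phi z - x) <= m.
Proof.
move=> inb.
have [z _|zm zm1 hm] := @circle_max R (fun z => rnorm (poly_disc p phi z - x)); last first.
  by exists (rnorm (poly_disc p phi zm - x)); [exact: inb|].
apply: continuous_comp; last exact: continuous_rnorm.
by apply: continuousB; [exact: poly_disc_continuous|exact: cst_continuous].
Qed.

Lemma poly_disc_shift p q phi z : poly_disc q phi z = poly_disc p phi z + (q - p).
Proof. by rewrite /poly_disc addrAC (addrC p) subrK. Qed.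

(** The margin of a compact circle in an open ball and the Lipschitz constant of
[chi] both survive a small translation. *)
Lemma disc_perturb U x rho p phi chi (e : R) : cutoff U chi -> circle_in_ball x rho p phi -> 0 < e ->
  exists2 d : R, 0 < d & forall q, rnorm (q - p) < d ->
    (forall z, rnorm z = 1 -> rnorm (poly_disc q phi z - x) < rho - d) /\
    avg (fun t => chi (poly_disc p phi (expi t))) - e <= avg (fun t => chi (poly_disc q phi (expi t))).
Proof.
move=> cchi inb e0; have [m mrho hm] := circle_in_ball_margin inb.
have [_ _ [L L0 hL]] := cchi; have L1 : 0 < L + 1 by rewrite ltr_wpDl.
exists (Num.min ((rho - m) / 2) (e / (L + 1))).
  by rewrite lt_min !divr_gt0// subr_gt0.
move=> q; rewrite lt_min => /andP[q1 q2]; split.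
  move=> z z1; have h1 : Num.min ((rho - m) / 2) (e / (L + 1)) <= (rho - m) / 2 by rewrite ge_min lexx.
  rewrite (poly_disc_shift p) addrAC; have := ler_rnormD (poly_disc p phi z - x) (q - p).
  by have := hm z z1; move: q1 h1; clear; lra.
rewrite ltr_pdivlMr// in q2.
rewrite -[X in _ - X]avg_cst -avgB; last 2 first.
- by apply: rintegrable_cont; exact: cutoff_poly_disc_continuous cchi.
- exact: rintegrable_cst.
apply: le_avg; first apply: rintegrableB.
- by apply: rintegrable_cont; exact: cutoff_poly_disc_continuous cchi.
- exact: rintegrable_cst.
- by apply: rintegrable_cont; exact: cutoff_poly_disc_continuous cchi.
move=> t _; have := hL (poly_disc q phi (expi t)) (poly_disc p phi (expi t)).
rewrite (_ : poly_disc q phi _ - _ = q - p) ?ler_norml; last by rewrite (poly_disc_shift p q) addrC addKr.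
move=> /andP[h1 _].
by have := rnorm_ge0 (q - p); move: h1 q2; clear; lra.
Qed.

Lemma disc_value_lsc U x rho p c : rnorm (p - x) < rho -> c < disc_value U x rho p ->
  exists2 d : R, 0 < d & forall q, rnorm (q - p) < d -> c < disc_value U x rho q.
Proof.
move=> px /(disc_value_adherent px)[phi [chi [cchi inb lt]]].
have e0 : 0 < (avg (fun t => chi (poly_disc p phi (expi t))) - c) / 2 by rewrite divr_gt0// subr_gt0.
have [d d0 hd] := disc_perturb cchi inb e0.
exists d => // q /hd[h1 h2]; apply: (@lt_le_trans _ _ (avg (fun t => chi (poly_disc q phi (expi t))))).
  by move: h2 lt; clear; lra.
apply: disc_value_ge => // z /h1/lt_trans; apply.
by rewrite gtrBl.
Qed.

End DiscFunctional.

(** * Gluing discs along a circle *)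

Section Gluing.
Context (R : realType).
Local Notation avg_integrable := (@rintegrable R 0 (2 * pi)).

Lemma expi_close (e : R) : 0 < e -> exists2 th : R, 0 < th &
  forall s t, `|s - t| <= th -> rnorm (expi s - expi t) < e.
Proof.
move=> e0; have e20 : 0 < e ^+ 2 / 2 by rewrite divr_gt0// exprn_gt0.
have /continuous_RRP/(_ _ e20)[d d0 hd] := @continuous_cos R 0.
exists (d / 2); first by rewrite divr_gt0.
move=> s t st; have := hd (s - t); rewrite subr0 cos0.
move=> /(_ ltac:(by apply: le_lt_trans st _; clear -d0; lra)).
rewrite ltr_norml => /andP[h _]; rewrite -ltr_sqr ?nnegrE ?rnorm_ge0 ?(ltW e0)//.
by rewrite rdist_expi; move: h; clear; lra.
Qed.

Lemma cos_far (th u : R) : 0 <= th <= pi -> th <= `|u| <= 2 * pi - th -> cos u <= cos th.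
Proof.
move=> /andP[t0 tpi] /andP[u1 u2]; rewrite -cos_norm.
have mono v : th <= v -> v <= pi -> cos v <= cos th.
  move=> tv vpi; rewrite leNgt ltr_cos ?in_itv/= ?t0//; first by rewrite -leNgt.
  by rewrite (le_trans t0 tv).
have [upi|piu] := leP `|u| pi; first exact: mono.
have -> : cos `|u| = cos (2 * pi - `|u|).
  by rewrite cosB mulr_natl cos2pi sin2pi mul1r mul0r addr0.
by apply: mono; move: u2 piu; clear; lra.
Qed.

Context (n : nat).
Local Notation V := 'rV[Cx R]_n.
Implicit Types (p q x a b : V) (U : set V) (chi psi : V -> R).

(** The far nodes have total weight at most [eta], so a crude bound [C] suffices for
their vectors. *)
Lemma rnorm_weighted_sum (N : nat) (kap eta B C t : R) (v : nat -> V) :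
  \sum_(j < N.+1 | cos (t - node R N j) <= kap) weight N j t <= eta ->
  0 <= B -> 0 <= C ->
  (forall j, (j < N.+1)%N -> kap < cos (t - node R N j) -> rnorm (v j) <= B) ->
  (forall j, (j < N.+1)%N -> rnorm (v j) <= C) ->
  rnorm (\sum_(j < N.+1) (weight N j t)%:C%C *: v j) <= B + C * eta.
Proof.
move=> heta B0 C0 vB vC; apply: le_trans (ler_rnorm_sum _ _ _) _.
apply: (@le_trans _ _ (\sum_(j < N.+1) (B * weight N j t +
   (if cos (t - node R N j) <= kap then C * weight N j t else 0)))).
  apply: ler_sum => j _; rewrite rnormZ rnormR ger0_norm ?weight_ge0//.
  have w0 := weight_ge0 N j t; case: (leP (cos (t - node R N j)) kap) => h.
    have := vC j (ltn_ord j); have : 0 <= B * weight N j t by rewrite mulr_ge0.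
    by move: w0; clear; nra.
  by rewrite addr0 mulrC ler_wpM2r// vB.
rewrite big_split /= -mulr_sumr sum_weight mulr1 -big_mkcond /= -mulr_sumr.
by rewrite lerD2l ler_wpM2l.
Qed.

(** The factor [z ^ (N + 1)] at which the discs are evaluated provides the power
[z ^ N] that turns the weights into polynomials, and one more factor [z] that
makes the result a disc centred at [a]. *)
Definition glue b N (c : Cx R) (phi : nat -> 'I_n -> {poly Cx R}) : 'I_n -> {poly Cx R} :=
  fun i => (b ord0 i)%:P + \sum_(j < N.+1) (c *: wpoly R N j) * (phi j i \Po (c *: 'X^(N.+1))).

Lemma glueE a b N c phi t : poly_disc a (glue b N c phi) (expi t) =
  \sum_(j < N.+1) (weight N j t)%:C%C *:
    poly_disc (a + expi t *: b) (phi j) (c * expi t ^+ N.+1).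
Proof.
apply/rowP => i; rewrite summxE !mxE /glue !hornerE horner_sum.
under [RHS]eq_bigr => j _ do rewrite !mxE mulrDr.
rewrite big_split /= -mulr_suml -[\sum_(j < N.+1) (weight N j t)%:C%C]rmorph_sum.
rewrite sum_weight mul1r mulrDr addrA mulr_sumr; congr (_ + _).
apply: eq_bigr => j _; rewrite hornerM hornerZ wpolyE horner_comp hornerZ hornerXn exprS; ring.
Qed.

Lemma line_continuous a b : continuous (fun z : Cx R => a + z *: b).
Proof.
move=> z0; apply: cderiv_row_continuous => i; exists (b ord0 i).
have := cderivD (cderiv_cst (a ord0 i) z0) (cderivZ (b ord0 i) (cderiv_id z0)).
rewrite add0r mulr1; congr cderiv; rewrite funeqE => u.
by rewrite !mxE mulrC.
Qed.

Lemma circle_continuous a b : continuous (fun t : R => a + expi t *: b).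
Proof.
move=> t; apply: (@continuous_comp _ _ _ (@expi R) (fun z : Cx R => a + z *: b)).
  exact: continuous_expi.
exact: line_continuous.
Qed.

(** A disc nearly optimal at one point of the circle is, after translation, nearly
optimal at the points nearby; compactness makes the range of translation uniform. *)
Lemma local_discs U x (rho : R) a b psi (tau : R) :
  (forall z, rnorm z = 1 -> rnorm (a + z *: b - x) < rho) -> continuous psi ->
  (forall p, rnorm (p - x) < rho -> psi p <= disc_value U x rho p) -> 0 < tau ->
  exists2 del : R, 0 < del & forall z0, rnorm z0 = 1 -> exists phi chi, cutoff U chi /\
    forall w, rnorm w = 1 -> rnorm (w - z0) < del ->
    (forall z, rnorm z = 1 -> rnorm (poly_disc (a + w *: b) phi z - x) < rho - del) /\
    psi (a + w *: b) - tau <= avg (fun t => chi (poly_disc (a + w *: b) phi (expi t))).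
Proof.
move=> inb psic psiE tau0; apply: lebesgue_number; first exact: compact_circle.
move=> z0 z01; set p := a + z0 *: b.
have t40 : 0 < tau / 4 by rewrite divr_gt0.
have px : rnorm (p - x) < rho by exact: inb.
have [|phi [chi [cchi phib lt]]] := @disc_value_adherent R n U x rho p (psi p - tau / 4) px.
  by apply: lt_le_trans (psiE _ px); rewrite gtrBl.
have [d d0 hd] := disc_perturb cchi phib t40.
have gc : {for z0, continuous (fun z : Cx R => a + z *: b)} by exact: line_continuous.
have /continuous_rnormP/(_ _ d0)[d1 d10 h1] := gc.
have pgc : {for z0, continuous (fun z : Cx R => psi (a + z *: b))}.
  exact: (continuous_comp gc (psic _)).
have /continuous_CRP/(_ _ t40)[d2 d20 h2] := pgc.
exists (Num.min d (Num.min d1 d2 / 2)).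
  by rewrite lt_min d0 divr_gt0// lt_min d10.
move=> w0 r; rewrite lt_min => /andP[_ w2] /andP[r0]; rewrite lt_min => /andP[rd r2].
exists phi, chi; split; first exact: cchi.
move=> w w1 wr.
have wz : rnorm (w - z0) < Num.min d1 d2.
  by have := ler_rdistD w0 w z0; move: w2 r2 wr; clear; lra.
move: wz; rewrite lt_min => /andP[/h1 wp /h2 wpsi].
have [k1 k2] := hd _ wp; split.
  by move=> z /k1 /lt_trans; apply; rewrite ltrD2l ltrN2.
move: wpsi; rewrite ltr_norml => /andP[_ wpsi].
apply: le_trans k2; move: lt wpsi tau0; rewrite -/p.
move: (psi p) (psi (a + w *: b)) (avg _) => u1 u2 u3; clear; lra.
Qed.

Lemma common_threshold (P : nat -> nat -> Prop) (M : nat) :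
  (forall m, exists k0, forall k, (k0 <= k)%N -> P m k) ->
  exists k, forall m, (m < M)%N -> P m k.
Proof.
move=> H; pose k0 m := projT1 (cid (H m)).
have hk0 m k : (k0 m <= k)%N -> P m k by rewrite /k0; case: cid => /= k' h /h.
exists (\sum_(m < M) k0 m)%N => m mM; apply: hk0.
by rewrite (bigD1 (Ordinal mM))//= leq_addr.
Qed.

Lemma avg_bad (M : nat) (th tau : R) (s : nat -> R) : 0 < th -> th <= tau / M.+1%:R ->
  avg (fun t => \sum_(m < M.+1) \1_(`[s m - th, s m + th]%classic) t) <= tau.
Proof.
move=> th0 thM; have tp := twopi_gt0 R.
have mI m : measurable (`[s m - th, s m + th]%classic : set R) by [].
rewrite avg_sum; last by move=> m; exact: rintegrable_indic.
have bd (m : 'I_M.+1) : avg (\1_(`[s m - th, s m + th]%classic)) <= tau / M.+1%:R.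
  rewrite avg_indic// ler_pdivrMl//.
  have h : (lebesgue_measure (`[s m - th, s m + th]%classic : set R) = (th + th)%:E).
    have := @lebesgue_measure_itv R `[s m - th, s m + th]; rewrite /= => ->.
    rewrite lte_fin (_ : s m - th < s m + th); last by move: th0; clear; lra.
    by rewrite -EFinB; congr (_%:E); ring.
  apply: (@le_trans _ _ (th + th)).
    rewrite -lee_fin fineK ?ge0_fin_numE//; last exact: indic_circle_fin.
    by rewrite -h; apply: le_measure; rewrite ?inE//; exact: measurableI.
  have y0 : 0 <= tau / M.+1%:R by apply: le_trans thM; exact: ltW.
  have := ler_wpM2r y0 (pi_ge2 R); move: thM y0; rewrite -mulrA; move: (tau / _) => y.
  by clear; lra.
apply: le_trans (ler_sum _ (fun m _ => bd m)) _.
by rewrite sumr_const card_ord -[_ *+ _]mulr_natl mulrC divfK// pnatr_eq0.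
Qed.

Lemma glue_dist a b q N c phi (kap eta B C t : R) :
  \sum_(j < N.+1 | cos (t - node R N j) <= kap) weight N j t <= eta ->
  0 <= B -> 0 <= C ->
  (forall j, (j < N.+1)%N -> kap < cos (t - node R N j) ->
     rnorm (poly_disc (a + expi t *: b) (phi j) (c * expi t ^+ N.+1) - q) <= B) ->
  (forall j, (j < N.+1)%N ->
     rnorm (poly_disc (a + expi t *: b) (phi j) (c * expi t ^+ N.+1) - q) <= C) ->
  rnorm (poly_disc a (glue b N c phi) (expi t) - q) <= B + C * eta.
Proof.
move=> heta B0 C0 hB hC; rewrite glueE.
have {1}-> : q = \sum_(j < N.+1) (weight N j t)%:C%C *: q.
  by rewrite -scaler_suml -rmorph_sum sum_weight scale1r.
rewrite -sumrB; under eq_bigr do rewrite -scalerBr.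
exact: (@rnorm_weighted_sum N kap eta B C t
  (fun j => poly_disc (a + expi t *: b) (phi j) (c * expi t ^+ N.+1) - q)).
Qed.

(** The index of the arc [node M m, node M (m + 1)[ that contains [node N j]. *)
Definition block M N j := (j * M.+1 %/ N.+1)%N.

Lemma node_lt N i j : (i < j)%N -> node R N i < node R N j.
Proof.
by move=> ij; rewrite /node ltr_pM2r ?invr_gt0// ltr_pM2l ?twopi_gt0// ltr_nat.
Qed.

Lemma node_le N i j : (i <= j)%N -> node R N i <= node R N j.
Proof. by rewrite leq_eqVlt => /orP[/eqP ->//|/(node_lt N)/ltW]. Qed.

Lemma node_end N : node R N N.+1 = 2 * pi.
Proof. by rewrite /node mulfK ?pnatr_eq0. Qed.

Lemma nodeS N j : node R N j.+1 = node R N j + 2 * pi / N.+1%:R.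
Proof. by rewrite /node -natr1; field; rewrite addrC natr1 pnatr_eq0. Qed.

Lemma block_bound M N j : (j < N.+1)%N ->
  [/\ (block M N j < M.+1)%N, node R M (block M N j) <= node R N j &
      node R N j < node R M (block M N j).+1].
Proof.
move=> jN; split.
- by rewrite ltn_divLR// mulnC ltn_mul2l.
- rewrite /node ler_pdivrMr// [leRHS]mulrAC ler_pdivlMr//.
  rewrite -!mulrA ler_wpM2l// ler_wpM2l ?pi_ge0// -!natrM ler_nat.
  exact: leq_divM.
- rewrite /node ltr_pdivrMr// [ltRHS]mulrAC ltr_pdivlMr//.
  rewrite -!mulrA ltr_pM2l// ltr_pM2l ?pi_gt0// -!natrM ltr_nat.
  exact: ltn_ceil.
Qed.

Lemma locate_node M t : 0 <= t < 2 * pi ->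
  exists2 m, (m < M.+1)%N & node R M m <= t < node R M m.+1.
Proof.
rewrite -(node_end M) => /andP[t0].
elim: M.+1 => [|k ih] tk; first by move: tk; rewrite /node mulr0 mul0r ltNge t0.
have [/ih[m mk h]|h] := ltP t (node R M k); first by exists m => //; exact: ltnW.
by exists k => //; rewrite h.
Qed.

(** Outside the [th]-neighbourhoods of the ends of the arcs, [t] is well inside an
arc. *)
Lemma locate_good M (th t : R) : 0 <= t <= 2 * pi -> 0 <= th ->
  1 <= \sum_(m < M.+2) \1_(`[node R M m - th, node R M m + th]%classic) t :> R \/
  exists2 m, (m < M.+1)%N & node R M m + th < t < node R M m.+1 - th.
Proof.
move=> /andP[t0 t2] th0.
have [[m /andP[h1 h2]]|H] := pselect (exists m : 'I_M.+2, node R M m - th <= t <= node R M m + th).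
  left; rewrite (bigD1 m)//= indicE mem_set/=; last by rewrite in_itv/= h1 h2.
  by rewrite lerDl sumr_ge0// => i _; rewrite indicE.
have far m : (m < M.+2)%N -> t < node R M m - th \/ node R M m + th < t.
  move=> mM; have [?|h1] := ltP t (node R M m - th); first by left.
  have [?|h2] := ltP (node R M m + th) t; first by right.
  by case: H; exists (Ordinal mM); rewrite /= h1 h2.
right; have t2' : t < 2 * pi.
  have := far M.+1 (ltnSn _); rewrite node_end => -[|]; move: t2 th0; clear; lra.
have [|m mM /andP[h1 h2]] := @locate_node M t; first by rewrite t0.
exists m => //; apply/andP; split.
  by case: (far m (ltnW mM)) => //; move: h1 th0; clear; lra.
by case: (far m.+1 mM) => //; move: h2 th0; clear; lra.
Qed.

Lemma locate_close M (th t : R) m : 0 <= th ->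
  node R M m + th < t < node R M m.+1 - th -> `|t - node R M m| <= 2 * pi / M.+1%:R.
Proof.
rewrite nodeS; move: (2 * pi / _) (node R M m) => D s th0 /andP[t1 t2].
by rewrite ger0_norm; move: th0 t1 t2; clear; lra.
Qed.

(** A node close to a point well inside an arc belongs to the same arc, since the
cosine of the distance to any other arc is at most [cos th]. *)
Lemma block_near M N (th t : R) m j : 0 <= th <= pi -> (m < M.+1)%N -> (j < N.+1)%N ->
  node R M m + th < t < node R M m.+1 - th -> cos th < cos (t - node R N j) ->
  block M N j = m.
Proof.
move=> thp mM jN /andP[t1 t2] near; have [_ b1 b2] := block_bound M jN.
have /andP[th0 _] := thp.
have j0 : 0 <= node R N j < 2 * pi by exact: node_bound.
have m0 : 0 <= node R M m by case/andP: (node_bound R mM).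
have mS : node R M m.+1 <= 2 * pi by rewrite -(node_end M) node_le.
have far : ~ th <= `|t - node R N j| <= 2 * pi - th.
  by move=> /(cos_far thp); rewrite leNgt near.
case: (ltngtP (block M N j) m) => // h; case: far.
  have hm := node_le M h; have h0 : 0 <= t - node R N j by move: b2 t1 hm th0; clear; lra.
  by rewrite ger0_norm//; apply/andP; split; move: b2 t1 t2 hm mS j0 th0; clear; lra.
have hm := node_le M h; have h0 : t - node R N j <= 0 by move: b1 t2 hm th0; clear; lra.
by rewrite ler0_norm//; apply/andP; split; move: b1 t1 t2 hm m0 j0 th0; clear; lra.
Qed.

Lemma small_arc (th : R) (k : nat) : 0 < th -> (Num.truncn (2 * pi / th) <= k)%N -> 2 * pi / k.+1%:R <= th.
Proof.
move=> th0 hq; rewrite ler_pdivrMr// [leRHS]mulrC -ler_pdivrMr//.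
by apply: ltW; apply: lt_le_trans (Num.Theory.truncnS_gt _) _; rewrite ler_nat.
Qed.

(** The fineness depends on [phi] and [chi] alone, not on the centre [p], because
translating a disc does not change its modulus of continuity. *)
Lemma riemann_step (phi : 'I_n -> {poly Cx R}) chi U (tau : R) : cutoff U chi -> 0 < tau -> exists q0 : nat, forall q : nat,
  (q0 <= q)%N -> forall p s, 0 <= s ->
  avg (fun t => chi (poly_disc p phi (expi t))) - tau <=
  q.+1%:R^-1 * \sum_(l < q.+1) chi (poly_disc p phi (expi (s + node R q l))).
Proof.
move=> cchi tau0; have [_ _ [L L0 hL]] := cchi.
have tL : 0 < tau / (L + 1) by rewrite divr_gt0// ltr_wpDl.
have [d d0 hd] := @uniform_continuity R V (fun z : Cx R => z *: poly_row phi z) _ (@compact_circle R)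
  (fun z _ => @scale_poly_row_continuous _ _ phi z) _ tL.
have [th th0 hth] := expi_close d0.
exists (Num.truncn (2 * pi / th)) => q q0 p s s0.
apply: (@riemann_sum R (fun t => chi (poly_disc p phi (expi t)))); last exact: s0.
- exact: cutoff_poly_disc_continuous cchi.
- by move=> u; rewrite expiD expi2pi mulr1.
- move=> u v uv; apply: le_trans (hL _ _) _.
  have -> : poly_disc p phi (expi u) - poly_disc p phi (expi v) =
      expi u *: poly_row phi (expi u) - expi v *: poly_row phi (expi v).
    by rewrite /poly_disc opprD addrACA subrr add0r.
  have h : rnorm (expi u *: poly_row phi (expi u) - expi v *: poly_row phi (expi v)) < tau / (L + 1).
    apply: hd; first exact: rnorm_expi.
    by apply: hth; apply: le_trans uv _; exact: small_arc.
  apply: (@le_trans _ _ (L * (tau / (L + 1)))); first by rewrite ler_wpM2l// ltW.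
  rewrite mulrA ler_pdivrMr ?ltr_wpDl// mulrC ler_wpM2l ?(ltW tau0)//.
  by rewrite lerDl.
Qed.

Lemma triple_bound p p' v x (rho : R) :
  rnorm (p - x) < rho -> rnorm (p' - x) < rho -> rnorm (v - x) < rho ->
  rnorm (v + (p' - p) - x) <= 3 * rho.
Proof.
move=> h1 h2 h3; rewrite addrAC; apply: le_trans (ler_rnormD _ _) _.
by have := ler_rdistD x p' p; rewrite (rdistC x); move: h1 h2 h3; clear; lra.
Qed.

Lemma sextuple_bound v y x (rho : R) :
  rnorm (v - x) <= 3 * rho -> rnorm (y - x) < rho -> rnorm (v - y) <= 6 * rho.
Proof.
move=> h1 h2; have := ler_rdistD x v y; have := rnorm_ge0 (y - x).
by rewrite (rdistC x y); move: h1 h2; clear; lra.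
Qed.

(** With [phi m] and [chi m] nearly optimal on the [m]-th arc, and [t] well inside
that arc, the glued disc at [expi t] is close to the disc of [phi m] centred at
[a + expi t *: b] and evaluated at [c * expi t ^+ N.+1].  Averaging over the
rotations [c] gives almost the mean of [chi m] over that disc by [riemann_step],
that is, almost [psi (a + expi t *: b)].  The set of the other [t] has small
measure.  Integrating in [t] bounds the mean of [psi] by an average of values of
the functional at discs centred at [a]. *)
Lemma glue_discs U x (rho : R) a b psi :
  (forall z, rnorm z = 1 -> rnorm (a + z *: b - x) < rho) -> continuous psi ->
  (forall p, rnorm (p - x) < rho -> psi p <= disc_value U x rho p) ->
  avg (fun t => psi (a + expi t *: b)) <= disc_value U x rho a.
Proof.
move=> inb psic psiE; apply/ler_addgt0Pr => e e0; set tau := e / 4.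
have tau0 : 0 < tau by rewrite divr_gt0.
have [del del0 hdel] := local_discs inb psic psiE tau0.
have rho0 : 0 < rho by apply: le_lt_trans (inb _ (rnorm_expi 0)); exact: rnorm_ge0.
have del2 : 0 < del / 2 by rewrite divr_gt0.
have [th0 th00 hth0] := expi_close del2.
(* neighbouring nodes of order M.+1 are del / 2 close on the circle *)
pose M := Num.truncn (2 * pi / th0).
have DM : 2 * pi / M.+1%:R <= th0.
  exact: small_arc.
pose pc m := cid (hdel _ (rnorm_expi (node R M m))).
pose phi m := projT1 (pc m); pose chi m := projT1 (cid (projT2 (pc m))).
have [cchi hchi] : (forall m, cutoff U (chi m)) /\ (forall m w, rnorm w = 1 ->
    rnorm (w - expi (node R M m)) < del ->
    (forall z, rnorm z = 1 -> rnorm (poly_disc (a + w *: b) (phi m) z - x) < rho - del) /\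
    psi (a + w *: b) - tau <= avg (fun t => chi m (poly_disc (a + w *: b) (phi m) (expi t)))).
  by split=> m; rewrite /chi /phi; case: cid => /= f [].
have [X cX hX] := cutoff_maxs M.+1 cchi.
have [L L0 hL] : exists2 L : R, 0 <= L & forall m p q, (m < M.+1)%N ->
    `|chi m p - chi m q| <= L * rnorm (p - q).
  have lip m : exists L : R, 0 <= L /\ forall p q, `|chi m p - chi m q| <= L * rnorm (p - q).
    by have [_ _ [L L0 hL]] := cchi m; exists L.
  pose L m := projT1 (cid (lip m)).
  have [L0 hL] : (forall m, 0 <= L m) /\
      (forall m p q, `|chi m p - chi m q| <= L m * rnorm (p - q)).
    by split=> m; rewrite /L; case: cid => /= L' [].
  exists (\sum_(m < M.+1) L m); first exact: sumr_ge0.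
  move=> m p q mM; apply: le_trans (hL m p q) _; rewrite ler_wpM2r ?rnorm_ge0//.
  by rewrite (bigD1 (Ordinal mM))//= lerDl sumr_ge0.
pose th := Num.min th0 (Num.min pi (tau / M.+2%:R)).
have thp : 0 < th by rewrite !lt_min th00 pi_gt0 divr_gt0.
have thpi : 0 <= th <= pi by rewrite (ltW thp) !ge_min lexx orbT.
have [thth0 thtau] : th <= th0 /\ th <= tau / M.+2%:R by rewrite !ge_min !lexx !orbT.
have kap1 : -1 <= cos th < 1.
  rewrite cos_geN1 cos_lt1// thp /=; apply: le_lt_trans (_ : pi < _) => //.
    by case/andP: thpi.
  by have := pi_gt0 R; clear; lra.
(* far nodes may send the glued disc at most eta times 3 * rho away from x, and at
   most eta times 6 * rho away from any of the discs *)
pose eta := Num.min (del / (6 * rho)) (tau / (6 * rho * (L + 1))).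
have L1 : 0 < L + 1 by rewrite ltr_wpDl.
have r6 : 0 < 6 * rho by rewrite mulr_gt0.
have eta0 : 0 < eta by rewrite lt_min !divr_gt0// mulr_gt0.
have eta1 : 3 * rho * eta < del.
  have : eta <= del / (6 * rho) by rewrite ge_min lexx.
  rewrite ler_pdivlMr// => h; rewrite (_ : 3 * rho * eta = eta * (6 * rho) / 2); last by field.
  by move: h del0; clear; lra.
have eta2 : L * (6 * rho * eta) <= tau.
  have : eta <= tau / (6 * rho * (L + 1)) by rewrite ge_min lexx orbT.
  rewrite ler_pdivlMr ?mulr_gt0// => h; apply: le_trans h.
  rewrite mulrA -[leLHS]mulrC; apply: ler_wpM2l; first exact: ltW.
  by rewrite mulrC ler_wpM2l ?(ltW r6)// lerDl.
have [N hN] := weight_concentration kap1 eta0.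
have [q hq] := @common_threshold (fun m (q : nat) => forall p s, 0 <= s ->
  avg (fun t => chi m (poly_disc p (phi m) (expi t))) - tau <=
  q.+1%:R^-1 * \sum_(l < q.+1) chi m (poly_disc p (phi m) (expi (s + node R q l)))) M.+1
  (fun m => riemann_step (phi m) (cchi m) tau0).
(* the disc attached to a fine node is that of the arc which contains it *)
pose bphi j := phi (block M N j); pose G c := glue b N c bphi.
have near t j : (j < N.+1)%N -> cos th < cos (t - node R N j) ->
    rnorm (expi t - expi (node R M (block M N j))) < del.
  move=> jN hc; have [_ b1 b2] := block_bound M jN.
  apply: le_lt_trans (ler_rdistD (expi (node R N j)) _ _) _.
  rewrite [ltRHS]splitr ltrD//.
    rewrite -ltr_sqr ?nnegrE ?rnorm_ge0 ?(ltW del2)// rdist_expi.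
    have : rnorm (expi th - expi 0) ^+ 2 < (del / 2) ^+ 2.
      rewrite ltr_sqr ?nnegrE ?rnorm_ge0 ?(ltW del2)// hth0//.
      by rewrite subr0 gtr0_norm.
    by rewrite rdist_expi subr0; move: hc; clear; lra.
  apply: hth0; apply: le_trans DM; rewrite ger0_norm ?subr_ge0//.
  by rewrite lerBlDl -nodeS ltW.
have inball j t z : rnorm z = 1 -> rnorm (poly_disc (a + expi t *: b) (bphi j) z - x) <= 3 * rho.
  move=> z1; have hs := rnorm_expi (node R M (block M N j)).
  have [|/(_ z z1) h _] := hchi (block M N j) _ hs; first by rewrite subrr rnorm0.
  rewrite (poly_disc_shift (a + expi (node R M (block M N j)) *: b)).
  apply: triple_bound; [exact: (inb _ hs)|exact: (inb _ (rnorm_expi t))|apply: lt_trans h _].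
  by rewrite gtrBl.
have unit (c : Cx R) (t : R) : rnorm c = 1 -> rnorm (c * expi t ^+ N.+1) = 1.
  by move=> c1; rewrite rnormM c1 rnormX rnorm_expi expr1n mulr1.
have Gin c : rnorm c = 1 -> circle_in_ball x rho a (G c).
  move=> c1 z /expi_surj[t _ ->].
  apply: (@le_lt_trans _ _ ((rho - del) + 3 * rho * eta)).
    apply: (glue_dist (hN t)).
    - have [|/(_ _ (rnorm_expi 0)) h _] := hchi 0 _ (rnorm_expi (node R M 0)).
        by rewrite subrr rnorm0.
      exact: le_trans (rnorm_ge0 _) (ltW h).
    - by rewrite mulr_ge0// ltW.
    - move=> j jN hc; apply: ltW.
      by have [+ _] := hchi _ _ (rnorm_expi t) (near _ _ jN hc); apply; exact: unit.
    - by move=> j jN; apply: inball; exact: unit.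
  by move: eta1; clear; lra.
pose c l := expi (node R q l).
(* X dominates all the chi m, so that one cutoff serves on every arc *)
pose A t := q.+1%:R^-1 * \sum_(l < q.+1) X (poly_disc a (G (c l)) (expi t)).
pose bad t : R := \sum_(m < M.+2) \1_(`[node R M m - th, node R M m + th]%classic) t.
have A0 t : 0 <= A t.
  by rewrite mulr_ge0 ?invr_ge0// sumr_ge0// => l _; case: cX => /(_ (poly_disc a (G (c l)) (expi t)))/andP[].
have key t : 0 <= t <= 2 * pi -> psi (a + expi t *: b) - 3 * tau - bad t <= A t.
  move=> t02; have pt := inb _ (rnorm_expi t).
  have [b1|[m mM tm]] := locate_good M t02 (ltW thp).
    have := psiE _ pt; have /andP[_] := disc_value01 U pt; have := A0 t.
    by move: b1 tau0; rewrite -/(bad t); clear; lra.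
  have bad0 : 0 <= bad t by apply: sumr_ge0 => i _; rewrite indicE.
  suff : psi (a + expi t *: b) - 3 * tau <= A t by move: bad0; clear; lra.
  have [|hb] := hchi m _ (rnorm_expi t).
    apply: lt_trans (_ : del / 2 < _); last by move: del0; clear; lra.
    apply: hth0; apply: le_trans DM.
    exact: locate_close (ltW thp) tm.
  have s0 : 0 <= t *+ N.+1 by rewrite mulrn_wge0//; case/andP: t02.
  move=> h1; have := hq m mM (a + expi t *: b) _ s0; move: h1; move: (avg _) => v h1 h2.
  suff h3 : q.+1%:R^-1 * \sum_(l < q.+1)
      chi m (poly_disc (a + expi t *: b) (phi m) (expi (t *+ N.+1 + node R q l))) <= A t + tau.
    have := le_trans h2 h3; move: h1; move: (psi _) (A t); clear => u1 u2; lra.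
  rewrite mulrC ler_pdivrMr// mulrDl {1}/A mulrC mulrA divff ?pnatr_eq0// mul1r.
  rewrite -[X in _ + tau * X%:R]card_ord mulr_natr -sumr_const -big_split /=.
  apply: ler_sum => l _; rewrite expiD -expiX [expi t ^+ _ * _]mulrC.
  set y := poly_disc _ _ _.
  have hy : rnorm (poly_disc a (G (c l)) (expi t) - y) <= 0 + 6 * rho * eta.
    apply: (glue_dist (hN t)) => //; first exact: ltW.
      move=> j jN /(block_near thpi mM jN tm); rewrite /bphi => ->.
      by rewrite -/(c l) subrr rnorm0.
    move=> j jN.
    apply: sextuple_bound (inball j t _ (unit _ t (rnorm_expi (node R q l)))) _.
    apply: lt_trans (hb _ (unit _ t (rnorm_expi (node R q l)))) _.
    by rewrite gtrBl.
  have := hX m (poly_disc a (G (c l)) (expi t)) mM.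
  have := hL m (poly_disc a (G (c l)) (expi t)) y mM.
  have : L * rnorm (poly_disc a (G (c l)) (expi t) - y) <= tau.
    by apply: le_trans eta2; rewrite ler_wpM2l// -[leRHS]add0r.
  by rewrite ler_norml => h /andP[]; move: h; clear; lra.
have Xi l : avg_integrable (fun t => X (poly_disc a (G (c l)) (expi t))).
  by apply: rintegrable_cont; exact: cutoff_poly_disc_continuous cX.
have Ai : avg_integrable A by apply: rintegrableZ; apply: rintegrable_sum => l; exact: Xi.
have psii : avg_integrable (fun t => psi (a + expi t *: b)).
  apply: rintegrable_cont => t; apply: (@continuous_comp _ _ _ (fun t => a + expi t *: b) psi).
    exact: circle_continuous.
  exact: psic.
have badi : avg_integrable bad by apply: rintegrable_sum => m; exact: rintegrable_indic.
have badle : avg bad <= tau by exact: avg_bad.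
have avgA : avg A <= disc_value U x rho a.
  rewrite /A avgZ; last by apply: rintegrable_sum => l; exact: Xi.
  rewrite avg_sum// mulrC ler_pdivrMr// mulr_natr -[X in _ *+ X]card_ord -sumr_const.
  by apply: ler_sum => l _; apply: disc_value_ge => //; apply: Gin; exact: rnorm_expi.
have := le_avg _ Ai key; rewrite avgB//; last by apply: rintegrableB => //; exact: rintegrable_cst.
rewrite avgB ?avg_cst//; last exact: rintegrable_cst.
have -> : e = 4 * tau by rewrite /tau; field.
move=> /(_ ltac:(by apply: rintegrableB => //; apply: rintegrableB => //; exact: rintegrable_cst)).
by move: badle avgA; clear; lra.
Qed.

End Gluing.

(** * Plurisubharmonicity of the disc functional *)

Section Submean.
Context (R : realType) (n : nat).
Local Notation V := 'rV[Cx R]_n.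
Local Notation mu := (@lebesgue_measure R).
Local Notation avg_integrable := (@rintegrable R 0 (2 * pi)).
Implicit Types (p q x a b : V) (U : set V).

(** Continuous functions that increase to [disc_value], which is only lower
semicontinuous, while [glue_discs] compares it with continuous functions. *)
Definition approx_below U x (rho : R) (k : nat) p : R :=
  - supconv [set q | rnorm (q - x) < rho] (fun q => - disc_value U x rho q) k%:R p.

Lemma approx_belowP U x (rho : R) : 0 < rho ->
  [/\ forall k, continuous (approx_below U x rho k),
      forall k p, 0 <= approx_below U x rho k p,
      forall k p, rnorm (p - x) < rho -> approx_below U x rho k p <= disc_value U x rho p,
      forall p k k', (k <= k')%N -> approx_below U x rho k p <= approx_below U x rho k' p &
      forall p, rnorm (p - x) < rho ->
        approx_below U x rho k p @[k --> \oo] --> disc_value U x rho p].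
Proof.
move=> rho0; pose S := [set q : V | rnorm (q - x) < rho].
have S0 : S !=set0 by exists x; rewrite /S /= subrr rnorm0.
have wM : forall q, S q -> - disc_value U x rho q <= 0.
  by move=> q /(disc_value01 U)/andP[+ _]; rewrite oppr_le0.
have SC q : S q -> rnorm (q - x) <= rho by move/ltW.
have le k p : S p -> approx_below U x rho k p <= disc_value U x rho p.
  by move=> Sp; rewrite /approx_below lerNl; exact: (supconv_self wM).
have mono p k k' : (k <= k')%N -> approx_below U x rho k p <= approx_below U x rho k' p.
  by move=> kk; rewrite lerN2; apply: (supconv_anti (M := 0)) => //; rewrite ler_nat.
split=> //.
- by move=> k p; apply: continuousN; exact: (supconv_continuous S0 wM _ SC).
- move=> k p; rewrite oppr_ge0; apply: supconv_le => // q /wM h.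
  by rewrite subr_le0 (le_trans h)// mulr_ge0// sqr_enorm_ge0.
- move=> p Sp; apply/cvgrPdist_le => e e0.
  have [|d d0 hd] := @disc_value_lsc R n U x rho p (disc_value U x rho p - e) Sp.
    by rewrite gtrBl.
  have [|k0 k00 hk] := @supconv_usc R n S _ 0 p (- (disc_value U x rho p - e)) d S0 wM d0.
    by move=> y Sy /hd/ltW; rewrite lerN2.
  exists (Num.truncn k0).+1 => // k /= kk.
  have kr : k0 <= k%:R.
    by apply/ltW/(lt_le_trans (Num.Theory.truncnS_gt _)); rewrite ler_nat.
  rewrite ger0_norm ?subr_ge0 ?le//.
  by have := hk _ kr; rewrite /approx_below -/S; clear; lra.
Qed.

Lemma disc_value_submean U x (rho : R) a b :
  (forall z, rnorm z = 1 -> rnorm (a + z *: b - x) < rho) ->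
  (\int[mu]_(t in `[0%R, (2 * pi)%R]) (disc_value U x rho (a + expi t *: b))%:E <=
   (2 * pi * disc_value U x rho a)%:E)%E.
Proof.
move=> inb; have h2 := twopi_gt0 R.
have rho0 : 0 < rho by apply: le_lt_trans (inb _ (rnorm_expi 0)); exact: rnorm_ge0.
have [c0 ge0 le mono lim] := approx_belowP U x rho0.
pose h k t := approx_below U x rho k (a + expi t *: b).
have hc k : continuous (h k).
  move=> t; apply: (@continuous_comp _ _ _ (fun t => a + expi t *: b) (approx_below U x rho k)).
    exact: circle_continuous.
  exact: c0.
have mh k : measurable_fun `[0%R, (2 * pi)%R]%classic (EFin \o h k).
  by case/integrableP: (rintegrable_cont 0 (2 * pi) (hc k)).
have -> : (\int[mu]_(t in `[0%R, (2 * pi)%R]) (disc_value U x rho (a + expi t *: b))%:E =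
    \int[mu]_(t in `[0%R, (2 * pi)%R]) limn (fun k => (h k t)%:E))%E.
  apply: eq_integral => t _; apply/esym/cvg_lim => //.
  apply: cvg_EFin; first by exists 0.
  by apply: lim; exact/inb/rnorm_expi.
rewrite monotone_convergence//; last 2 first.
- by move=> k t _; rewrite lee_fin ge0.
- by move=> t _ k k' kk; rewrite lee_fin mono.
apply: lime_le.
  apply: ereal_nondecreasing_is_cvgn => k k' kk; apply: ge0_le_integral => //.
  - by move=> t _; rewrite lee_fin ge0.
  - exact: mh.
  - exact: mh.
  - by move=> t _; rewrite lee_fin mono.
exists 0 => // k _ /=.
have -> : (\int[mu]_(t in `[0%R, (2 * pi)%R]) (h k t)%:E = (rint 0 (2 * pi) (h k))%:E)%E.
  rewrite /rint /Rintegral fineK//; apply: integrable_fin_num => //.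
  exact: rintegrable_cont (hc k).
have := glue_discs inb (c0 k) (le k).
by rewrite lee_fin /avg ler_pdivrMl.
Qed.

Lemma disc_value_psh U x (rho : R) :
  plurisubharmonic [set p | rnorm (p - x) < rho] (fun p => (- disc_value U x rho p)%:E).
Proof.
have usc : usc_on [set p | rnorm (p - x) < rho] (fun p => (- disc_value U x rho p)%:E).
  move=> p px c; rewrite lte_fin ltrNl => /(disc_value_lsc px)[d d0 hd].
  by apply/nbhs_rnormP; exists d => // q /hd; rewrite lte_fin ltrNl.
split=> [p _|//|a b]; first exact: ltry.
split=> [l _|l Dl c hc|l0 r r0 Dr]; first exact: ltry.
  exact: line_continuous (usc _ Dl c hc).
pose a' := a + l0 *: b; pose b' := (r%:C%C : Cx R) *: b.
have E t : a + (l0 + r%:C%C * expi t) *: b = a' + expi t *: b'.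
  by rewrite /a' /b' scalerDl addrA scalerA mulrC.
have inb z : rnorm z = 1 -> rnorm (a' + z *: b' - x) < rho.
  move=> z1; have := Dr (l0 + r%:C%C * z); rewrite /a' /b' scalerA [z * _]mulrC -[a + _ + _]addrA -scalerDl.
  apply; rewrite /closed_disc /= addrAC subrr add0r rnormE lecR rnormM rnormR z1 mulr1.
  by rewrite ger0_norm// ltW.
rewrite /circle_mean; under eq_integral => t _ do rewrite E EFinN.
have h2 := twopi_gt0 R.
rewrite integral_ge0N; last first.
  move=> t _; rewrite lee_fin.
  by case/andP: (disc_value01 U (inb _ (rnorm_expi t))).
rewrite muleN EFinN leeN2.
apply: le_trans (lee_wpmul2l _ (disc_value_submean U inb)) _.
  by rewrite lee_fin invr_ge0 ltW.
by rewrite -EFinM lee_fin mulKf// gt_eqF.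
Qed.

Lemma derivable_row (f : Cx R -> V) (z : Cx R) :
  (forall i, exists c, cderiv (fun u => f u ord0 i) z c) -> derivable f z 1.
Proof.
move=> fd; pose l : V := \row_i projT1 (cid (fd i)).
apply/cvg_ex; exists l => A /nbhs_rnormP[e e0 eA].
have H : \forall h \near 0^', forall i : 'I_n,
    rnorm (h^-1 *: (f (h + z) ord0 i - f z ord0 i) - l ord0 i) < e.
  apply: filter_forall => i; rewrite mxE; case: cid => a /= /cderivP fa.
  apply: (fa [set w | rnorm (w - a) < e]).
  by apply/nbhs_rnormP; exists e.
apply: filterS H => h hh; apply: eA; apply/rnorm_row_lt => // i.
by have := hh i; rewrite !mxE [h *: 1]mulr1.
Qed.

Lemma poly_disc_holo p phi (z : Cx R) : derivable (poly_disc p phi) z 1.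
Proof.
apply: derivable_row => j; exists ('X * phi j)^`().[z].
have -> : (fun u => poly_disc p phi u ord0 j) = (fun u => p ord0 j + ('X * phi j).[u]).
  by rewrite funeqE => u; rewrite !mxE hornerM hornerX.
rewrite -[X in cderiv _ _ X]add0r.
exact: (cderivD (cderiv_cst (p ord0 j) z) (cderiv_horner ('X * phi j) z)).
Qed.

Lemma poly_disc_max_modulus x (rho : R) phi : 0 < rho -> circle_in_ball x rho x phi ->
  forall z, rnorm z <= 1 -> rnorm (poly_disc x phi z - x) < rho.
Proof.
move=> rho0 inb z z1; apply/rnorm_row_lt => // i.
have E w : (poly_disc x phi w - x) ord0 i = ('X * phi i).[w].
  by rewrite addrAC subrr add0r !mxE hornerM hornerX.
rewrite E; apply: poly_max_modulus z1 => w w1; rewrite -E.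
by have /rnorm_row_lt := inb w w1; apply.
Qed.

Lemma avg_cutoff_arc_length U chi (g : Cx R -> V) : open U -> cutoff U chi ->
  continuous (fun t => g (expi t)) ->
  ((avg (fun t => chi (g (expi t))))%:E <= arc_length (@unit_circle R `&` g @^-1` U))%E.
Proof.
move=> oU cchi gc; have h2 := twopi_gt0 R.
pose A := `[0, 2 * pi[%classic `&` [set t | U (g (expi t))].
have mA : measurable A.
  apply: measurableI => //; apply: measurable_realfun.open_measurable.
  by apply: open_comp => [t _|//]; exact: gc.
have AE : A `&` `[0, 2 * pi]%classic = A.
  apply/setIidl => t [+ _]; rewrite /= !in_itv/= => /andP[-> /ltW].
  by [].
have -> : arc_length (@unit_circle R `&` g @^-1` U) = (avg \1_A)%:E.
  rewrite avg_indic// AE EFinM fineK; last first.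
    by rewrite ge0_fin_numE// -AE; exact: indic_circle_fin.
  congr (_ * mu _)%E; rewrite /A; congr (_ `&` _); apply/seteqP; split=> t /=; first by case.
  by move=> Ut; split=> //; rewrite /unit_circle /= rnormE rnorm_expi.
(* means run over a closed interval, arc lengths over a half-open one: the endpoint
   is added as a null set *)
have -> : avg \1_A = avg (fun t => \1_A t + \1_[set 2 * pi] t).
  rewrite avgD; [|exact: rintegrable_indic|exact: rintegrable_indic].
  rewrite [X in _ + X]avg_indic// [X in mu X](_ : _ = [set 2 * pi]).
    by rewrite lebesgue_measure_set1 mulr0 addr0.
  by apply/setIidl => t ->; rewrite /= in_itv/= lexx ltW.
have [c01 c0 _] := cchi.
rewrite lee_fin; apply: le_avg.
- apply: rintegrable_cont => t; apply: (@continuous_comp _ _ _ (fun t => g (expi t)) chi).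
    exact: gc.
  exact: cutoff_continuous cchi _.
- by apply: rintegrableD; exact: rintegrable_indic.
move=> t /andP[t0 t2]; rewrite !indicE.
have [Ut|nU] := pselect (U (g (expi t))); last first.
  by rewrite c0// addr_ge0.
have /andP[_ c1] := c01 (g (expi t)); apply: le_trans c1 _.
have [tl|tl] := ltP t (2 * pi).
  rewrite [t \in A]mem_set ?lerDl//.
  by split=> //=; rewrite in_itv/= t0.
rewrite [t \in [set _]]mem_set ?lerDr//=.
by apply/eqP; rewrite eq_le t2.
Qed.

(** The opposite of the disc functional is plurisubharmonic near [x] and equal to -1
on [U], so non-thinness gives the functional the value 1 at [x]; a disc and a
cutoff whose mean exceeds [1 - eps] do the job, a cutoff being at most the indicator
of [U]. *)
Lemma nonthin_discs U x : open U -> nonthin U x ->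
  discs_mostly_in U x.
Proof.
move=> oU [_ nt] eps eps0 B /nbhs_rnormP[rho rho0 hB].
pose W := [set p : V | rnorm (p - x) < rho].
have Wx : W x by rewrite /W /= subrr rnorm0.
have nW p : W p -> nbhs p W.
  move=> Wp; apply/nbhs_rnormP; exists (rho - rnorm (p - x)); first by rewrite subr_gt0.
  by move=> q qp; have := ler_rdistD p q x; rewrite /W /=; move: qp; clear; lra.
have oW : open W by rewrite openE.
have Ex : 1 <= disc_value U x rho x.
  have := nt W _ oW Wx (disc_value_psh U x rho).
  move=> h; rewrite -lerN2 -lee_fin -h.
  have r20 : 0 < rho / 2 by rewrite divr_gt0.
  apply: ge_ereal_inf; eexists; first by exists (rho / 2).
  apply: ge_ereal_sup => _ [y [Ey [Uy _]] <-].
  rewrite lee_fin lerN2 disc_value_in//.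
  by apply: le_lt_trans (eball_rnorm (ltW r20) Ey) _; move: rho0; clear; lra.
have [|phi [chi [cchi inb lt]]] := @disc_value_adherent R n U x rho x (1 - eps) Wx.
  by apply: lt_le_trans Ex; rewrite gtrBl.
have inW z : rnorm z <= 1 -> B (poly_disc x phi z).
  by move=> /(poly_disc_max_modulus rho0 inb)/hB.
exists (poly_disc x phi); split.
- split; first by exists setT => [|z _]; [split=> //; exact: openT|exact: poly_disc_holo].
  by move=> _ [z z1 <-]; apply: inW; move: z1; rewrite /closed_disc /= subr0 rnormE lecR.
- by rewrite /poly_disc scale0r addr0.
- have -> : @unit_circle R `&` poly_disc x phi @^-1` (B `&` U) = @unit_circle R `&` poly_disc x phi @^-1` U.
    apply/seteqP; split=> z [z1]; first by case.
    move=> Uz; split=> //; split=> //; apply: inW.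
    by move: z1; rewrite /unit_circle /= rnormE => -[->].
  rewrite -lte_fin in lt; apply: lt_le_trans lt (avg_cutoff_arc_length oU cchi _).
  move=> t; apply: (@continuous_comp _ _ _ (@expi R) (poly_disc x phi)).
    exact: continuous_expi.
  exact: poly_disc_continuous.
Qed.

End Submean.

Theorem theorem5 (R : realType) (n : nat) (hn : (0 < n)%N)
    (U : set 'rV[Cx R]_n) (hU : open U) (x : 'rV[Cx R]_n) :
  nonthin U x <->
  (forall eps : R, 0 < eps ->
   forall V : set 'rV[Cx R]_n, nbhs x V ->
   exists f : Cx R -> 'rV[Cx R]_n,
     [/\ holo_closed_disc V f,
         f 0 = x &
         ((1 - eps)%:E <
          arc_length (@unit_circle R `&` f @^-1` (V `&` U)))%E]).
Proof. by split; [exact: nonthin_discs|exact: discs_nonthin]. Qed.
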